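(* Let $E$ be a locally complete locally convex Hausdorff space over $\mathbb{C}$, $z\in\mathbb{C}^{d}$ and $R\in(0,\infty)^{d}$. Then the following statements hold. a) The tensor product $\mathcal{P}(\overline{\mathbb{D}_R(z)},\mathbb{C})\otimes E$ is dense in $\mathcal{A}(\overline{\mathbb{D}_R(z)},E)$. b) If $E$ is complete, then \[ \mathcal{A}(\overline{\mathbb{D}_R(z)},E)\cong\mathcal{A}(\overline{\mathbb{D}_R(z)})\,\varepsilon\, E\cong\mathcal{A}(\overline{\mathbb{D}_R(z)})\,\widehat{\otimes}_{\varepsilon}\,E, \] where $\cong$ stands for topologically isomorphic and $\mathcal{A}(\overline{\mathbb{D}_R(z)})\widehat{\otimes}_{\varepsilon}E$ is the completion of the injective tensor product $\mathcal{A}(\overline{\mathbb{D}_R(z)})\otimes_{\varepsilon}E$. c) $\mathcal{A}(\overline{\mathbb{D}_R(z)})$ has the approximation property.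
   Context: $E$ is a non-trivial locally convex Hausdorff space with directed fundamental system of seminorms $(p_\alpha)_{\alpha\in\mathfrak{A}}$ and completion $\widehat{E}$. For a bounded, absolutely convex set (disk) $D\subset E$ put $E_D:=\bigcup_{n\in\mathbb{N}}nD$ normed by the gauge of $D$; $E$ is locally complete if $E_D$ is a Banach space for every closed disk $D$. $\mathbb{D}_R(z)=\prod_{k=1}^d\{\zeta\in\mathbb{C}:|\zeta-z_k|<R_k\}$. $\mathcal{A}(\overline{\mathbb{D}_R(z)},E)$ is the space of continuous functions $\overline{\mathbb{D}_R(z)}\to E$ whose restriction to $\mathbb{D}_R(z)$ lies in $\mathcal{O}(\mathbb{D}_R(z),E)$, with the seminorms $\|f\|_\alpha:=\sup_{w\in\overline{\mathbb{D}_R(z)}}p_\alpha(f(w))$, $\alpha\in\mathfrak{A}$; $\mathcal{A}(\overline{\mathbb{D}_R(z)}):=\mathcal{A}(\overline{\mathbb{D}_R(z)},\mathbb{C})$. Here, for $\Omega\subset\mathbb{C}^d$ open, $\mathcal{O}(\Omega,E)$ is the space of functions $f\colon\Omega\to E$ such that $f\circ\phi^{-1}$ is continuously partially differentiable on $\phi(\Omega)$ with values in $E$ and all complex partial derivatives $\partial^\beta_{\mathbb{C}}f(z)$, $\beta\in\mathbb{N}_0^d$, $z\in\Omega$, exist in $E$ ($\partial^{\beta}_{\mathbb{C}}$ denotes iterated complex partial derivatives, and $\phi(z)=(\operatorname{Re}z_1,\operatorname{Im}z_1,\dots,\operatorname{Re}z_d,\operatorname{Im}z_d)$). For locally complete $E$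 this is the space of holomorphic functions $\Omega\to E$. $\mathcal{P}(\overline{\mathbb{D}_R(z)},\mathbb{C})$ is the space of complex polynomials in $d$ variables restricted to $\overline{\mathbb{D}_R(z)}$; $\mathcal{P}(\overline{\mathbb{D}_R(z)},\mathbb{C})\otimes E$ is identified with the space of functions $w\mapsto\sum_{k=1}^nq_k(w)x_k$, $q_k$ polynomials, $x_k\in E$ (the $E$-valued polynomials). For locally convex Hausdorff spaces $F$ and $E$, $F\varepsilon E:=L_e(F_\kappa',E)$ is the space of continuous linear operators from $F_\kappa'$ to $E$, where $F'_\kappa$ is $F'$ with the topology of uniform convergence on absolutely convex compact subsets of $F$, equipped with the topology of uniform convergence on equicontinuous subsets of $F'$. *)

(* Defs.v *)
From HB Require Import structures.
From mathcomp Require Import all_boot all_order all_algebra.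
From mathcomp Require Import all_classical all_reals all_analysis.
From mathcomp Require Import complex.
From mathcomp Require mpoly.

Set Implicit Arguments.
Unset Strict Implicit.
Unset Printing Implicit Defensive.

Import Order.TTheory GRing.Theory Num.Theory numFieldNormedType.Exports.
Import ComplexField.Normc.

Local Open Scope classical_set_scope.
Local Open Scope ring_scope.
Local Open Scope complex_scope.

Section Seminorms.
Variable R : realType.

Lemma normCE (a : R[i]) : `|a| = (normc a)%:C.
Proof. by case: a. Qed.

Lemma normc_ge0 (a : R[i]) : 0 <= normc a.
Proof. by case: a => a b /=; exact: sqrtr_ge0. Qed.

Lemma normc_pos (r : R) : 0 <= r -> normc r%:C = r.
Proof. by move=> r0; rewrite /= expr0n addr0 sqrtr_sqr ger0_norm. Qed.

Lemma linear_fun0 (U V : lmodType R[i]) (f : U -> V) : linear f -> f 0 = 0.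
Proof.
move=> /(_ 1 0 0); rewrite !scale1r addr0 => /esym /(canRL (addrK _)).
by rewrite subrr.
Qed.

Record seminorm (V : lmodType R[i]) := Seminorm {
  sn_fun :> V -> R;
  snZ : forall (a : R[i]) x, sn_fun (a *: x) = normc a * sn_fun x;
  snD : forall x y, sn_fun (x + y) <= sn_fun x + sn_fun y }.

Section SeminormTheory.
Variables (V : lmodType R[i]) (p : seminorm V).

Lemma sn0 : p 0 = 0.
Proof. by rewrite -(scale0r (0 : V)) snZ normc0 mul0r. Qed.

Lemma snN x : p (- x) = p x.
Proof. by rewrite -scaleN1r snZ normcN normc1 mul1r. Qed.

Lemma sn_ge0 x : 0 <= p x.
Proof.
have := snD p x (- x); rewrite subrr sn0 snN.
by rewrite -mulr2n pmulrn_lge0.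
Qed.

End SeminormTheory.

(* The locally convex space [V] topologised by the seminorms [q i]; the family
   is not assumed directed, so basic neighbourhoods are cut out by finitely
   many seminorms. *)
Definition lcs (V : lmodType R[i]) (I : Type) (q : I -> seminorm V) : Type := V.

Section Lcs.
Variables (V : lmodType R[i]) (I : Type) (q : I -> seminorm V).

HB.instance Definition _ := GRing.Lmodule.copy (lcs q) V.

Definition lcs_ball (s : seq I) (e : R) (x : V) : set V :=
  [set y | all (fun i => q i (y - x) < e) s].

Definition lcs_nbhs (x : lcs q) : set_system (lcs q) :=
  [set U | exists s e, 0 < e /\ lcs_ball s e x `<=` U].

HB.instance Definition _ := hasNbhs.Build (lcs q) lcs_nbhs.

Lemma lcs_ball_center s e x : 0 < e -> lcs_ball s e x x.
Proof.
move=> e0; rewrite /lcs_ball /=; elim: s => //= i s ->.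
by rewrite subrr sn0 e0.
Qed.

Lemma lcs_ball_le s e e' x : e <= e' -> lcs_ball s e x `<=` lcs_ball s e' x.
Proof.
move=> ee y; rewrite /lcs_ball /=; apply: sub_all => i /lt_le_trans; exact.
Qed.

Lemma lcs_ball_cat s t e x :
  lcs_ball (s ++ t) e x = lcs_ball s e x `&` lcs_ball t e x.
Proof.
rewrite /lcs_ball; apply/seteqP; split=> y /=; first by rewrite all_cat => /andP.
by rewrite all_cat => /andP.
Qed.

Lemma lcs_ball_open s e x y : lcs_ball s e x y ->
  exists e', 0 < e' /\ lcs_ball s e' y `<=` lcs_ball s e x.
Proof.
rewrite /lcs_ball /=; elim: s => [_|i s ih /= /andP[hi /ih[e' [e'0 he']]]].
  by exists 1; split.
exists (Num.min e' (e - q i (y - x))); split.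
  by rewrite lt_min e'0 subr_gt0 hi.
move=> z /= /andP[]; rewrite lt_min => /andP[_ hz] hs; apply/andP; split.
  rewrite -(subrK y z) -addrA (le_lt_trans (snD _ _ _))//.
  by rewrite -ltrBrDr.
apply: he'; move: hs; apply: sub_all => j /lt_le_trans; apply.
by rewrite ge_min lexx.
Qed.

Lemma lcs_nbhs_filter (x : lcs q) : ProperFilter (nbhs x).
Proof.
split; first by move=> [s [e [e0 /(_ x)]]]; apply; exact: lcs_ball_center.
split.
- by exists [::], 1; split.
- move=> P Q [s [e [e0 hP]]] [t [f [f0 hQ]]].
  exists (s ++ t), (Num.min e f); split; first by rewrite lt_min e0.
  move=> y; rewrite lcs_ball_cat => -[ys yt]; split.
    by apply: hP; apply: lcs_ball_le ys; rewrite ge_min lexx.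
  by apply: hQ; apply: lcs_ball_le yt; rewrite ge_min lexx orbT.
- move=> P Q PQ [s [e [e0 hP]]]; exists s, e; split=> //.
  exact: subset_trans PQ.
Qed.

Lemma lcs_nbhs_singleton (x : lcs q) (A : set (lcs q)) : nbhs x A -> A x.
Proof. by move=> [s [e [e0]]]; apply; exact: lcs_ball_center. Qed.

Lemma lcs_nbhs_nbhs (x : lcs q) (A : set (lcs q)) :
  nbhs x A -> nbhs x (nbhs^~ A).
Proof.
move=> [s [e [e0 h]]]; exists s, e; split => // y /lcs_ball_open[e' [e'0 h']].
by exists s, e'; split => //; exact: subset_trans h.
Qed.

HB.instance Definition _ := Nbhs_isNbhsTopological.Build (lcs q)
  lcs_nbhs_filter lcs_nbhs_singleton lcs_nbhs_nbhs.

Lemma lcs_ball_nbhs s e x : 0 < e -> nbhs (x : lcs q) (lcs_ball s e x).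
Proof. by move=> e0; exists s, e; split. Qed.

Lemma lcs_add_continuous : continuous (fun x : lcs q * lcs q => x.1 + x.2).
Proof.
move=> [x y] /= U [s [e [e0 hU]]].
have e20 : 0 < e / 2 by rewrite divr_gt0.
exists (lcs_ball s (e / 2) x, lcs_ball s (e / 2) y).
  by split; exact: lcs_ball_nbhs.
move=> [u v] /= [hu hv]; apply: hU; rewrite /lcs_ball /= in hu hv *.
elim: s hu hv => //= i s ih /andP[a b] /andP[c f].
rewrite ih // andbT opprD addrACA (le_lt_trans (snD _ _ _))//.
by rewrite (splitr e) ltrD.
Qed.

Lemma lcs_scale_continuous :
  continuous (fun z : (R[i])^o * lcs q => z.1 *: z.2).
Proof.
move=> [a x] /= U [s [e [e0 hU]]].
have [M [M0 hM]] : exists M, 0 < M /\ all (fun i => q i x < M) s.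
  elim: s {hU} => [|i s [M [M0 hM]]]; first by exists 1.
  exists (Num.max M (q i x + 1)); split; first by rewrite lt_max M0.
  rewrite /= lt_max ltrDl ltr01 orbT /=; move: hM; apply: sub_all => j hj.
  by rewrite lt_max hj.
set N := normc a + 1.
have N0 : 0 < N by rewrite ltr_wpDl // normc_ge0.
have e2M : 0 < e / 2 / M by rewrite !divr_gt0.
set del := Num.min 1 (e / 2 / M).
have del0 : 0 < del by rewrite lt_min ltr01 e2M.
exists ([set b : R[i]^o | normc (a - b) < del], lcs_ball s (e / 2 / N) x).
  split; last by apply: lcs_ball_nbhs; rewrite !divr_gt0.
  apply/nbhs_ballP; exists del%:C; first by rewrite /= ltcR.
  by move=> b; rewrite /ball /= normCE ltcR.
move=> [b y] /= [hb hy]; apply: hU; rewrite /lcs_ball /= in hy *.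
elim: s hy hM => //= i s ih /andP[h1 h2] /andP[h3 h4].
rewrite ih // andbT.
have -> : b *: y - a *: x = b *: (y - x) + (- (a - b)) *: x.
  by rewrite scalerBr opprB scalerBl addrA subrK.
rewrite (le_lt_trans (snD _ _ _))// !snZ normcN (splitr e).
have hbN : normc b <= N.
  rewrite -(subrK a b) addrC (le_trans (le_normcD _ _))// lerD2l.
  rewrite -normcN opprB (le_trans (ltW hb))//.
  by rewrite ge_min lexx.
rewrite ltr_leD //.
  rewrite (le_lt_trans (ler_wpM2r (sn_ge0 _ _) hbN))//.
  by rewrite mulrC -ltr_pdivlMr.
have nn : 0 <= normc (a - b) by exact: normc_ge0.
rewrite (le_trans (ler_wpM2l nn (ltW h3)))// -ler_pdivlMr //.
by rewrite (le_trans (ltW hb))// ge_min lexx orbT.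
Qed.

Lemma lcs_locally_convex : exists2 B : set_system (lcs q),
  (forall b, b \in B -> convex_set b) & basis B.
Proof.
exists [set U | exists s e (x : lcs q), U = lcs_ball s e x].
  move=> U; rewrite inE => -[s [e [x ->]]] y z l; rewrite !inE /lcs_ball /=.
  have l0 : 0 <= l%:num by [].
  have l1 : 0 <= 1 - l%:num by rewrite subr_ge0.
  have ln : normc (l%:num) + normc (1 - l%:num) = 1.
    have : (normc l%:num + normc (1 - l%:num))%:C = 1%:C.
      by rewrite rmorphD /= -!normCE !ger0_norm // addrC subrK.
    by move=> /complexI.
  elim: s => //= i s ih /andP[h1 h2] /andP[h3 h4]; rewrite ih // andbT.
  have -> : conv l y z - x = l%:num *: (y - x) + (1 - l%:num) *: (z - x).
    rewrite !scalerBr addrACA -opprD -scalerDl [l%:num + _]addrC subrK scale1r.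
    by [].
  rewrite (le_lt_trans (snD _ _ _))// !snZ -[e]mul1r -ln mulrDl.
  have [n0|n0] := eqVneq (normc l%:num) 0.
    rewrite n0 !mul0r !add0r; move: ln; rewrite n0 add0r => ->.
    by rewrite !mul1r.
  rewrite ltr_leD //.
    by rewrite ltr_pM2l // lt_def n0 normc_ge0.
  by rewrite ler_wpM2l ?normc_ge0 // ltW.
split.
  move=> U [s [e [x ->]]]; rewrite openE => y /lcs_ball_open[e' [e'0 h']].
  by exists s, e'.
move=> x U [s [e [e0 h]]]; exists (lcs_ball s e x) => //.
by split; [exists s, e, x | exact: lcs_ball_center].
Qed.

HB.instance Definition _ := PreTopologicalLmod_isTvs.Build R[i] (lcs q)
  lcs_add_continuous lcs_scale_continuous lcs_locally_convex.
HB.instance Definition _ :=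
  PreTopologicalNmodule_isTopologicalNmodule.Build (lcs q) lcs_add_continuous.
HB.instance Definition _ := TopologicalNmodule_isTopologicalLmodule.Build
  R[i] (lcs q) lcs_scale_continuous.
HB.instance Definition _ :=
  Uniform_isTvs.Build R[i] (lcs q) lcs_locally_convex.
End Lcs.

Record cseminorm (E : tvsType R[i]) := CSeminorm {
  csn_sn :> seminorm E;
  csn_cont : continuous (csn_sn : E -> R) }.

(* Since the family is directed, a single seminorm cuts out a basic
   neighbourhood; that the [p i] do not define a finer topology than that of [E]
   is part of [cseminorm]. *)
Definition directed_fundamental (E : tvsType R[i]) (I : Type)
    (p : I -> cseminorm E) :=
  (forall i j, exists k (c : R), 0 < c /\
     forall x, p i x <= c * p k x /\ p j x <= c * p k x) /\
  (forall U : set E, nbhs 0 U ->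
     exists i (e : R), 0 < e /\ [set x | p i x < e] `<=` U).

Section Sets.
Variable E : tvsType R[i].

Definition absolutely_convex (D : set E) :=
  forall (x y : E) (a b : R[i]), D x -> D y -> `|a| + `|b| <= 1 ->
    D (a *: x + b *: y).

Definition bounded (D : set E) :=
  forall U : set E, nbhs 0 U ->
    exists t : R, 0 < t /\ D `<=` [set t%:C *: x | x in U].

Definition disk (D : set E) := bounded D /\ absolutely_convex D.

Definition disk_span (D : set E) : set E :=
  [set x | exists n : nat, exists2 y, D y & x = n%:R *: y].

Definition gauge (D : set E) (x : E) : R :=
  inf [set t : R | 0 < t /\ exists2 y, D y & x = t%:C *: y].

(* The normed space [(disk_span D, gauge D)] is complete; on it [gauge D] is a
   norm because D is bounded and E Hausdorff. *)
Definition banach_disk (D : set E) :=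
  forall u : nat -> E, (forall n, disk_span D (u n)) ->
    (forall e : R, 0 < e -> exists N, forall m n, (N <= m)%N -> (N <= n)%N ->
       gauge D (u m - u n) < e) ->
    exists2 l, disk_span D l & (fun n => gauge D (u n - l)) @ \oo --> (0 : R).

Definition locally_complete :=
  forall D : set E, closed D -> disk D -> banach_disk D.

(* Completeness refers to the translation-invariant uniformity: the uniform
   structure of a [tvsType] is only required to induce the right topology. *)
Definition tvs_complete :=
  forall F : set_system E, ProperFilter F ->
    (forall U : set E, nbhs 0 U ->
       exists2 A, F A & forall x y, A x -> A y -> U (x - y)) ->
    exists l : E, F --> l.

End Sets.

Definition topologically_isomorphic (X Y : tvsType R[i]) :=
  exists (f : {linear X -> Y}) (g : {linear Y -> X}),
    [/\ cancel f g, cancel g f, continuous f & continuous g].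

Definition is_completion (X W : tvsType R[i]) (f : {linear X -> W}) :=
  [/\ hausdorff_space W, tvs_complete W, injective f,
      forall x (U : set X),
        nbhs x U <-> exists2 V, nbhs (f x) V & f @^-1` V `<=` U
    & dense (range f)].

Lemma cvg_lincomb (T : Type) (F : set_system T) (FF : Filter F)
    (E : tvsType R[i]) (a : R[i]) (u v : T -> E) (x y : E) :
  u @ F --> x -> v @ F --> y ->
  (fun t => a *: u t + v t) @ F --> a *: x + y.
Proof.
move=> ux vy.
have sc : (fun t => a *: u t) @ F --> a *: x.
  apply: (@cvg_comp _ _ _ (fun t => (a : R[i]^o, u t)) (fun z => z.1 *: z.2)
    F (nbhs (a : R[i]^o, x))); last exact: (@scale_continuous _ E (a, x)).
  have ca : (fun _ : T => a : R[i]^o) @ F --> (a : R[i]^o) by exact: cvg_cst.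
  exact: (@cvg_pair _ _ _ F (nbhs (a : R[i]^o)) (nbhs x) FF _ _ _ _ ca ux).
apply: (@cvg_comp _ _ _ (fun t => (a *: u t, v t)) (fun z => z.1 + z.2)
    F (nbhs (a *: x, y))); last exact: (@add_continuous E (a *: x, y)).
exact: (cvg_pair sc vy).
Qed.

Section ContinuousLinear.
Variables F E : tvsType R[i].

Definition clin_pred : {pred F -> E} :=
  [pred f : F -> E | `[< linear f /\ continuous f >]].

Record clin := Clin { clin_fun :> F -> E; clinP : clin_fun \in clin_pred }.

HB.instance Definition _ := [isSub for clin_fun].
HB.instance Definition _ := [Choice of clin by <:].

Lemma clin_submod : GRing.submod_closed clin_pred.
Proof.
split.
  apply/asboolP; split; first by move=> a x y; rewrite -[RHS]/(a *: 0 + 0) scaler0 addr0.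
  by move=> x; exact: (@cvg_cst _ (0 : E)).
move=> a f g /asboolP[fl fc] /asboolP[gl gc]; apply/asboolP; split.
  move=> b x y; rewrite -[LHS]/(a *: f (b *: x + y) + g (b *: x + y)).
  rewrite -[RHS]/(b *: (a *: f x + g x) + (a *: f y + g y)) fl gl !scalerDr !scalerA [a * b]mulrC.
  by rewrite addrACA.
by move=> x; exact: cvg_lincomb (fc x) (gc x).
Qed.

HB.instance Definition _ := GRing.isSubmodClosed.Build _ _ clin_pred clin_submod.
HB.instance Definition _ := [SubChoice_isSubLmodule of clin by <:].

Lemma clin_linear (T : clin) : linear T.
Proof. by case: T => f /= /asboolP[]. Qed.

Lemma clin_continuous (T : clin) : continuous T.
Proof. by case: T => f /= /asboolP[]. Qed.

End ContinuousLinear.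

Section BoundedTheory.

Lemma csn_bounded (E : tvsType R[i]) (p : cseminorm E) (D : set E) :
  bounded D -> exists M, forall x, D x -> p x <= M.
Proof.
have n0 : nbhs (0 : E) [set x | p x < 1].
  apply: (@csn_cont _ p 0 [set r | r < 1]).
  by apply: lt_nbhsl; rewrite /= sn0.
move=> /(_ _ n0)[t [t0 ht]]; exists t => x /ht[y /= py <-].
by rewrite snZ (normc_pos (ltW t0)) (ler_piMr (ltW t0)) ?(ltW py).
Qed.

Lemma clin_bounded (F E : tvsType R[i]) (T : clin F E) (D : set F) :
  bounded D -> bounded (T @` D).
Proof.
move=> bD U U0.
have : nbhs (0 : F) (T @^-1` U).
  apply: (@clin_continuous _ _ T 0).
  suff -> : T 0 = 0 by [].
  exact: linear_fun0 (clin_linear T).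
move=> /bD[t [t0 ht]]; exists t; split => // _ [x /ht[y Uy <-] <-].
exists (T y) => //.
have T0 : T 0 = 0.
  exact: linear_fun0 (clin_linear T).
by have := clin_linear T t%:C y 0; rewrite T0 !addr0.
Qed.

Lemma compact_tvs_bounded (E : tvsType R[i]) (K : set E) : compact K -> bounded K.
Proof.
move=> /compact_near_coveringP cK U U0.
have := cK _ (nbhs (0 : R[i]^o)) (fun t x => U (t *: x)) _ _.
have h : forall x, K x -> \forall x' \near x & t \near (0 : R[i]^o), U (t *: x').
  move=> x _; have := @scale_continuous _ E (0, x) U.
  rewrite /= scale0r => /(_ U0) [[A B] /= [A0 Bx] AB].
  by exists (B, A) => // -[y t] /= [By At]; exact: (AB (t, y)).
move=> /(_ _ h) /nbhs_ballP[e /= e0 he].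
have : e \is Num.real by exact: gtr0_real.
case/complex_realP => r er; rewrite {}er in e0 he.
rewrite ltcR in e0.
exists (2 / r); split; first by rewrite divr_gt0.
move=> x Kx; exists ((r / 2)%:C *: x); last first.
  rewrite scalerA -rmorphM mulrA divfK ?gt_eqF // divff ?pnatr_eq0 //.
  by rewrite scale1r.
apply: (he (r / 2)%:C) => //.
rewrite -ball_normE /= sub0r normrN ger0_norm ?lecR ?divr_ge0 ?ltW //.
by rewrite ltcR ltr_pdivrMr // ltr_pMr // ltr1n.
Qed.

End BoundedTheory.

(* The seminorm [v |-> sup_(t in A) p (ev t v)]. *)
Section SupSeminorm.
Variables (V W : lmodType R[i]) (T : Type) (A : set T).
Variables (ev : T -> V -> W) (p : seminorm W).
Hypothesis ev_lin : forall t, linear (ev t).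
Hypothesis ev_bnd : forall v, exists M, forall t, A t -> p (ev t v) <= M.

Definition sup_fun (v : V) : R := sup [set p (ev t v) | t in A].

Lemma sup_funZ a v : sup_fun (a *: v) = normc a * sup_fun v.
Proof.
have evZ t u b : ev t (b *: u) = b *: ev t u.
  by have := ev_lin t b u 0; rewrite (linear_fun0 (ev_lin t)) !addr0.
have [A0|/set0P A0] := eqVneq A set0.
  by rewrite /sup_fun A0 !image_set0 sup0 mulr0.
have le_sup b u : sup_fun (b *: u) <= normc b * sup_fun u.
  apply: ge_sup; first by case: A0 => t At; exists (p (ev t (b *: u))), t.
  move=> _ [t At <-]; rewrite evZ snZ ler_wpM2l ?normc_ge0 //.
  apply: ub_le_sup; last by exists t.
  by have [M hM] := ev_bnd u; exists M => _ [s As <-]; exact: hM.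
apply/eqP; rewrite eq_le le_sup /=.
have [->|a0] := eqVneq a 0.
  rewrite normc0 mul0r; case: A0 => t At.
  rewrite (le_trans (sn_ge0 p (ev t (0 *: v))))//; apply: ub_le_sup; last by exists t.
  by have [M hM] := ev_bnd (0 *: v); exists M => _ [s As <-]; exact: hM.
have na : 0 < normc a.
  by rewrite lt_def normc_ge0 andbT; apply: contra_neq a0; exact: eq0_normc.
rewrite -ler_pdivlMl // -normcV.
by rewrite -{1}(scale1r v) -(mulVf a0) -scalerA.
Qed.

Lemma sup_funD u v : sup_fun (u + v) <= sup_fun u + sup_fun v.
Proof.
have [A0|/set0P A0] := eqVneq A set0.
  by rewrite /sup_fun A0 !image_set0 sup0 addr0.
apply: ge_sup; first by case: A0 => t At; exists (p (ev t (u + v))), t.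
have ub w t : A t -> p (ev t w) <= sup_fun w.
  move=> At; apply: ub_le_sup; last by exists t.
  by have [M hM] := ev_bnd w; exists M => _ [s As <-]; exact: hM.
move=> _ [t At <-]; have := ev_lin t 1 u v; rewrite !scale1r => ->.
by rewrite (le_trans (snD _ _ _))// lerD // ub.
Qed.

Definition sup_sn : seminorm V := Seminorm sup_funZ sup_funD.

End SupSeminorm.

(* Continuous linear maps [F -> E] with the topology of uniform convergence on
   the members of a family [S] of bounded sets. *)
Section UniformConvergence.
Variables (F E : tvsType R[i]) (S : set (set F)).
Hypothesis Sbnd : S `<=` @bounded F.

Lemma clin_ev_linear (x : F) : linear (fun T : clin F E => T x).
Proof. by []. Qed.

Lemma clin_ev_bounded (A : set_type S) (p : cseminorm E) (T : clin F E) :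
  exists M, forall x, val A x -> p (T x) <= M.
Proof.
have [M hM] := csn_bounded p (clin_bounded T (Sbnd (set_valP A))).
by exists M => x Ax; apply: hM; exists x.
Qed.

Definition clin_sn (Ap : set_type S * cseminorm E) : seminorm (clin F E) :=
  sup_sn clin_ev_linear (clin_ev_bounded Ap.1 Ap.2).

Definition clin_unif := lcs clin_sn.

HB.instance Definition _ := Tvs.on clin_unif.

End UniformConvergence.

Section EpsProduct.

Definition acc (F : tvsType R[i]) : set (set F) :=
  [set K | absolutely_convex K /\ compact K].

Lemma acc_bounded (F : tvsType R[i]) : @acc F `<=` @bounded F.
Proof. by move=> K [_]; exact: compact_tvs_bounded. Qed.

Definition Lkappa (F E : tvsType R[i]) := clin_unif E (@acc_bounded F).
HB.instance Definition _ F E := Tvs.on (Lkappa F E).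

Definition dual_kappa (F : tvsType R[i]) := Lkappa F R[i]^o.
HB.instance Definition _ F := Tvs.on (dual_kappa F).

Definition equicont (F : tvsType R[i]) : set (set (clin F R[i]^o)) :=
  [set H | equicontinuous H (fun phi : clin F R[i]^o => phi : F -> R[i]^o)].

Lemma lcs_bounded (V : lmodType R[i]) (I : Type) (q : I -> seminorm V)
    (H : set (lcs q)) :
  (forall i, exists M, forall v, H v -> q i v <= M) -> bounded H.
Proof.
move=> qH U [s [e [e0 hU]]].
have [M [M0 hM]] : exists M, 0 < M /\
    forall v, H v -> all (fun i => q i v < M) s.
  elim: s {hU} => [|i s [M [M0 hM]]]; first by exists 1.
  have [N hN] := qH i; exists (Num.max M (N + 1)).
  split; first by rewrite lt_max M0.
  move=> v Hv /=; have vN : q i v < N + 1.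
    by rewrite (le_lt_trans (hN _ Hv)) // ltrDl.
  rewrite lt_max vN orbT /=.
  by have := hM _ Hv; apply: sub_all => j hj; rewrite lt_max hj.
have t0 : 0 < M / e by rewrite divr_gt0.
exists (M / e); split => // v /hM vM.
exists ((e / M)%:C *: v); last first.
  rewrite scalerA -rmorphM mulrA divfK ?gt_eqF // divff ?gt_eqF //.
  by rewrite scale1r.
apply: hU; rewrite /lcs_ball /=; move: vM; apply: sub_all => i hi.
rewrite subr0 snZ normc_pos; last by rewrite divr_ge0 // ltW.
by rewrite mulrAC ltr_pdivrMr // ltr_pM2l.
Qed.

Lemma equicont_sn (F : tvsType R[i]) (H : set (clin F R[i]^o))
    (p : cseminorm R[i]^o) : equicont H ->
  nbhs (0 : F) [set x | forall phi, H phi -> p (phi x) <= 1].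
Proof.
move=> eqH.
have n0 : nbhs (0 : R[i]^o) [set x | p x < 1].
  apply: (@csn_cont _ p 0 [set r | r < 1]).
  by apply: lt_nbhsl; rewrite /= sn0.
have /nbhs_ballP[e /= e0 he] := n0.
have := eqH 0 [set xy | ball xy.1 e xy.2] (entourage_ball _ (PosNum e0)).
apply: filterS => x hx phi Hphi; apply/ltW/he.
by have := hx _ Hphi; rewrite /= (linear_fun0 (clin_linear phi)).
Qed.

Lemma equicont_bounded (F : tvsType R[i]) :
  @equicont F `<=` @bounded (dual_kappa F).
Proof.
move=> H eqH; apply: lcs_bounded => -[K p].
have [t [t0 ht]] := acc_bounded (set_valP K) (equicont_sn p eqH).
exists t => phi Hphi; rewrite /clin_sn /= /sup_fun /=.
have [K0|/set0P[x0 Kx0]] := eqVneq (val K : set F) set0.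
  by rewrite K0 image_set0 sup0 ltW.
apply: ge_sup; first by exists (p (phi x0)), x0.
move=> _ [x /ht[y hy <-] <-].
have -> : phi (t%:C *: y) = t%:C *: phi y.
  have := clin_linear phi t%:C y 0.
  by rewrite (linear_fun0 (clin_linear phi)) !addr0.
by rewrite snZ (normc_pos (ltW t0)) (ler_piMr (ltW t0)) // hy.
Qed.

(* F eps E = L_e(F'_kappa, E) *)
Definition eps_product (F E : tvsType R[i]) :=
  @clin_unif (dual_kappa F) E (@equicont F) (@equicont_bounded F).
HB.instance Definition _ F E := Tvs.on (eps_product F E).

Lemma clin_id_subproof (F : tvsType R[i]) : @idfun F \in @clin_pred F F.
Proof. by apply/asboolP; split => // x; exact: cvg_id. Qed.

Definition clin_id (F : tvsType R[i]) : clin F F := Clin (clin_id_subproof F).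

(* F' (x) F as a set of operators *)
Definition finite_rank (F : tvsType R[i]) : set (Lkappa F F) :=
  [set T | exists n (phi : 'I_n -> clin F R[i]^o) (y : 'I_n -> F),
     forall x, (T : clin F F) x = \sum_(k < n) (phi k x : R[i]) *: y k].

Definition approximation_property (F : tvsType R[i]) :=
  closure (@finite_rank F) (clin_id F : Lkappa F F).

End EpsProduct.

Section Modulus.

Lemma normc_snZ (a : R[i]) (x : R[i]^o) : normc (a *: x) = normc a * normc x.
Proof. exact: normcM. Qed.

Definition modulus_sn : seminorm R[i]^o := Seminorm normc_snZ (@le_normcD R).

Lemma normc_continuous : continuous (modulus_sn : R[i]^o -> R).
Proof.
move=> x U /nbhs_ballP[e /= e0 hU].
apply/nbhs_ballP; exists e%:C; first by rewrite /= ltcR.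
move=> y; rewrite -ball_normE /= normCE ltcR => xy; apply: hU.
rewrite -ball_normE /=; apply: le_lt_trans xy.
rewrite ler_norml; apply/andP; split.
  rewrite lerNl opprB lerBlDr -(normcN (x - y)) opprB.
  by rewrite -[X in normc X <= _](subrK x y) le_normcD.
by rewrite lerBlDr -[x in normc x](subrK y) le_normcD.
Qed.

Definition modulus : cseminorm R[i]^o := CSeminorm normc_continuous.

Lemma equicont_pointwise (F : tvsType R[i]) (x : F) (H : set (clin F R[i]^o)) :
  equicont H -> exists M, forall phi, H phi -> normc (phi x) <= M.
Proof.
move=> /(equicont_sn modulus).
move=> /(compact_tvs_bounded (@compact_set1 F x))[t [t0 /(_ x erefl)[y hy <-]]].
exists t => phi /hy /= hp.
have -> : phi (t%:C *: y) = t%:C *: phi y.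
  have := clin_linear phi t%:C y 0.
  by rewrite (linear_fun0 (clin_linear phi)) !addr0.
by rewrite normcM (normc_pos (ltW t0)) (ler_piMr (ltW t0)).
Qed.

End Modulus.

Section InjectiveTensor.
Variables F E : tvsType R[i].

Record bilin := Bilin {
  bilin_fun :> F -> E -> R[i]^o;
  bilin_l : forall y, linear (bilin_fun^~ y);
  bilin_r : forall x, linear (bilin_fun x) }.

(* F (x) E is realised inside the algebraic dual of the space of bilinear forms
   on F x E, x (x) y being the evaluation at (x, y). *)
Definition tensor_pred : {pred bilin -> R[i]^o} :=
  [pred t : bilin -> R[i]^o | `[< exists s : seq (F * E),
     t = fun b => \sum_(u <- s) b u.1 u.2 >]].

Record tensor := Tensor {
  tensor_fun :> bilin -> R[i]^o;
  tensorP : tensor_fun \in tensor_pred }.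

HB.instance Definition _ := [isSub for tensor_fun].
HB.instance Definition _ := [Choice of tensor by <:].

Lemma tensor_submod : GRing.submod_closed tensor_pred.
Proof.
split; first by apply/asboolP; exists [::]; apply/funext => b; rewrite big_nil.
move=> a t u /asboolP[s ->] /asboolP[r ->]; apply/asboolP.
exists ([seq (a *: v.1, v.2) | v <- s] ++ r); apply/funext => b.
rewrite big_cat big_map /= -[LHS]/(a *: _ + _); congr (_ + _).
rewrite scaler_sumr; apply: eq_bigr => v _.
have := bilin_l b v.2 a v.1 0.
by rewrite (linear_fun0 (bilin_l b v.2)) !addr0 => ->.
Qed.

HB.instance Definition _ :=
  GRing.isSubmodClosed.Build _ _ tensor_pred tensor_submod.
HB.instance Definition _ := [SubChoice_isSubLmodule of tensor by <:].

Lemma bilin_tensor_l (phi : clin F R[i]^o) (psi : clin E R[i]^o) y :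
  linear (fun x => phi x * psi y : R[i]^o).
Proof. by move=> a u v; rewrite clin_linear mulrDl scalerAl. Qed.

Lemma bilin_tensor_r (phi : clin F R[i]^o) (psi : clin E R[i]^o) x :
  linear (fun y => phi x * psi y : R[i]^o).
Proof. by move=> a u v; rewrite clin_linear mulrDr scalerAr. Qed.

Definition bilin_tensor phi psi : bilin :=
  Bilin (bilin_tensor_l phi psi) (bilin_tensor_r phi psi).

Lemma tensor_ev_linear (fg : clin F R[i]^o * clin E R[i]^o) :
  linear (fun t : tensor => t (bilin_tensor fg.1 fg.2)).
Proof. by []. Qed.

Lemma tensor_ev_bounded (HG : set_type (@equicont F) * set_type (@equicont E))
    (t : tensor) :
  exists M, forall fg, (val HG.1 `*` val HG.2) fg ->
    modulus (t (bilin_tensor fg.1 fg.2)) <= M.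
Proof.
case: t => t /= /asboolP[s ->]; elim: s => [|u s [M hM]].
  by exists 0 => fg _; rewrite big_nil normc0.
have [M1 hM1] := equicont_pointwise u.1 (set_valP HG.1).
have [M2 hM2] := equicont_pointwise u.2 (set_valP HG.2).
exists (M1 * M2 + M) => -[f g] /= [hf hg].
rewrite big_cons (le_trans (le_normcD _ _))// lerD //; last exact: (hM (f, g)).
rewrite /= normcM ler_pM ?normc_ge0 //; [exact: hM1|exact: hM2].
Qed.

(* sup_(phi in H, psi in G) |(phi (x) psi)(t)| : the injective topology is that of
   uniform convergence on products of equicontinuous sets of functionals. *)
Definition tensor_sn (HG : set_type (@equicont F) * set_type (@equicont E)) :
    seminorm tensor :=
  sup_sn tensor_ev_linear (tensor_ev_bounded HG).

Definition inj_tensor := lcs tensor_sn.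
HB.instance Definition _ := Tvs.on inj_tensor.

End InjectiveTensor.

Section Holomorphic.
Variables (d : nat) (E : tvsType R[i]).
Local Notation Cd := 'rV[R[i]^o]_d.
Implicit Types (f : Cd -> E) (w v : Cd) (l : E) (Om : set Cd).

(* The derivative of [f] in the direction [v] with a real increment: for
   [v = e_k] (resp. [i e_k]) it is the partial derivative of [f \o phi^-1] with
   respect to [Re w_k] (resp. [Im w_k]). *)
Definition is_rpartial f v w l :=
  (fun h : R => (h^-1)%:C *: (f (w + h%:C *: v) - f w)) @ 0^' --> l.

Definition is_cpartial f (k : 'I_d) w l :=
  (fun h : R[i]^o => h^-1 *: (f (w + h *: delta_mx 0 k) - f w)) @ 0^' --> l.

Definition C1_real Om f :=
  forall (k : 'I_d) (c : R[i]), c = 1 \/ c = 0 +i* 1 ->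
    exists g : Cd -> E, forall w, Om w ->
      is_rpartial f (c *: delta_mx 0 k) w (g w) /\ {for w, continuous g}.

Definition multi_succ (b : {ffun 'I_d -> nat}) (k : 'I_d) :
    {ffun 'I_d -> nat} :=
  [ffun j => (b j + (j == k))%N].

(* [D b] is the iterated derivative d_1^(b_1) ... d_d^(b_d) f, whence the side
   condition under which [D (b + e_k)] is the derivative of [D b]. *)
Definition all_cpartials Om f :=
  exists D : {ffun 'I_d -> nat} -> Cd -> E,
    (forall w, Om w -> D [ffun=> 0%N] w = f w) /\
    (forall (b : {ffun 'I_d -> nat}) (k : 'I_d) w, Om w ->
       (forall j : 'I_d, (j < k)%N -> b j = 0%N) ->
       is_cpartial (D b) k w (D (multi_succ b k) w)).

Definition O_space Om : set (Cd -> E) :=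
  [set f | C1_real Om f /\ all_cpartials Om f].

Lemma is_rpartial_lin a f g v w l m : is_rpartial f v w l ->
  is_rpartial g v w m ->
  is_rpartial (fun w => a *: f w + g w) v w (a *: l + m).
Proof.
move=> hf hg; rewrite /is_rpartial.
have -> : (fun h : R => (h^-1)%:C *:
    (a *: f (w + h%:C *: v) + g (w + h%:C *: v) - (a *: f w + g w))) =
  (fun h : R => a *: ((h^-1)%:C *: (f (w + h%:C *: v) - f w)) +
     (h^-1)%:C *: (g (w + h%:C *: v) - g w)).
  apply/funext => h; rewrite opprD addrACA -scalerBr scalerDr.
  by rewrite !scalerA mulrC.
exact: cvg_lincomb.
Qed.

Lemma is_cpartial_lin a f g k w l m : is_cpartial f k w l ->
  is_cpartial g k w m ->
  is_cpartial (fun w => a *: f w + g w) k w (a *: l + m).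
Proof.
move=> hf hg; rewrite /is_cpartial.
have -> : (fun h : R[i]^o => h^-1 *: (a *: f (w + h *: delta_mx 0 k) +
    g (w + h *: delta_mx 0 k) - (a *: f w + g w))) =
  (fun h : R[i]^o => a *: (h^-1 *: (f (w + h *: delta_mx 0 k) - f w)) +
     h^-1 *: (g (w + h *: delta_mx 0 k) - g w)).
  apply/funext => h; rewrite opprD addrACA -scalerBr scalerDr.
  by rewrite !scalerA mulrC.
exact: cvg_lincomb.
Qed.

Lemma is_rpartial0 v w : is_rpartial (fun _ => 0) v w 0.
Proof.
rewrite /is_rpartial.
have -> : (fun h : R => (h^-1)%:C *: (0 - 0 : E)) = (fun _ => 0).
  by apply/funext => h; rewrite subrr scaler0.
exact: cvg_cst.
Qed.

Lemma is_cpartial0 k w : is_cpartial (fun _ => 0) k w 0.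
Proof.
rewrite /is_cpartial.
have -> : (fun h : R[i]^o => h^-1 *: (0 - 0 : E)) = (fun _ => 0).
  by apply/funext => h; rewrite subrr scaler0.
exact: cvg_cst.
Qed.

Lemma O_space0 Om : O_space Om (fun _ => 0).
Proof.
split.
  move=> k c _; exists (fun _ => 0) => w _; split; first exact: is_rpartial0.
  exact: (@cst_continuous _ _ (0 : E)).
exists (fun _ _ => 0); split => // b k w _ _; exact: is_cpartial0.
Qed.

Lemma O_space_lin Om a f g : O_space Om f -> O_space Om g ->
  O_space Om (fun w => a *: f w + g w).
Proof.
move=> [f1 [Df [Df0 hDf]]] [g1 [Dg [Dg0 hDg]]]; split.
  move=> k c hc; have [f' hf'] := f1 k c hc; have [g' hg'] := g1 k c hc.
  exists (fun w => a *: f' w + g' w) => w Ow.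
  have [hf hcf] := hf' w Ow; have [hg hcg] := hg' w Ow.
  split; first exact: is_rpartial_lin.
  exact: cvg_lincomb hcf hcg.
exists (fun b w => a *: Df b w + Dg b w); split.
  by move=> w Ow; rewrite Df0 // Dg0.
by move=> b k w Ow hb; apply: is_cpartial_lin; [exact: hDf|exact: hDg].
Qed.

End Holomorphic.

Section PolydiscAlgebra.
Variables (d : nat) (z : 'rV[R[i]^o]_d) (r : 'I_d -> R).
Local Notation Cd := 'rV[R[i]^o]_d.

Definition polydisc : set Cd :=
  [set w | forall k, normc (w 0 k - z 0 k) < r k].

Section Carrier.
Variable E : tvsType R[i].

(* A function on the closed polydisc is represented by its extension by 0. *)
Definition A_pred : {pred Cd -> E} :=
  [pred f : Cd -> E | `[< [/\ {within closure polydisc, continuous f},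
     O_space polydisc f & forall w, ~ closure polydisc w -> f w = 0] >]].

Record A_carrier := ACarrier {
  A_fun :> Cd -> E;
  A_carrierP : A_fun \in A_pred }.

HB.instance Definition _ := [isSub for A_fun].
HB.instance Definition _ := [Choice of A_carrier by <:].

Lemma A_submod : GRing.submod_closed A_pred.
Proof.
split.
  apply/asboolP; split => //; last exact: O_space0.
  by move=> x; exact: (@cvg_cst _ (0 : E)).
move=> a f g /asboolP[fc fO f0] /asboolP[gc gO g0]; apply/asboolP; split.
- by move=> x; exact: cvg_lincomb (fc x) (gc x).
- exact: O_space_lin.
- move=> w hw; rewrite -[LHS]/(a *: f w + g w) f0 // g0 //.
  by rewrite scaler0 addr0.
Qed.

HB.instance Definition _ := GRing.isSubmodClosed.Build _ _ A_pred A_submod.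
HB.instance Definition _ := [SubChoice_isSubLmodule of A_carrier by <:].

Lemma compact_closed_polydisc : compact (closure polydisc).
Proof.
pose M k := r k + normc (z 0 k) + 1.
pose g (ab : R * R) : R[i]^o := ab.1 +i* ab.2.
have gc : continuous g.
  move=> -[a b] U /nbhs_ballP[e /= e0 hU].
  have /complex_realP[t te] : e \is Num.real by exact: gtr0_real.
  rewrite {}te ltcR in e0 hU *.
  have t2 : 0 < t / 2 by rewrite divr_gt0.
  exists (ball a (t / 2), ball b (t / 2)).
    by split; apply/nbhs_ballP; exists (t / 2).
  move=> [a' b'] [/=]; rewrite -!ball_normE /= => ha hb; apply: hU.
  rewrite -ball_normE /= normCE ltcR.
  have -> : (a +i* b) - (a' +i* b') = (a - a')%:C + (0 +i* (b - b')) :> R[i].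
    by apply/eqP; rewrite eq_complex /= addr0 add0r !eqxx.
  rewrite (le_lt_trans (le_normcD _ _))// (splitr t) ltrD //.
    by rewrite /= expr0n addr0 sqrtr_sqr.
  by rewrite /= expr0n add0r sqrtr_sqr.
pose A k := g @` (`[- M k, M k] `*` `[- M k, M k]).
have Ac k : compact (A k).
  apply: continuous_compact; first exact: continuous_subspaceT.
  by apply: compact_setX; exact: segment_compact.
apply: (subclosed_compact _ (@rV_compact R[i]^o d A Ac)).
  exact: closed_closure.
move=> w hw k /=.
have : nbhs w [set w' : Cd | normc (w 0 k - w' 0 k) < 1].
  apply: (@coord_continuous _ 1 d 0 k w [set y | normc (w 0 k - y) < 1]).
  apply/nbhs_ballP; exists 1 => //= y; rewrite -ball_normE /= normCE.
  by rewrite ltcR.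
move=> /hw[w' [w'D /= ww']].
have wM : normc (w 0 k) <= M k.
  have -> : w 0 k = (w' 0 k - z 0 k) + z 0 k + (w 0 k - w' 0 k).
    by rewrite subrK addrC subrK.
  rewrite (le_trans (le_normcD _ _))// lerD ?(ltW ww') //.
  by rewrite (le_trans (le_normcD _ _))// lerD2r ltW // w'D.
case: (w 0 k) wM => a b /= wM; exists (a, b) => //.
by split; rewrite /= in_itv /= -ler_norml (le_trans _ wM)// -sqrtr_sqr
  ler_sqrt ?addr_ge0 ?sqr_ge0 // ?lerDl ?lerDr sqr_ge0.
Qed.

Lemma A_ev_linear (w : Cd) : linear (fun f : A_carrier => f w).
Proof. by []. Qed.

Lemma A_ev_bounded (p : cseminorm E) (f : A_carrier) :
  exists M, forall w, closure polydisc w -> p (f w) <= M.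
Proof.
case: f => f /= /asboolP[fc _ _].
have := compact_tvs_bounded (continuous_compact fc compact_closed_polydisc).
move=> /(csn_bounded p)[M hM]; exists M => w hw.
by apply: hM; exists w.
Qed.

Definition A_sn (p : cseminorm E) : seminorm A_carrier :=
  sup_sn A_ev_linear (A_ev_bounded p).

Definition A_space (I : Type) (p : I -> cseminorm E) :=
  lcs (fun i => A_sn (p i)).
HB.instance Definition _ I p := Tvs.on (@A_space I p).

Definition poly_tensor : set (Cd -> E) :=
  [set f | exists n (q : 'I_n -> mpoly.mpoly d R[i]) (x : 'I_n -> E),
     (forall w, closure polydisc w ->
        f w = \sum_(k < n) mpoly.meval (w 0) (q k) *: x k) /\
     (forall w, ~ closure polydisc w -> f w = 0)].

End Carrier.

Definition A_scalar := A_space (fun _ : unit => modulus).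
HB.instance Definition _ := Tvs.on A_scalar.

End PolydiscAlgebra.
End Seminorms.

Arguments A_pred {R d} z r E.
Arguments poly_tensor {R d} z r E.
Arguments A_carrier {R d} z r E.

(* Main.v *)
From HB Require Import structures.
From mathcomp Require Import all_boot all_order all_algebra.
From mathcomp Require Import all_classical all_reals all_analysis.
From mathcomp Require Import complex.
From mathcomp Require Import -(notations) mpoly.
From mathcomp Require Import ring lra.
Require Import Defs.

Set Implicit Arguments.
Unset Strict Implicit.
Unset Printing Implicit Defensive.

Import Order.TTheory GRing.Theory Num.Theory numFieldNormedType.Exports.
Import ComplexField.Normc.

Local Open Scope classical_set_scope.
Local Open Scope ring_scope.
Local Open Scope complex_scope.

Local Notation "p .@[ v ]" := (meval v p)
  (at level 2, format "p .@[ v ]").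

(** The proof replaces integrals by finite sums over roots of unity. Let [P_N]
    interpolate a function of one variable at the [N]-th roots of unity [om ^+ j]
    by a polynomial of degree less than [N]. The difference of [P_N f w] and [f w]
    is the increment over [0 <= t <= 1] of the weighted mean of the values of [f]
    at [w + t * (om ^+ j - w)]. After a cancellation between weights and distances
    ([interp_weight_dist]) the derivative of this mean in [t] is a multiple of the
    mean of [om ^+ j *: f'] over a circle, and that is small because the increments
    of [f] along the circle telescope to 0 ([sum_derivative_circle]). So [P_N f]
    converges to [f] uniformly on the closed disc if [f] is uniformly
    differentiable there ([interpolation_error]); this uses neither completeness of
    the range nor functionals. Treating the coordinates one after the other, after
    a dilation, approximates every function of the polydisc algebra by sums of
    terms [q w *: f c] with polynomials [q] and nodes [c]
    ([polynomial_interpolation]), which is the density statement.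

    Cauchy's estimates are elementary for polynomials, where Taylor coefficients are
    finite Fourier sums ([cauchy_coefficient]). Their constants are uniform, so for
    complete [E] every uniform limit of polynomials lies in the algebra
    ([uniform_limit_in_A]); hence the space of vector-valued functions is complete.

    The interpolation is applied once more to the function that maps [w] to the
    evaluation at [w], on a compact set [B] of scalar functions. The result is an
    operator of finite rank that is uniformly close to the identity on [B]
    ([compact_interp]): this is the approximation property.

    For the epsilon product, a function [f] is sent to the operator that maps a
    functional [phi] to the vector [x] with [psi x = phi (psi \o f)] for all [psi]
    ([integral_exists]). It is continuous because the functions [psi \o f] with
    [psi] in a polar form a relatively compact set ([compact_dominated]). The
    inverse maps an operator [u] to the function with value [u (dirac w)] at [w],
    which is a uniform limit of polynomials by [compact_interp]. Finally, tensors
    embed topologically into the space of vector-valued functions and have dense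
    range, since polynomials come from tensors; that space is therefore a completion
    ([tensor_function_completion]), and completions are unique up to isomorphism
    ([completion_unique]). *)

(** * Seminorm descriptions of the topologies *)

Section Basics.
Variable R : realType.
Local Notation C := R[i]^o.

Lemma nbhs_complexP (a : C) (U : set C) :
  nbhs a U <-> exists e : R, 0 < e /\ forall b, normc (b - a) < e -> U b.
Proof.
split=> [/nbhs_ballP[e /= e0 hU]|[e [e0 hU]]].
  have /complex_realP[t te] : e \is Num.real by exact: gtr0_real.
  rewrite {}te ltcR in e0 hU *; exists t; split => // b hb; apply: hU.
  by rewrite -ball_normE /= normCE ltcR -normcN opprB.
apply/nbhs_ballP; exists e%:C; first by rewrite /= ltcR.
by move=> b; rewrite -ball_normE /= normCE ltcR -normcN opprB; exact: hU.
Qed.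

Lemma nbhs_rowP (d : nat) (w : 'rV[C]_d) (U : set 'rV[C]_d) :
  nbhs w U <->
  exists e : R, 0 < e /\ forall v : 'rV[C]_d,
    (forall k, normc (v 0 k - w 0 k) < e) -> U v.
Proof.
split=> [/nbhs_ballP[e /= e0 hU]|[e [e0 hU]]].
  have /complex_realP[t te] : e \is Num.real by exact: gtr0_real.
  rewrite {}te ltcR in e0 hU *; exists t; split => // b hb; apply: hU.
  split=> [|i k]; first by rewrite ltcR.
  by rewrite -ball_normE /= normCE ltcR -normcN opprB (ord1 i).
apply/nbhs_ballP; exists e%:C; first by rewrite /= ltcR.
move=> b [_ hb]; apply: hU => k; move: (hb 0 k).
by rewrite -ball_normE /= normCE ltcR -normcN opprB.
Qed.

Lemma nbhs_realP (a : R) (U : set R) :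
  nbhs a U <-> exists e : R, 0 < e /\ forall b, `|b - a| < e -> U b.
Proof.
split=> [/nbhs_ballP[e /= e0 hU]|[e [e0 hU]]].
  by exists e; split => // b hb; apply: hU; rewrite -ball_normE /= distrC.
apply/nbhs_ballP; exists e => //= b; rewrite -ball_normE /= distrC; exact: hU.
Qed.

Lemma dnbhs_complexP (U : set C) :
  (0 : C)^' U <->
  exists e : R, 0 < e /\ forall h, h != 0 -> normc h < e -> U h.
Proof.
rewrite /dnbhs; split.
  move=> /nbhs_complexP[e [e0 h]]; exists e; split=> // b b0 be.
  by apply: (h b); rewrite ?subr0.
move=> [e [e0 h]]; apply/nbhs_complexP; exists e; split=> // b.
by rewrite subr0 => be b0; exact: h.
Qed.

Lemma dnbhs_realP (U : set R) :
  (0 : R)^' U <->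
  exists e : R, 0 < e /\ forall h, h != 0 -> `|h| < e -> U h.
Proof.
rewrite /dnbhs; split.
  move=> /nbhs_realP[e [e0 h]]; exists e; split=> // b b0 be.
  by apply: (h b); rewrite ?subr0.
move=> [e [e0 h]]; apply/nbhs_realP; exists e; split=> // b.
by rewrite subr0 => be b0; exact: h.
Qed.

Lemma nbhs_translate (E : tvsType R[i]) (x y : E) (U : set E) :
  nbhs (x + y) U <-> nbhs x [set v | U (v + y)].
Proof.
have add_cts (a b : E) (V : set E) : nbhs (a + b) V -> nbhs a [set v | V (v + b)].
  move=> h; have := @add_continuous E (a, b) V h => -[[A B] /= [hA hB] AB].
  apply: filterS hA => v Av; apply: (AB (v, b)); split => //=.
  exact: nbhs_singleton hB.
split; first exact: add_cts.
rewrite -[x in nbhs x _](addrK y) => /add_cts.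
by congr nbhs; apply/seteqP; split=> v /=; rewrite subrK.
Qed.

(** If the inequality failed at [x], some multiple of [x] would lie in the ball
    with [q] equal to 2; this covers the case [p x = 0]. *)
Lemma sn_le_of_ball (V : lmodType R[i]) (p q : seminorm V) (e : R) :
  0 < e -> (forall x, p x < e -> q x <= 1) -> forall x, q x <= 2 / e * p x.
Proof.
move=> e0 h x; rewrite leNgt; apply/negP => lt.
have q0 : 0 < q x.
  by apply: le_lt_trans lt; rewrite mulr_ge0 ?sn_ge0 // divr_ge0 // ltW.
have t0 : 0 <= 2 / q x by rewrite divr_ge0 // ltW.
have := h ((2 / q x)%:C *: x); rewrite !snZ !normc_pos // divfK ?gt_eqF //.
rewrite mulrAC ltr_pdivrMr // -ltr_pdivrMl // mulrA [e^-1 * 2]mulrC.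
by move=> /(_ lt); rewrite leNgt ltr1n.
Qed.

Lemma sup_fun_ub (V W : lmodType R[i]) (T : Type) (A : set T)
    (ev : T -> V -> W) (p : seminorm W) (v : V) (M : R) :
  (forall t, A t -> p (ev t v) <= M) ->
  forall t, A t -> p (ev t v) <= sup_fun A ev p v.
Proof.
move=> h t At; apply: ub_le_sup; last by exists t.
by exists M => _ [s As <-]; exact: h.
Qed.

Lemma sup_fun_le (V W : lmodType R[i]) (T : Type) (A : set T)
    (ev : T -> V -> W) (p : seminorm W) (v : V) (M : R) : 0 <= M ->
  (forall t, A t -> p (ev t v) <= M) -> sup_fun A ev p v <= M.
Proof.
move=> M0 h; rewrite /sup_fun; have [->|/set0P[t At]] := eqVneq A set0.
  by rewrite image_set0 sup0.
apply: ge_sup; first by exists (p (ev t v)), t.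
by move=> _ [s As <-]; exact: h.
Qed.

Lemma sn_sum (V : lmodType R[i]) (p : seminorm V) (I : Type) (s : seq I)
    (P : pred I) (F : I -> V) :
  p (\sum_(i <- s | P i) F i) <= \sum_(i <- s | P i) p (F i).
Proof.
elim/big_rec2: _ => [|i y x _ le]; first by rewrite sn0.
by rewrite (le_trans (snD _ _ _))// lerD2l.
Qed.

Lemma snB (V : lmodType R[i]) (p : seminorm V) x y : p (x - y) = p (y - x).
Proof. by rewrite -snN opprB. Qed.

Lemma sn_triangle (V : lmodType R[i]) (p : seminorm V) y x z :
  p (x - z) <= p (x - y) + p (y - z).
Proof. by rewrite -[x in p x](subrKA y) snD. Qed.

(** The condition under which the balls of single seminorms are a base of the
    neighbourhoods, see [nbhs_lcsP]. *)
Definition sn_directed (V : lmodType R[i]) (I : Type) (q : I -> seminorm V) :=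
  forall i j, exists k (c : R), 0 < c /\
     forall x, q i x <= c * q k x /\ q j x <= c * q k x.

Lemma nbhs_lcsP (V : lmodType R[i]) (I : Type) (q : I -> seminorm V)
    (i0 : I) (x : lcs q) (U : set (lcs q)) : sn_directed q ->
  nbhs x U <-> exists i (e : R), 0 < e /\ forall y, q i (y - x) < e -> U y.
Proof.
move=> dq; split; last first.
  move=> [i [e [e0 h]]]; exists [:: i], e; split => // y /=.
  by rewrite /lcs_ball /= andbT => /h.
move=> [s [e [e0 h]]].
have [i [c [c0 hc]]] : exists i (c : R), 0 < c /\
    forall y, all (fun j => q j y <= c * q i y) s.
  elim: s {h} => [|j s [i [c [c0 hc]]]]; first by exists i0, 1.
  have [k [c' [c'0 hk]]] := dq j i.
  exists k, (Num.max c' (c * c')); split; first by rewrite lt_max c'0.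
  move=> y /=; have [h1 h2] := hk y; apply/andP; split.
    by rewrite (le_trans h1)// ler_wpM2r ?sn_ge0 // le_max lexx.
  move: (hc y); apply: sub_all => l /le_trans; apply.
  rewrite (le_trans (ler_wpM2l (ltW c0) h2))// mulrA ler_wpM2r ?sn_ge0 //.
  by rewrite le_max lexx orbT.
exists i, (e / c); split; first by rewrite divr_gt0.
move=> y hy; apply: h; rewrite /lcs_ball /=; move: (hc (y - x)).
apply: sub_all => j /le_lt_trans; apply.
by rewrite mulrC -ltr_pdivlMr.
Qed.

Section Fund.
Variables (E : tvsType R[i]) (I : Type) (p : I -> cseminorm E).
Hypothesis pf : directed_fundamental p.

Lemma fund_index : exists i : I, True.
Proof.
have [_ h] := pf; have [|i _] := h setT; first exact: filterT.
by exists i.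
Qed.

Lemma fund_directed : sn_directed p.
Proof. by case: pf. Qed.

Lemma nbhs_fundP (x : E) (U : set E) :
  nbhs x U <-> exists i (e : R), 0 < e /\ forall y, p i (y - x) < e -> U y.
Proof.
have [_ h] := pf; rewrite -[x in nbhs x _]add0r nbhs_translate; split.
  move=> /h[i [e [e0 hU]]]; exists i, e; split => // y /hU /=.
  by rewrite subrK.
move=> [i [e [e0 hU]]].
have : nbhs (0 : E) [set v | p i v < e].
  apply: (@csn_cont _ _ (p i) 0 [set r | r < e]).
  by apply: lt_nbhsl; rewrite /= sn0.
by apply: filterS => v /= pv; apply: hU; rewrite addrK.
Qed.

Lemma fund_dom (q : seminorm E) : nbhs (0 : E) [set x | q x <= 1] ->
  exists i (c : R), 0 < c /\ forall x, q x <= c * p i x.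
Proof.
have [_ h] := pf; move=> /h[i [e [e0 hU]]].
exists i, (2 / e); split; first by rewrite divr_gt0.
exact: sn_le_of_ball.
Qed.

Lemma fund_dom_csn (q : cseminorm E) :
  exists i (c : R), 0 < c /\ forall x, q x <= c * p i x.
Proof.
apply: fund_dom; suff : nbhs (0 : E) [set x | q x < 1].
  by apply: filterS => x /= /ltW.
apply: (@csn_cont _ _ q 0 [set r | r < 1]).
by apply: lt_nbhsl; rewrite /= sn0.
Qed.

Lemma fund_sep (hE : hausdorff_space E) (x y : E) :
  (forall i (e : R), 0 < e -> p i (x - y) <= e) -> x = y.
Proof.
move=> h; apply: hE => A B /nbhs_fundP[i [e [e0 hA]]] By.
exists y; split; last exact: nbhs_singleton By.
apply: hA; rewrite snB; have e2 : 0 < e / 2 by rewrite divr_gt0.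
by rewrite (le_lt_trans (h i _ e2))// ltr_pdivrMr // ltr_pMr // ltr1n.
Qed.

Lemma cvg_fundP (T : Type) (F : set_system T) (FF : Filter F) (u : T -> E) x :
  u @ F --> x <-> forall i (e : R), 0 < e -> F [set t | p i (u t - x) < e].
Proof.
split=> [h i e e0|h U /nbhs_fundP[i [e [e0 hU]]]].
  have /h : nbhs x [set y | p i (y - x) < e] by apply/nbhs_fundP; exists i, e.
  exact.
by apply: (@filterS _ F FF _ _ _ (h i e e0)) => t /hU.
Qed.

End Fund.

End Basics.

(** * The Hahn-Banach theorem for seminorms *)

Section HahnBanach.
Variables (R : realType) (V : lmodType R[i]).
Implicit Types (q m : V -> R) (x y : V) (t : R).

Definition sublinear q :=
  (forall x y, q (x + y) <= q x + q y) /\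
  (forall t x, 0 <= t -> q (t%:C *: x) = t * q x).

Lemma sublinear0 q : sublinear q -> q 0 = 0.
Proof. by move=> [_ qZ]; rewrite -(scale0r (0 : V)) (qZ 0) ?mul0r. Qed.

Lemma sublinearN q x : sublinear q -> - q (- x) <= q x.
Proof.
move=> sq; have := sq.1 x (- x); rewrite subrr (sublinear0 sq).
by rewrite -lerBlDr sub0r.
Qed.

(** The reverse inequality is the hypothesis for the factor [t^-1]. *)
Lemma pos_homogeneous q : q 0 = 0 ->
  (forall t x, 0 < t -> q (t%:C *: x) <= t * q x) ->
  forall t x, 0 <= t -> q (t%:C *: x) = t * q x.
Proof.
move=> q0 h t x; rewrite le_eqVlt => /predU1P[<-|t0].
  by rewrite scale0r q0 mul0r.
apply/eqP; rewrite eq_le h //= -ler_pdivlMl //.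
have t1 : 0 < t^-1 by rewrite invr_gt0.
apply: le_trans (h _ _ t1).
by rewrite scalerA -rmorphM mulVf ?gt_eqF // scale1r.
Qed.

(** The largest sublinear minorant of [q] that is at most [- q y] at [- y]. *)
Definition tilt q y x : R :=
  inf [set q (x + t%:C *: y) - t * q y | t in [set t | 0 <= t]].

Section Tilt.
Variables (q : V -> R) (y : V).
Hypothesis sq : sublinear q.

Let S x := [set q (x + t%:C *: y) - t * q y | t in [set t | 0 <= t]].

Let S_lb x : lbound (S x) (- q (- x)).
Proof.
move=> _ [t /= t0 <-]; rewrite lerBrDr -sq.2 // addrC lerBlDr.
have := sq.1 (x + t%:C *: y) (- x).
by rewrite addrAC subrr add0r.
Qed.

Let S_inf x : has_inf (S x).
Proof.
split; last by exists (- q (- x)); exact: S_lb.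
by exists (q (x + 0%:C *: y) - 0 * q y), 0 => /=.
Qed.

Lemma tilt_le_at x t : 0 <= t -> tilt q y x <= q (x + t%:C *: y) - t * q y.
Proof. by move=> t0; apply: ge_inf; [exact: (S_inf x).2|exists t]. Qed.

Lemma tilt_glb x (M : R) :
  (forall t, 0 <= t -> M <= q (x + t%:C *: y) - t * q y) -> M <= tilt q y x.
Proof.
by move=> h; apply: lb_le_inf; [exact: (S_inf x).1|move=> _ [t t0 <-]; exact: h].
Qed.

Lemma tilt_le x : tilt q y x <= q x.
Proof.
by have := @tilt_le_at x 0 (lexx _); rewrite scale0r addr0 mul0r subr0.
Qed.

Lemma tilt_sublinear : sublinear (tilt q y).
Proof.
split.
  move=> x1 x2; rewrite -lerBlDr; apply: tilt_glb => t t0.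
  rewrite lerBlDr -lerBlDl; apply: tilt_glb => s s0.
  rewrite lerBlDl (le_trans (tilt_le_at _ (addr_ge0 t0 s0)))//.
  rewrite mulrDl opprD addrACA lerD2r rmorphD /= scalerDl addrACA.
  exact: sq.1.
apply: pos_homogeneous.
  apply/eqP; rewrite eq_le (le_trans (tilt_le _)) ?(sublinear0 sq) //=.
  apply: tilt_glb => t t0; rewrite (le_trans _ (@S_lb 0 _ _)) //.
    by rewrite oppr0 (sublinear0 sq) oppr0.
  by exists t.
move=> t x t0; rewrite -ler_pdivrMl //; apply: tilt_glb => s s0.
rewrite ler_pdivrMl //; have ts0 : 0 <= t * s by rewrite mulr_ge0 // ltW.
rewrite (le_trans (tilt_le_at _ ts0))// rmorphM /= -scalerA -scalerDr.
by rewrite sq.2 ?(ltW t0) // -mulrA -mulrBr.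
Qed.

End Tilt.

(** Zorn's lemma for the pointwise order. The functions are defined on all of
    [V], so no extension of partially defined functionals is involved. *)
Lemma minimal_sublinear p : sublinear p ->
  exists m, [/\ sublinear m, forall x, m x <= p x &
    forall q, sublinear q -> (forall x, q x <= m x) -> forall x, m x <= q x].
Proof.
move=> sp; pose T := {q : V -> R | sublinear q /\ forall x, q x <= p x}.
pose rel (s t : T) := `[< forall x, sval t x <= sval s x >].
have p0 : sublinear p /\ forall x, p x <= p x by split.
have [||A Atot|[m [sm mp]] mmin] := @ZL_preorder T (exist _ p p0) rel.
- by move=> s; apply/asboolP.
- move=> s t u /asboolP st /asboolP tu; apply/asboolP => x.
  exact: le_trans (tu x) (st x).
- have [->|/set0P[a Aa]] := eqVneq A set0; first by exists (exist _ p p0).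
  pose S x := [set sval s x | s in A].
  have S_lb x : lbound (S x) (- p (- x)).
    move=> _ [[s [ss sp']] As <-] /=.
    by rewrite (le_trans _ (sublinearN x ss))// lerN2.
  have S_inf x : has_inf (S x).
    by split; [exists (sval a x), a|exists (- p (- x)); exact: S_lb].
  pose q x := inf (S x).
  have q_le s x : A s -> q x <= sval s x.
    by move=> As; apply: ge_inf; [exact: (S_inf x).2|exists s].
  have q_glb x M : (forall s, A s -> M <= sval s x) -> M <= q x.
    by move=> h; apply: lb_le_inf; [exact: (S_inf x).1|move=> _ [s As <-]; exact: h].
  have sq : sublinear q.
    split.
      move=> x y; rewrite -lerBlDr; apply: (q_glb) => s As.
      rewrite lerBlDr -lerBlDl; apply: (q_glb) => t At; rewrite lerBlDl.
      have [/asboolP h|/asboolP h] := Atot s t As At.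
        rewrite (le_trans (q_le _ _ At))// (le_trans ((svalP t).1.1 _ _))//.
        by rewrite lerD2r.
      rewrite (le_trans (q_le _ _ As))// (le_trans ((svalP s).1.1 _ _))//.
      by rewrite lerD2l.
    apply: pos_homogeneous.
      apply/eqP; rewrite eq_le (le_trans (q_le _ _ Aa)) /=; last first.
        by rewrite (sublinear0 (svalP a).1).
      by apply: (q_glb) => s As; rewrite (sublinear0 (svalP s).1).
    move=> t x t0; rewrite -ler_pdivrMl //; apply: (q_glb) => s As.
    rewrite ler_pdivrMl // (le_trans (q_le _ _ As))//.
    by rewrite (svalP s).1.2 // ltW.
  have qp : sublinear q /\ forall x, q x <= p x.
    split=> // x; exact: le_trans (q_le _ _ Aa) ((svalP a).2 x).
  exists (exist _ q qp) => s As; apply/asboolP => x /=; exact: q_le.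
exists m; split => // q sq qm x.
have qp : sublinear q /\ forall x, q x <= p x.
  by split=> // y; exact: le_trans (qm y) (mp y).
have /asboolP := mmin (exist _ q qp) (introT (asboolP _) qm); exact.
Qed.

(** A minimal sublinear function equals its tilts, so it is additive. *)
Lemma minimal_sublinear_additive m : sublinear m ->
  (forall q, sublinear q -> (forall x, q x <= m x) -> forall x, m x <= q x) ->
  forall x y, m (x + y) = m x + m y.
Proof.
move=> sm mmin x y; apply/eqP; rewrite eq_le sm.1 /= -lerBrDr.
have := mmin _ (tilt_sublinear y sm) (tilt_le y sm) x.
move=> /le_trans; apply.
by have := tilt_le_at y sm x ler01; rewrite scale1r mul1r.
Qed.

Lemma sn_sublinear (p : seminorm V) : sublinear p.
Proof. by split=> [x y|t x t0]; [exact: snD|rewrite snZ normc_pos]. Qed.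

(** A minimal sublinear minorant of the tilt of [p] along [x0] is linear, and it
    is at most [- p x0] at [- x0]. *)
Lemma real_hahn_banach (p : seminorm V) (x0 : V) :
  exists u : V -> R, [/\ forall x y, u (x + y) = u x + u y,
    forall (t : R) x, u (t%:C *: x) = t * u x, forall x, u x <= p x &
    u x0 = p x0].
Proof.
have sp := sn_sublinear p.
have [u [su up umin]] := minimal_sublinear (tilt_sublinear x0 sp).
have uD := minimal_sublinear_additive su umin.
have uN x : u (- x) = - u x.
  by apply/eqP; rewrite -addr_eq0 -uD addNr sublinear0.
have ple x : u x <= p x by exact: le_trans (up x) (tilt_le x0 sp x).
exists u; split=> // [t x|].
  have [t0|t0] := leP 0 t; first exact: su.2.
  rewrite -[t in LHS]opprK rmorphN scaleNr uN su.2 ?oppr_ge0 ?(ltW t0) //.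
  by rewrite mulNr opprK.
apply/eqP; rewrite eq_le ple /= -lerN2 -uN.
apply: le_trans (up _) _; apply: le_trans (tilt_le_at x0 sp _ ler01) _.
by rewrite scale1r addNr (sublinear0 sp) mul1r sub0r.
Qed.

Lemma hahn_banach (p : seminorm V) (x0 : V) :
  exists psi : V -> R[i]^o, [/\ linear psi, forall x, normc (psi x) <= p x &
    normc (psi x0) = p x0].
Proof.
have [u [uD uZ up ux0]] := real_hahn_banach p x0.
have uN x : u (- x) = - u x.
  by have := uZ (-1) x; rewrite rmorphN rmorph1 scaleN1r mulN1r.
(* the complex linear functional with real part [u] *)
pose psi x : R[i]^o := u x +i* - u ('i *: x).
have psiD x y : psi (x + y) = psi x + psi y.
  by rewrite /psi scalerDr !uD opprD; apply/eqP; rewrite eq_complex /= !eqxx.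
have psiZ (a : R[i]) x : psi (a *: x) = a * psi x.
  have h v : u (a *: v) = complex.Re a * u v + complex.Im a * u ('i *: v).
    case: a => a b /=; rewrite -!uZ -uD scalerA -scalerDl; congr (u (_ *: _)).
    apply/eqP; rewrite eq_complex /=.
    by rewrite !(mulr0, mulr1, mul0r, subr0, addr0, add0r) !eqxx.
  rewrite /psi scalerA mulrC -scalerA !h scalerA -expr2 sqr_i scaleN1r uN.
  case: a {h} => a b /=; apply/eqP; rewrite eq_complex /=.
  by apply/andP; split; apply/eqP; ring.
have psi_le x : normc (psi x) <= p x.
  have [->|n0] := eqVneq (psi x) 0; first by rewrite normc0 sn_ge0.
  have np : 0 < normc (psi x).
    by rewrite lt_def normc_ge0 andbT; apply: contra_neq n0; exact: eq0_normc.
  (* multiplication by [a] turns the value [psi x] to the positive half-line *)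
  pose a := (normc (psi x))%:C / psi x.
  have na : normc a = 1.
    by rewrite normcM normcV normc_pos ?(ltW np) // divff // gt_eqF.
  have -> : normc (psi x) = u (a *: x).
    have : psi (a *: x) = (normc (psi x))%:C by rewrite psiZ divfK.
    by move=> /(congr1 (@complex.Re _)) /= ->.
  by rewrite (le_trans (up _))// snZ na mul1r.
exists psi; split => //; first by move=> a x y; rewrite psiD psiZ.
apply/eqP; rewrite eq_le psi_le -ux0 /=.
rewrite (le_trans (ler_norm _))// -sqrtr_sqr ler_sqrt ?addr_ge0 ?sqr_ge0 //.
by rewrite lerDl sqr_ge0.
Qed.

End HahnBanach.

(** * Interpolation at roots of unity in one variable *)

Section RootsOfUnity.
Variable R : realType.

Definition unity_root (N : nat) : R[i] :=
  cos (2 * pi / N%:R) +i* sin (2 * pi / N%:R).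

Lemma unity_rootX N m : unity_root N ^+ m =
  cos (2 * pi / N%:R * m%:R) +i* sin (2 * pi / N%:R * m%:R).
Proof.
elim: m => [|m ih].
  by rewrite expr0 mulr0 cos0 sin0; apply/eqP; rewrite eq_complex /= !eqxx.
rewrite exprSr ih -(natr1 m) [_ * (m%:R + 1)]mulrDr mulr1 cosD sinD /unity_root.
apply/eqP; rewrite eq_complex /=.
by apply/andP; split; apply/eqP; ring.
Qed.

Lemma unity_rootN N : (0 < N)%N -> unity_root N ^+ N = 1.
Proof.
move=> N0; rewrite unity_rootX divfK ?pnatr_eq0 -?lt0n // mulrC.
have -> : pi * 2 = pi *+ 2 :> R by rewrite mulr_natr.
by rewrite cos2pi sin2pi.
Qed.

Lemma normc_unity_root N : normc (unity_root N) = 1.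
Proof. by rewrite /= cos2Dsin2 sqrtr1. Qed.

Lemma unity_rootX_neq1 N m : (0 < m < N)%N -> unity_root N ^+ m != 1.
Proof.
move=> /andP[m0 mN]; rewrite unity_rootX eq_complex /= negb_and.
pose x : R := pi / N%:R * m%:R.
have N0 : 0 < N%:R :> R by rewrite ltr0n (leq_trans _ mN) //.
have s0 : 0 < sin x.
  apply: sin_gt0_pi; rewrite /x mulr_gt0 ?divr_gt0 ?pi_gt0 ?ltr0n ?(leq_trans _ mN) //=.
  by rewrite mulrAC ltr_pdivrMr // ltr_pM2l ?pi_gt0 // ltr_nat.
have -> : 2 * pi / N%:R * m%:R = x *+ 2 by rewrite /x; ring.
rewrite cos_mulr2n cos2sin2; apply/orP; left; rewrite lt_eqF //.
have -> : (1 - sin x ^+ 2) *+ 2 - 1 = 1 - sin x ^+ 2 *+ 2 by ring.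
by rewrite gtrDl oppr_lt0 pmulrn_lgt0 // exprn_gt0.
Qed.

Lemma unity_root_near1 (e : R) : 0 < e ->
  exists N, (1 < N)%N /\ normc (unity_root N - 1) < e.
Proof.
move=> e0; have e2 : 0 < e / 2 by rewrite divr_gt0.
have /nbhs_realP[t [t0 ht]] : nbhs (0 : R) [set x | `|cos x - 1| < e / 2].
  have /(_ [set y | `|y - 1| < e / 2]) := @continuous_cos R 0.
  by rewrite cos0; apply; apply/nbhs_realP; exists (e / 2).
have /nbhs_realP[s [s0 hs]] : nbhs (0 : R) [set x | `|sin x| < e / 2].
  have /(_ [set y | `|y| < e / 2]) := @continuous_sin R 0.
  rewrite sin0; apply; apply/nbhs_realP; exists (e / 2); split => // b.
  by rewrite subr0.
set m := Num.min t s; have m0 : 0 < m by rewrite lt_min t0.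
pose n := (Num.truncn (2 * pi / m)).+1.
have hn : 2 * pi / m < n%:R by rewrite /n truncnS_gt.
have hN : 2 * pi / (n.+1)%:R < m.
  rewrite ltr_pdivrMr ?ltr0n // [X in _ < X]mulrC -ltr_pdivrMr //.
  by rewrite (lt_trans hn) // ltr_nat.
exists n.+1; split => //; rewrite /unity_root; set x := 2 * pi / _ in hN *.
have x0 : 0 <= x by rewrite divr_ge0 // mulr_ge0 // ltW // pi_gt0.
have xm : `|x - 0| < m by rewrite subr0 ger0_norm.
have -> : (cos x +i* sin x) - 1 = (cos x - 1)%:C + (0 +i* sin x) :> R[i].
  by apply/eqP; rewrite eq_complex /= subr0 addr0 add0r !eqxx.
rewrite (le_lt_trans (le_normcD _ _))// (splitr e) ltrD //.
  rewrite /= expr0n addr0 sqrtr_sqr ht // (lt_le_trans xm) //.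
  by rewrite ge_min lexx.
rewrite /= expr0n add0r sqrtr_sqr hs // (lt_le_trans xm) //.
by rewrite ge_min lexx orbT.
Qed.

Lemma sum_unity_root (om : R[i]) N : om ^+ N = 1 -> om != 1 ->
  \sum_(j < N) om ^+ j = 0.
Proof.
move=> omN om1; apply/eqP; have := subrX1 om N; rewrite omN subrr.
by move=> /esym/eqP; rewrite mulf_eq0 subr_eq0 (negPf om1).
Qed.

Lemma normcX (a : R[i]) n : normc (a ^+ n) = normc a ^+ n.
Proof. by elim: n => [|n ih]; rewrite ?normc1 // !exprS normcM ih. Qed.

Lemma le_normcB (a b : R[i]) : normc (a - b) <= normc a + normc b.
Proof. by rewrite -[in normc b]normcN; exact: (@le_normcD R a (- b)). Qed.

Lemma normc_gt0 (a : R[i]) : (0 < normc a) = (a != 0).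
Proof.
rewrite lt_def normc_ge0 andbT; congr negb; apply/eqP/eqP => [|->].
  exact: eq0_normc.
by rewrite normc0.
Qed.

Lemma normc_nat n : normc (n%:R : R[i]) = n%:R.
Proof.
have -> : n%:R = (n%:R : R)%:C by rewrite rmorph_nat.
by rewrite normc_pos.
Qed.

End RootsOfUnity.

Section Interpolation.
Variables (R : realType) (V : lmodType R[i]) (q : seminorm V).
Variables (F G : R[i] -> V) (N : nat) (om : R[i]) (e delta : R).
Hypotheses (omN : om ^+ N = 1) (normc_om : normc om = 1)
  (om_prim : forall m, (0 < m < N)%N -> om ^+ m != 1)
  (N1 : (1 < N)%N) (om_near : normc (om - 1) < delta) (e0 : 0 <= e).
Hypothesis FG : forall a h, normc a <= 1 -> normc (a + h) <= 1 ->
  normc h < delta -> q (F (a + h) - F a - h *: G a) <= e * normc h.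

Let om0 : om != 0.
Proof. by rewrite -normc_gt0 normc_om. Qed.

Let om1 : om != 1.
Proof. by rewrite -[om]expr1 om_prim. Qed.

Let Nn0 : N%:R != 0 :> R[i].
Proof. by rewrite pnatr_eq0 -lt0n ltnW. Qed.

(** The weight at the node [om ^+ j] of the polynomial of degree less than [N]
    interpolating at the [N]-th roots of unity. *)
Definition interp_weight (w : R[i]) (j : nat) : R[i] :=
  N%:R^-1 * \sum_(m < N) (w * om ^- j) ^+ m.

(** The constant 1 is interpolated exactly: the other powers of [w] cancel over
    the roots of unity. *)
Lemma sum_interp_weight w : \sum_(j < N) interp_weight w j = 1.
Proof.
rewrite -mulr_sumr exchange_big /=.
rewrite (bigD1 (Ordinal (ltnW N1))) //= [X in _ + X]big1 ?addr0.
  rewrite (eq_bigr (fun=> 1)) // big_const_ord iter_addr_0.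
  by rewrite mulVf.
move=> m m0; under eq_bigr do rewrite exprMn.
rewrite -mulr_sumr; under eq_bigr do rewrite -exprVn exprAC.
rewrite sum_unity_root ?mulr0 //; first by rewrite exprAC exprVn omN invr1 expr1n.
rewrite exprVn invr_eq1 om_prim // ltn_ord andbT lt0n.
by apply: contra m0 => /eqP m0; apply/eqP/val_inj.
Qed.

(** The cancellation that tames the weights: on the unit disc their moduli may
    add up to a multiple of [log N], but multiplied by the distance of [w] to
    its node each weight is at most [2 / N]. *)
Lemma interp_weight_dist w j :
  interp_weight w j * (om ^+ j - w) = N%:R^-1 * om ^+ j * (1 - w ^+ N).
Proof.
rewrite /interp_weight -!mulrA; congr (_ * _).
have := subrX1 (w * om ^- j) N.
have -> : (w * om ^- j) ^+ N = w ^+ N.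
  by rewrite exprMn exprVn exprAC omN expr1n invr1 mulr1.
move=> h; rewrite -[1 - w ^+ N]opprB h.
have := expf_neq0 j om0; set o := om ^+ j => o0; set S := \sum_(_ < _) _.
by field.
Qed.

Lemma convex_disc (w : R[i]) j (t : R) : normc w <= 1 -> 0 <= t <= 1 ->
  normc (w + t%:C * (om ^+ j - w)) <= 1.
Proof.
move=> w1 /andP[t0 t1]; have u0 : 0 <= 1 - t by rewrite subr_ge0.
have -> : w + t%:C * (om ^+ j - w) = (1 - t)%:C * w + t%:C * om ^+ j.
  by rewrite rmorphB /=; ring.
rewrite (le_trans (le_normcD _ _))// !normcM !normc_pos // normcX normc_om.
rewrite expr1n mulr1 -lerBrDr; exact: ler_piMr.
Qed.

(** A discrete form of the vanishing of the integral of the derivative of [F]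
    along a circle: the increments of [F] along the [N] nodes telescope. *)
Lemma sum_derivative_circle (w : R[i]) (t : R) : normc w <= 1 -> 0 < t <= 1 ->
  q (\sum_(j < N) om ^+ j *: G (w + t%:C * (om ^+ j - w))) <= e * N%:R.
Proof.
move=> w1 /andP[t0 t1]; have tt : 0 <= t <= 1 by rewrite (ltW t0).
pose y j := w + t%:C * (om ^+ j - w).
pose h j := t%:C * (om - 1) * om ^+ j.
have yS j : y j.+1 = y j + h j by rewrite /y /h exprS; ring.
have nh j : normc (h j) = t * normc (om - 1).
  by rewrite !normcM normcX normc_om expr1n mulr1 normc_pos ?ltW.
have h_lt j : normc (h j) < delta.
  rewrite nh (le_lt_trans _ om_near) // ler_piMl ?normc_ge0 //.
have err j : q (F (y j.+1) - F (y j) - h j *: G (y j)) <= e * (t * normc (om - 1)).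
  rewrite yS -(nh j); apply: FG => //; first exact: convex_disc.
  by rewrite -yS; exact: convex_disc.
have tel : \sum_(j < N) (F (y j.+1) - F (y j)) = 0.
  rewrite -(big_mkord xpredT (fun j => F (y j.+1) - F (y j))) telescope_sumr //.
  by rewrite /y omN expr0 subrr.
have : q (\sum_(j < N) (F (y j.+1) - F (y j) - h j *: G (y j))) <=
    t * normc (om - 1) * (e * N%:R).
  rewrite (le_trans (sn_sum _ _ _ _))//.
  rewrite (le_trans (ler_sum _ (fun (j : 'I_N) _ => err j)))//.
  rewrite sumr_const card_ord -mulr_natr le_eqVlt; apply/orP; left.
  by apply/eqP; ring.
rewrite sumrB tel sub0r snN.
under eq_bigr do rewrite /h -scalerA.
rewrite -scaler_sumr snZ normcM normc_pos ?(ltW t0) //.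
by rewrite ler_pM2l // mulr_gt0 // normc_gt0 subr_eq0.
Qed.

(** The difference of [F w] and its interpolant is the increment over [0 <= t
    <= 1] of the weighted mean of [F (w + t * (om ^+ j - w))]; splitting it
    into [M] steps replaces integration of its derivative, which
    [interp_weight_dist] and [sum_derivative_circle] show to be small. *)
Lemma interpolation_error (M : nat) (w : R[i]) : 2 / M%:R < delta ->
  (0 < M)%N -> normc w <= 1 ->
  q (F w - \sum_(j < N) interp_weight w j *: F (om ^+ j)) <= 4 * e.
Proof.
move=> Md M0 w1; have M0R : 0 < M%:R :> R by rewrite ltr0n.
have N0R : 0 < N%:R :> R by rewrite ltr0n ltnW.
pose x j l := w + (l%:R / M%:R)%:C * (om ^+ j - w).
pose c := interp_weight w.
have -> : F w - \sum_(j < N) c j *: F (om ^+ j) =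
    - \sum_(l < M) \sum_(j < N) c j *: (F (x j l.+1) - F (x j l)).
  rewrite exchange_big /= -[F w]scale1r -(sum_interp_weight w) scaler_suml.
  rewrite -sumrB -sumrN; apply: eq_bigr => j _; rewrite -scaler_sumr.
  rewrite -(big_mkord xpredT (fun l => F (x j l.+1) - F (x j l))).
  rewrite telescope_sumr // /x divff ?gt_eqF // mul0r rmorph0 rmorph1.
  by rewrite mul0r mul1r addr0 [w + _]addrC subrK -scalerBr -scalerN opprB.
have w2 : normc (1 - w ^+ N) <= 2.
  rewrite (le_trans (le_normcB _ _))// normc1 normcX.
  by rewrite (_ : 2 = 1 + 1) // lerD2l exprn_ile1 ?normc_ge0.
have step (l : 'I_M) :
    q (\sum_(j < N) c j *: (F (x j l.+1) - F (x j l))) <= 4 * e / M%:R.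
  have tl k : (k <= M)%N -> 0 <= k%:R / M%:R :> R.
    by move=> _; rewrite divr_ge0 ?ler0n.
  have tu k : (k <= M)%N -> k%:R / M%:R <= 1 :> R.
    by move=> kM; rewrite ler_pdivrMr // mul1r ler_nat.
  pose h j := M%:R^-1 * (om ^+ j - w).
  (* [FG] is applied at the later of the two points, backwards, because
     [sum_derivative_circle] excludes [t = 0] *)
  have xS j : x j l = x j l.+1 + - h j.
    rewrite /x /h -natr1 mulrDl rmorphD /= mul1r fmorphV rmorph_nat; ring.
  have ch j : c j * h j = M%:R^-1 * (1 - w ^+ N) * N%:R^-1 * om ^+ j.
    rewrite /h mulrCA interp_weight_dist; ring.
  have nch j : normc (c j) * normc (h j) <= 2 / M%:R / N%:R.
    rewrite -normcM ch !normcM normcX normc_om expr1n mulr1 !normcV !normc_nat.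
    by rewrite ler_wpM2r ?invr_ge0 ?ler0n // mulrC ler_wpM2r ?invr_ge0 ?ler0n.
  have n2 j : normc (om ^+ j - w) <= 2.
    rewrite (le_trans (le_normcB _ _))// normcX normc_om expr1n.
    by rewrite (_ : 2 = 1 + 1) // lerD2l.
  have err j : q (F (x j l) - F (x j l.+1) + h j *: G (x j l.+1)) <=
      e * normc (h j).
    have -> : F (x j l) - F (x j l.+1) + h j *: G (x j l.+1) =
        F (x j l.+1 + - h j) - F (x j l.+1) - (- h j) *: G (x j l.+1).
      by rewrite -xS scaleNr opprK.
    rewrite -[normc (h j)]normcN; apply: FG.
    - by apply: convex_disc; rewrite // tl // tu.
    - by rewrite -xS; apply: convex_disc; rewrite // tl ?tu // ltnW.
    - rewrite normcN (le_lt_trans _ Md) // normcM normcV normc_nat mulrC.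
      by rewrite ler_wpM2r ?invr_ge0 ?ler0n.
  have -> : \sum_(j < N) c j *: (F (x j l.+1) - F (x j l)) =
      (M%:R^-1 * (1 - w ^+ N) * N%:R^-1) *:
        \sum_(j < N) om ^+ j *: G (x j l.+1) -
      \sum_(j < N) c j *: (F (x j l) - F (x j l.+1) + h j *: G (x j l.+1)).
    rewrite scaler_sumr -sumrB; apply: eq_bigr => j _.
    by rewrite scalerA -ch -(scalerA (c j)) -scalerBr opprD opprB [in RHS]addrC subrK.
  rewrite (le_trans (snD _ _ _))// snN.
  have -> : 4 * e / M%:R = 2 * e / M%:R + 2 * e / M%:R by field; rewrite gt_eqF.
  rewrite lerD //.
    rewrite snZ !normcM !normcV !normc_nat.
    have hG : q (\sum_(j < N) om ^+ j *: G (x j l.+1)) <= e * N%:R.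
      by apply: sum_derivative_circle; rewrite // divr_gt0 ?ltr0n //= tu.
    have -> : 2 * e / M%:R = M%:R^-1 * 2 / N%:R * (e * N%:R).
      by field; rewrite !gt_eqF.
    rewrite ler_pM ?sn_ge0 //; first by rewrite !mulr_ge0 ?invr_ge0 ?normc_ge0.
    by rewrite ler_wpM2r ?invr_ge0 ?ler0n // ler_wpM2l ?invr_ge0 ?ler0n.
  rewrite (le_trans (sn_sum _ _ _ _))//.
  have bnd (j : 'I_N) : true -> q (c j *: (F (x j l) - F (x j l.+1) + h j *: G (x j l.+1)))
      <= 2 / M%:R / N%:R * e.
    move=> _; rewrite snZ (le_trans (ler_wpM2l (normc_ge0 _) (err j)))//.
    by rewrite mulrCA mulrC ler_wpM2r.
  rewrite (le_trans (ler_sum _ bnd))// sumr_const card_ord -mulr_natr.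
  by rewrite le_eqVlt; apply/orP; left; apply/eqP; field; rewrite !gt_eqF.
rewrite snN (le_trans (sn_sum _ _ _ _))//.
rewrite (le_trans (ler_sum _ (fun l _ => step l)))// sumr_const card_ord.
by rewrite -[_ *+ M]mulr_natr divfK ?gt_eqF.
Qed.

End Interpolation.

(** * Vector-valued polynomials and Cauchy estimates *)

Section MpolyFunctions.
Variables (R : realType) (d : nat).
Local Notation MP := (mpoly d R[i]).
Local Notation Cd := 'rV[R[i]^o]_d.

Lemma mpoly_alg_ind (P : MP -> Prop) :
  (forall c, P (mpolyC d c)) -> (forall i, P (mpolyX _ (mnm1 i))) ->
  (forall p q, P p -> P q -> P (p + q)) ->
  (forall p q, P p -> P q -> P (p * q)) -> forall p, P p.
Proof.
move=> PC PX PD PM; elim/mpolyind => [|c m p _ _ ih].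
  by rewrite -mpolyC0.
apply: (PD) => //; rewrite -mul_mpolyC; apply: (PM) => //.
rewrite mpolyXE_id; apply: (big_ind P) => // [|i _].
  by rewrite -mpolyC1.
elim: (m i) => [|n ihn]; first by rewrite expr0 -mpolyC1.
by rewrite exprS; apply: PM.
Qed.

Lemma meval_bounded (p : MP) (B : R) : exists M : R, 0 <= M /\
  forall w : Cd, (forall k, normc (w 0 k) <= B) -> normc p.@[w 0] <= M.
Proof.
elim/mpoly_alg_ind: p => [c|i|p q [M [M0 hM]] [N [N0 hN]]|p q [M [M0 hM]] [N [N0 hN]]].
- by exists (normc c); rewrite normc_ge0; split => // w _; rewrite mevalC.
- exists `|B|; split => // w hw; rewrite mevalXU.
  by rewrite (le_trans (hw i)) // ler_norm.
- exists (M + N); split => [|w hw]; first by rewrite addr_ge0.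
  by rewrite mevalD (le_trans (le_normcD _ _))// lerD ?hM ?hN.
- exists (M * N); split => [|w hw]; first by rewrite mulr_ge0.
  by rewrite mevalM normcM ler_pM ?normc_ge0 ?hM ?hN.
Qed.

Lemma meval_continuous (p : MP) (w : Cd) (e : R) : 0 < e ->
  \forall v \near w, normc (p.@[(v : Cd) 0] - p.@[w 0]) < e.
Proof.
elim/mpoly_alg_ind: p e => [c|i|p q hp hq|p q hp hq] e e0.
- by apply/nbhs_rowP; exists 1; split => // v _; rewrite !mevalC subrr normc0.
- apply/nbhs_rowP; exists e; split => // v hv.
  by rewrite !mevalXU hv.
- have e2 : 0 < e / 2 by rewrite divr_gt0.
  have hp' := hp _ e2; have hq' := hq _ e2.
  near=> v; rewrite !mevalD opprD addrACA.
  by rewrite (le_lt_trans (le_normcD _ _))// (splitr e) ltrD //; near: v.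
- set a := normc p.@[w 0]; set b := normc q.@[w 0].
  have a0 : 0 <= a by exact: normc_ge0.
  have b0 : 0 <= b by exact: normc_ge0.
  have ep : 0 < e / 2 / (b + 1) by rewrite !divr_gt0 // ltr_wpDl.
  have eq : 0 < Num.min 1 (e / 2 / (a + 1)).
    by rewrite lt_min ltr01 !divr_gt0 // ltr_wpDl.
  have hp' := hp _ ep; have hq' := hq _ eq.
  near=> v; rewrite !mevalM.
  have -> : p.@[v 0] * q.@[v 0] - p.@[w 0] * q.@[w 0] =
    (p.@[v 0] - p.@[w 0]) * q.@[v 0] + p.@[w 0] * (q.@[v 0] - q.@[w 0]) by ring.
  have h1 : normc (p.@[v 0] - p.@[w 0]) < e / 2 / (b + 1) by near: v.
  have h2 : normc (q.@[v 0] - q.@[w 0]) < Num.min 1 (e / 2 / (a + 1)) by near: v.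
  move: h2; rewrite lt_min => /andP[h2 h3].
  have h4 : normc q.@[v 0] <= b + 1.
    rewrite -[X in normc X](subrK q.@[w 0]) (le_trans (le_normcD _ _))//.
    by rewrite addrC lerD2l ltW.
  rewrite (le_lt_trans (le_normcD _ _))// !normcM (splitr e) ltr_leD //.
    rewrite (le_lt_trans (ler_wpM2l (normc_ge0 _) h4))//.
    by rewrite -ltr_pdivlMr // ltr_wpDl.
  rewrite (le_trans (ler_wpM2l a0 (ltW h3)))//.
  rewrite mulrCA ger_pMr ?divr_gt0 // ler_pdivrMr ?ltr_wpDl //.
  by rewrite mul1r lerDl.
Unshelve. all: by end_near. Qed.

Lemma meval_line (p : MP) (w : Cd) (k : 'I_d) : exists A : {poly R[i]},
  (forall h : R[i], p.@[(w + h *: delta_mx 0 k) 0] = A.[h]) /\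
  A`_1 = (mderiv k p).@[w 0].
Proof.
elim/mpoly_alg_ind: p => [c|i|p q [A [hA A1]] [B [hB B1]]|p q [A [hA A1]] [B [hB B1]]].
- exists c%:P; split => [h|]; first by rewrite mevalC hornerC.
  by rewrite mderivC meval0 coefC.
- exists ((w 0 i)%:P + (i == k)%:R *: 'X); split => [h|].
    rewrite mevalXU !mxE eqxx /= !hornerE; congr (_ + _).
    exact: mulrC.
  rewrite coefD coefC coefZ coefX /= add0r mulr1 mderivX mevalZ.
  rewrite mnm1E; have [<-|_] := eqVneq i k; last by rewrite mul0r.
  have -> : mnm_sub (mnm1 i) (mnm1 i) = mnm0 :> multinom d.
    by apply/mnmP => j; rewrite mnmBE mnm0E subnn.
  by rewrite mpolyX0 meval1 mulr1.
- exists (A + B); split => [h|]; first by rewrite mevalD hA hB hornerD.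
  by rewrite coefD A1 B1 mderivD mevalD.
- exists (A * B); split => [h|]; first by rewrite mevalM hA hB hornerM.
  rewrite coefM big_ord_recl big_ord1 /= subn0 subnn A1 B1.
  have := hA 0; have := hB 0; rewrite scale0r addr0 !horner_coef0 => <- <-.
  by rewrite mderivM mevalD !mevalM addrC.
Qed.

Lemma meval_affine (p : MP) (a b : 'I_d -> R[i]) : exists q : MP,
  forall w : Cd, q.@[w 0] = p.@[(\row_k (a k * w 0 k + b k) : Cd) 0].
Proof.
elim/mpoly_alg_ind: p => [c|i|p q [A hA] [B hB]|p q [A hA] [B hB]].
- by exists (mpolyC d c) => w; rewrite !mevalC.
- exists (a i *: mpolyX _ (mnm1 i) + mpolyC d (b i)) => w.
  by rewrite mevalD mevalZ mevalC !mevalXU mxE.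
- by exists (A + B) => w; rewrite !mevalD hA hB.
- by exists (A * B) => w; rewrite !mevalM hA hB.
Qed.

Lemma meval_horner (A : {poly R[i]}) (k : 'I_d) : exists q : MP,
  forall w : Cd, q.@[w 0] = A.[w 0 k].
Proof.
elim/poly_ind: A => [|A c [q hq]].
  by exists 0 => w; rewrite meval0 horner0.
exists (q * mpolyX _ (mnm1 k) + mpolyC d c) => w.
by rewrite mevalD mevalM mevalC mevalXU hq !hornerE.
Qed.

End MpolyFunctions.

Section CauchyCoefficients.
Variables (R : realType) (V : lmodType R[i]) (q : seminorm V).
Variables (a : nat -> V) (n : nat) (rho M : R).
Let F (h : R[i]) := \sum_(m < n) h ^+ m *: a m.
Hypotheses (rho0 : 0 < rho)
  (FM : forall h, normc h <= rho -> q (F h) <= M).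

(** The coefficients are finite Fourier sums, because the monomials of degree
    less than [N] are orthonormal on the [N]-th roots of unity. *)
Lemma cauchy_coefficient m : (m < n)%N -> q (a m) <= M / rho ^+ m.
Proof.
move=> mn; pose N := n.+1; pose om : R[i] := unity_root R N.
have omN : om ^+ N = 1 by exact: unity_rootN.
have om0 : om != 0 by rewrite -normc_gt0 normc_unity_root.
have N0 : N%:R != 0 :> R[i] by rewrite pnatr_eq0.
have -> : a m = (rho ^- m)%:C *: (N%:R^-1 *:
    \sum_(j < N) (om ^- m) ^+ j *: F (rho%:C * om ^+ j)).
  have -> : \sum_(j < N) (om ^- m) ^+ j *: F (rho%:C * om ^+ j) =
      (N%:R * (rho ^+ m)%:C) *: a m.
    under eq_bigr do rewrite /F scaler_sumr.
    rewrite exchange_big /= (bigD1 (Ordinal mn)) //= [X in _ + X]big1 ?addr0.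
      rewrite -[N in N%:R](card_ord N) -sumr_const mulr_suml scaler_suml.
      apply: eq_bigr => j _; rewrite scalerA mul1r exprMn rmorphXn /=.
      rewrite [_ * (om ^+ j) ^+ m]mulrC mulrA [(om ^+ j) ^+ m]exprAC -exprMn.
      by rewrite mulVf ?expf_neq0 // expr1n mul1r.
    move=> l lm; under eq_bigr do rewrite scalerA.
    rewrite -scaler_suml.
    have -> : \sum_(j < N) (om ^- m) ^+ j * (rho%:C * om ^+ j) ^+ l =
        rho%:C ^+ l * \sum_(j < N) (om ^- m * om ^+ l) ^+ j.
      rewrite mulr_sumr; apply: eq_bigr => j _.
      by rewrite !exprMn [(om ^+ j) ^+ l]exprAC mulrCA.
    rewrite sum_unity_root ?mulr0 ?scale0r //.
      by rewrite exprMn exprVn exprAC omN expr1n invr1 mul1r exprAC omN expr1n.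
    have neq i j : (i < j < N)%N -> om ^+ j != om ^+ i.
      move=> /andP[ij jN]; rewrite -(subnKC (ltnW ij)) exprD -subr_eq0.
      rewrite -[X in _ - X]mulr1 -mulrBr mulf_eq0 negb_or expf_neq0 //= subr_eq0.
      by apply: unity_rootX_neq1; rewrite subn_gt0 ij (leq_ltn_trans (leq_subr _ _)).
    rewrite -(inj_eq (mulfI (expf_neq0 m om0))) mulVKf ?expf_neq0 // mulr1.
    have [lm'|ml|lm'] := ltngtP l m.
    - by rewrite eq_sym; apply: neq; rewrite lm' (ltn_trans mn).
    - by apply: neq; rewrite ml (ltn_trans (ltn_ord l)).
    - by move: lm; rewrite -(inj_eq val_inj) /= lm' eqxx.
  rewrite !scalerA -mulrA mulKf // -rmorphM mulVf ?scale1r //.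
  by rewrite expf_neq0 // gt_eqF.
rewrite snZ normc_pos ?invr_ge0 ?exprn_ge0 ?(ltW rho0) // mulrC ler_wpM2r //.
  by rewrite invr_ge0 exprn_ge0 // ltW.
rewrite snZ normcV normc_nat ler_pdivrMl ?ltr0n //.
rewrite (le_trans (sn_sum _ _ _ _))//.
have bnd (j : 'I_N) : true -> q ((om ^- m) ^+ j *: F (rho%:C * om ^+ j)) <= M.
  move=> _; rewrite snZ normcX normcV normcX normc_unity_root expr1n invr1.
  rewrite expr1n mul1r; apply: FM; rewrite normcM normcX normc_unity_root.
  by rewrite expr1n mulr1 normc_pos // ltW.
by rewrite (le_trans (ler_sum _ bnd))// sumr_const card_ord mulr_natl.
Qed.

Lemma taylor_remainder (h : R[i]) : (1 < n)%N -> normc h <= rho / 2 ->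
  q (F h - F 0 - h *: a 1%N) <= 2 * M / rho ^+ 2 * normc h ^+ 2.
Proof.
move=> n1 hr.
have M0 : 0 <= M by rewrite (le_trans (sn_ge0 q (F 0))) // FM // normc0 ltW.
have F0 : F 0 = a 0%N.
  rewrite /F (bigD1 (Ordinal (ltnW n1))) //= big1 ?addr0 ?expr0 ?scale1r //.
  by move=> i i0; rewrite expr0n (_ : (i == 0%N :> nat) = false) ?scale0r //; exact: negbTE.
have -> : F h - F 0 - h *: a 1%N = \sum_(2 <= m < n) h ^+ m *: a m.
  rewrite F0 /F -(big_mkord xpredT (fun m => h ^+ m *: a m)).
  rewrite big_ltn 1?ltnW // big_ltn // expr0 scale1r expr1.
  by rewrite (addrC (a 0%N)) addrK addrC addKr.
set t := normc h / rho.
have t0 : 0 <= t by rewrite divr_ge0 ?normc_ge0 // ltW.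
have t12 : t <= 1 / 2 by rewrite ler_pdivrMr // mulrC mulrA mulr1.
rewrite (le_trans (sn_sum _ _ _ _))//.
have -> : 2 * M / rho ^+ 2 * normc h ^+ 2 = M * t ^+ 2 * 2.
  by rewrite /t exprMn exprVn; ring.
have bnd : \sum_(2 <= m < n) q (h ^+ m *: a m) <= \sum_(2 <= m < n) M * t ^+ m.
  rewrite !big_nat; apply: ler_sum => m /andP[_ mn].
  rewrite snZ normcX /t exprMn exprVn mulrCA ler_wpM2l ?exprn_ge0 ?normc_ge0 //.
  exact: cauchy_coefficient.
rewrite (le_trans bnd)// -mulr_sumr -mulrA ler_wpM2l //.
have -> : \sum_(2 <= m < n) t ^+ m = \sum_(0 <= i < n - 2) t ^+ (i + 2).
  exact: (big_addn 0 n 2 xpredT (fun m => t ^+ m)).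
rewrite (eq_bigr (fun i => t ^+ 2 * t ^+ i)); last by move=> i _; rewrite addnC exprD.
rewrite -mulr_sumr ler_wpM2l ?exprn_ge0 // big_mkord.
set k := (n - 2)%N; have := subrX1 t k; set S := \sum_(_ < _) _ => hS.
have : (1 - t) * S <= 1.
  by rewrite -[1 - t]opprB mulNr -hS opprB gerBl exprn_ge0.
have S0 : 0 <= S by apply: sumr_ge0 => i _; rewrite exprn_ge0.
rewrite -ler_pdivlMl; last by rewrite subr_gt0 (le_lt_trans t12)// ltr_pdivrMr // mul1r ltr1n.
move=> /le_trans; apply; rewrite mulr1 -[leRHS]invrK lef_pV2 ?posrE ?invr_gt0 //.
  by lra.
by lra.
Qed.

End CauchyCoefficients.

Section VectorPolynomials.
Variables (R : realType) (d : nat) (E : lmodType R[i]).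
Local Notation MP := (mpoly d R[i]).
Local Notation Cd := 'rV[R[i]^o]_d.

(** A polynomial with values in [E], as a list of terms [(p, x)] standing for
    [p *: x]. *)
Definition epoly := seq (MP * E).

Implicit Types (s t : epoly) (w : Cd).

Definition ev s w : E := \sum_(t <- s) t.1.@[w 0] *: t.2.

Lemma ev_cat s t w : ev (s ++ t) w = ev s w + ev t w.
Proof. by rewrite /ev big_cat. Qed.

Lemma ev_cons x s w : ev (x :: s) w = x.1.@[w 0] *: x.2 + ev s w.
Proof. by rewrite /ev big_cons. Qed.

Definition epoly_scale (a : R[i]) s : epoly := [seq (x.1, a *: x.2) | x <- s].

Lemma ev_scale a s w : ev (epoly_scale a s) w = a *: ev s w.
Proof.
rewrite /ev big_map scaler_sumr; apply: eq_bigr => x _ /=.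
by rewrite !scalerA mulrC.
Qed.

Definition epoly_deriv (k : 'I_d) s : epoly :=
  [seq (mderiv k x.1, x.2) | x <- s].

Definition epoly_derivs (l : seq 'I_d) s : epoly := foldr epoly_deriv s l.

Lemma epoly_derivs_sub l s t w :
  ev (epoly_derivs l (s ++ epoly_scale (-1) t)) w =
  ev (epoly_derivs l s) w - ev (epoly_derivs l t) w.
Proof.
have -> : epoly_derivs l (s ++ epoly_scale (-1) t) =
    epoly_derivs l s ++ epoly_scale (-1) (epoly_derivs l t).
  elim: l => //= k l ->; rewrite /epoly_deriv map_cat; congr (_ ++ _).
  by rewrite /epoly_scale -!map_comp.
by rewrite ev_cat ev_scale scaleN1r.
Qed.

Lemma ev_line s w (k : 'I_d) : exists (n : nat) (a : nat -> E),
  [/\ (1 < n)%N, forall h : R[i],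
      ev s (w + h *: delta_mx 0 k) = \sum_(m < n) h ^+ m *: a m &
    a 1%N = ev (epoly_deriv k s) w].
Proof.
suff [n [a [n1 an h a1]]] : exists (n : nat) (a : nat -> E),
  [/\ (1 < n)%N, forall m, (n <= m)%N -> a m = 0, forall h : R[i],
      ev s (w + h *: delta_mx 0 k) = \sum_(m < n) h ^+ m *: a m &
    a 1%N = ev (epoly_deriv k s) w] by exists n, a.
elim: s => [|x s [n [a [n1 an ha a1]]]].
  exists 2%N, (fun=> 0); split=> // [h|]; last by rewrite /ev big_nil.
  by rewrite /ev big_nil big1 // => i _; rewrite scaler0.
have [A [hA A1]] := meval_line x.1 w k.
have widen (b : nat -> E) u v (h : R[i]) : (u <= v)%N ->
    (forall m, (u <= m)%N -> b m = 0) ->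
    \sum_(m < u) h ^+ m *: b m = \sum_(m < v) h ^+ m *: b m.
  move=> uv bu; rewrite -(big_mkord xpredT (fun m => h ^+ m *: b m)).
  rewrite -(big_mkord xpredT (fun m => h ^+ m *: b m)) [RHS](big_cat_nat (leq0n u) uv) /=.
  rewrite [X in _ + X]big_nat [X in _ + X]big1 ?addr0 // => m /andP[um _].
  by rewrite bu // scaler0.
exists (maxn n (size A)), (fun m => A`_m *: x.2 + a m); split.
- by rewrite leq_max n1.
- move=> m; rewrite geq_max => /andP[nm Am].
  by rewrite an // nth_default // scale0r addr0.
- move=> h; rewrite ev_cons ha hA (horner_coef_wide (n := maxn n (size A))).
    rewrite (widen a n (maxn n (size A))) ?leq_maxl // scaler_suml -big_split /=.
    apply: eq_bigr => m _; rewrite scalerDr !scalerA; congr (_ *: _ + _).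
    exact: mulrC.
  exact: leq_maxr.
- by rewrite /= ev_cons /= A1 a1.
Qed.

Lemma ev_bounded s (B : R) : exists M : R, 0 <= M /\
  forall w, (forall k, normc (w 0 k) <= B) ->
  \sum_(t <- s) normc t.1.@[w 0] <= M.
Proof.
elim: s => [|x s [M [M0 hM]]]; first by exists 0; split => // w _; rewrite big_nil.
have [N [N0 hN]] := meval_bounded x.1 B.
exists (N + M); split => [|w hw]; first by rewrite addr_ge0.
by rewrite big_cons lerD ?hN ?hM.
Qed.

Lemma ev_continuous (q : seminorm E) s w (e : R) : 0 < e ->
  \forall v \near w, q (ev s v - ev s w) < e.
Proof.
elim: s e => [|x s ih] e e0.
  by apply/nbhs_rowP; exists 1; split => // v _; rewrite /ev !big_nil subrr sn0.
have e1 : 0 < e / 2 / (q x.2 + 1).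
  by rewrite !divr_gt0 // ltr_wpDl // sn_ge0.
have e2 : 0 < e / 2 by rewrite divr_gt0.
have h1 := meval_continuous x.1 w e1; have h2 := ih _ e2.
near=> v; rewrite !ev_cons opprD addrACA -scalerBl.
rewrite (le_lt_trans (snD _ _ _))// (splitr e) ler_ltD //; last by near: v.
rewrite snZ.
have h : normc (x.1.@[(v : Cd) 0] - x.1.@[w 0]) < e / 2 / (q x.2 + 1) by near: v.
rewrite (le_trans (ler_wpM2r (sn_ge0 _ _) (ltW h)))//.
rewrite mulrAC ler_pdivrMr ?ltr_wpDl ?sn_ge0 // ler_wpM2l ?(ltW e2) //.
by rewrite lerDl.
Unshelve. all: by end_near. Qed.

End VectorPolynomials.

Arguments epoly {R} d E.

Section PolydiscEstimates.
Variables (R : realType) (d : nat) (z : 'rV[R[i]^o]_d) (r : 'I_d -> R).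
Hypothesis r0 : forall k, 0 < r k.
Local Notation Cd := 'rV[R[i]^o]_d.

Definition cpolydisc (rho : R) : set Cd :=
  [set w | forall k, normc (w 0 k - z 0 k) <= rho * r k].

Lemma cpolydisc_le rho rho' : rho <= rho' -> cpolydisc rho `<=` cpolydisc rho'.
Proof.
move=> le w hw k; rewrite (le_trans (hw k))// ler_wpM2r // ltW //.
Qed.

Lemma cpolydisc_line rho rho' w (h : R[i]) (k : 'I_d) : rho <= rho' ->
  cpolydisc rho w -> normc h <= (rho' - rho) * r k ->
  cpolydisc rho' (w + h *: delta_mx 0 k).
Proof.
move=> le hw hh j; rewrite !mxE eqxx /=; have [->|_] := eqVneq j k.
  rewrite mulr1 addrAC (le_trans (le_normcD _ _))//.
  by rewrite (le_trans (lerD (hw k) hh))// -mulrDl addrC subrK.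
by rewrite mulr0 addr0; exact: cpolydisc_le le _ hw j.
Qed.

Lemma polydisc_sub w : polydisc z r w ->
  exists rho, [/\ 0 < rho, rho < 1 & cpolydisc rho w].
Proof.
move=> hw; pose rho := \big[Num.max/(1 / 2)]_k (normc (w 0 k - z 0 k) / r k).
exists rho; split.
- by rewrite (lt_le_trans _ (bigmax_ge_id _ _ _ _)).
- apply: bigmax_lt; first by rewrite ltr_pdivrMr // mul1r ltr1n.
  by move=> k _; rewrite ltr_pdivrMr // mul1r hw.
- move=> k; rewrite -ler_pdivrMr //.
  exact: (le_bigmax_cond _ (fun k => normc (w 0 k - z 0 k) / r k)).
Qed.

Lemma cpolydisc_polydisc rho w : rho < 1 -> cpolydisc rho w -> polydisc z r w.
Proof. by move=> r1 hw k; rewrite (le_lt_trans (hw k))// gtr_pMl. Qed.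

Lemma polydisc_open w : polydisc z r w -> nbhs w (polydisc z r).
Proof.
move=> /polydisc_sub[rho [rho0 rho1 hw]].
pose e := \big[Num.min/1]_k ((1 - rho) * r k).
apply/nbhs_rowP; exists e; split.
  by apply: lt_bigmin => // k _; rewrite mulr_gt0 // subr_gt0.
move=> v hv k; rewrite -(subrKA (w 0 k)).
rewrite (le_lt_trans (le_normcD _ _))// -[X in _ < X]mul1r -(subrK rho 1) mulrDl.
rewrite ltr_leD // (lt_le_trans (hv k)) //.
exact: (bigmin_le_cond _ (fun k => (1 - rho) * r k)).
Qed.

Lemma near_cpolydisc w : polydisc z r w -> exists2 rho,
  0 < rho < 1 & nbhs w (cpolydisc rho).
Proof.
move=> /polydisc_sub[rho [rho0 rho1 hw]].
pose rho' := (rho + 1) / 2.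
have lt1 : rho < rho' by rewrite /rho'; lra.
have lt2 : rho' < 1 by rewrite /rho'; lra.
exists rho'; first by rewrite lt2 (lt_trans rho0).
pose e := \big[Num.min/1]_k ((rho' - rho) * r k).
apply/nbhs_rowP; exists e; split.
  by apply: lt_bigmin => // k _; rewrite mulr_gt0 // subr_gt0.
move=> v hv k; rewrite -(subrKA (w 0 k)).
rewrite (le_trans (le_normcD _ _))// -(subrK rho rho') mulrDl.
rewrite lerD // ltW // (lt_le_trans (hv k)) //.
exact: (bigmin_le_cond _ (fun k => (rho' - rho) * r k)).
Qed.

Lemma closure_polydisc : closure (polydisc z r) = cpolydisc 1.
Proof.
apply/seteqP; split=> w hw.
  move=> k; rewrite mul1r leNgt; apply/negP => lt.
  have e0 : 0 < normc (w 0 k - z 0 k) - r k by rewrite subr_gt0.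
  have /hw[v [hv1 hv2]] : nbhs w [set v : Cd | normc (v 0 k - w 0 k) <
      normc (w 0 k - z 0 k) - r k].
    apply/nbhs_rowP; exists (normc (w 0 k - z 0 k) - r k); split => // v.
    exact.
  have := le_normcD (w 0 k - v 0 k) (v 0 k - z 0 k).
  rewrite subrKA leNgt => /negP; apply.
  rewrite -(subrK (r k) (normc (w 0 k - z 0 k))) ltrD //.
  by rewrite -normcN opprB.
move=> U /nbhs_rowP[e [e0 hU]].
pose B := 1 + \sum_k r k.
have B1 : 1 <= B by rewrite lerDl sumr_ge0 // => k _; rewrite ltW.
have B0 : 0 < B by rewrite (lt_le_trans ltr01).
pose t := Num.min (1 / 2) (e / B / 2).
have t0 : 0 < t by rewrite lt_min !divr_gt0.
have t1 : t < 1 by rewrite gt_min ltr_pdivrMr // mul1r ltr1n.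
exists (w - t%:C *: (w - z)); split; last first.
  apply: hU => k; rewrite !mxE addrAC subrr add0r normcN normcM normc_pos ?(ltW t0) //.
  have hk : r k <= B.
    rewrite /B (bigD1 k) //= addrCA lerDl addr_ge0 // sumr_ge0 // => j _.
    by rewrite ltW.
  have := hw k; rewrite mul1r => hwk.
  rewrite (le_lt_trans (ler_wpM2l (ltW t0) (le_trans hwk hk)))//.
  rewrite -ltr_pdivlMr // gt_min; apply/orP; right.
  by rewrite ltr_pdivrMr // ltr_pMr ?divr_gt0 // ltr1n.
move=> k; rewrite !mxE.
have -> : w 0 k - t%:C * (w 0 k - z 0 k) - z 0 k =
    (1 - t)%:C * (w 0 k - z 0 k) by rewrite rmorphB /= rmorph1; ring.
rewrite normcM normc_pos ?subr_ge0 ?(ltW t1) //.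
have := hw k; rewrite mul1r => hwk.
rewrite (le_lt_trans (ler_wpM2l _ hwk)) ?subr_ge0 ?(ltW t1) //.
by rewrite gtr_pMl // gtrBl.
Qed.

Variable E : lmodType R[i].
Implicit Types (q : seminorm E) (s : epoly d E).

(** A partial derivative is the first coefficient along a coordinate line, on a
    disc that stays within a slightly larger polydisc. The constant depends
    neither on the polynomial nor on the seminorm, so the estimate survives
    uniform limits on the closed polydisc. *)
Lemma cauchy_estimate (l : seq 'I_d) (rho : R) : rho < 1 ->
  exists C : R, 0 <= C /\ forall q s M,
    (forall w, cpolydisc 1 w -> q (ev s w) <= M) ->
    forall w, cpolydisc rho w -> q (ev (epoly_derivs l s) w) <= C * M.
Proof.
elim: l rho => [|k l ih] rho rho1.
  exists 1; split => // q s M hM w hw; rewrite mul1r; apply: hM.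
  exact: cpolydisc_le (ltW rho1) _ hw.
pose rho' := (rho + 1) / 2.
have lt1 : rho < rho' by rewrite /rho'; lra.
have lt2 : rho' < 1 by rewrite /rho'; lra.
have [C [C0 hC]] := ih _ lt2.
have s0 : 0 < (rho' - rho) * r k by rewrite mulr_gt0 // subr_gt0.
exists (C / ((rho' - rho) * r k)); split; first by rewrite divr_ge0 // ltW.
move=> q s M hM w hw; have [n [a [n1 ha a1]]] := ev_line (epoly_derivs l s) w k.
rewrite /= -a1 mulrAC -[X in _ / X]expr1; apply: (@cauchy_coefficient _ _ _ _ n) => //.
by move=> h hh; rewrite -ha; apply: hC hM _ _; apply: cpolydisc_line hw hh; exact: ltW.
Qed.

Lemma cauchy_taylor (l : seq 'I_d) (k : 'I_d) (rho : R) : rho < 1 ->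
  exists (C delta : R), [/\ 0 <= C, 0 < delta & forall q s M,
    (forall w, cpolydisc 1 w -> q (ev s w) <= M) ->
    forall w (h : R[i]), cpolydisc rho w -> normc h <= delta ->
    q (ev (epoly_derivs l s) (w + h *: delta_mx 0 k) - ev (epoly_derivs l s) w
       - h *: ev (epoly_derivs (k :: l) s) w) <= C * M * normc h ^+ 2].
Proof.
move=> rho1; pose rho' := (rho + 1) / 2.
have lt1 : rho < rho' by rewrite /rho'; lra.
have lt2 : rho' < 1 by rewrite /rho'; lra.
have [C [C0 hC]] := cauchy_estimate l lt2.
have s0 : 0 < (rho' - rho) * r k by rewrite mulr_gt0 // subr_gt0.
set sg := (rho' - rho) * r k in s0.
exists (2 * C / sg ^+ 2), (sg / 2); split.
- by rewrite divr_ge0 ?sqr_ge0 //; exact: mulr_ge0.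
- by rewrite divr_gt0.
move=> q s M hM w h hw hh; have [n [a [n1 ha a1]]] := ev_line (epoly_derivs l s) w k.
have ev0 : ev (epoly_derivs l s) w = \sum_(m < n) 0 ^+ m *: a m.
  by rewrite -ha scale0r addr0.
rewrite [in X in X - _]ha ev0 /= -a1.
have -> : 2 * C / sg ^+ 2 * M = 2 * (C * M) / sg ^+ 2 by ring.
apply: (@taylor_remainder _ _ _ _ _ sg) => // h' hh'.
by rewrite -ha; apply: hC hM _ _; apply: cpolydisc_line hw hh'; exact: ltW.
Qed.

End PolydiscEstimates.

(** * Polynomial approximation on polydiscs *)

Section UnitPolydisc.
Variables (R : realType) (d : nat) (V : lmodType R[i]).
Local Notation MP := (mpoly d R[i]).
Local Notation Cd := 'rV[R[i]^o]_d.
Variables (f : Cd -> V) (g : 'I_d -> Cd -> V) (Q : set (seminorm V)).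

Definition unit_cpolydisc : set Cd := [set u | forall k, normc (u 0 k) <= 1].
Local Notation U := unit_cpolydisc.

Definition upd (u : Cd) (k : 'I_d) (a : R[i]) : Cd :=
  \row_j (if j == k then a else u 0 j).

Hypothesis fg : forall k (e : R), 0 < e -> exists delta : R, 0 < delta /\
  forall u (h : R[i]), U u -> U (u + h *: delta_mx 0 k) -> normc h < delta ->
  forall q, Q q -> q (f (u + h *: delta_mx 0 k) - f u - h *: g k u) <= e * normc h.

Lemma unit_cpolydisc_upd u k a : U u -> normc a <= 1 -> U (upd u k a).
Proof. by move=> hu ha j; rewrite mxE; case: eqP. Qed.

Lemma interpolation_coordinate (k : 'I_d) (e : R) : 0 < e ->
  exists s : seq ({poly R[i]} * R[i]), (forall t, t \in s -> normc t.2 <= 1) /\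
  forall u, U u -> forall q, Q q ->
    q (f u - \sum_(t <- s) t.1.[u 0 k] *: f (upd u k t.2)) <= e.
Proof.
move=> e0; have e4 : 0 < e / 4 by rewrite divr_gt0.
have [delta [dl0 hd]] := fg k e4.
have [N [N1 om1]] := unity_root_near1 dl0.
set om := unity_root R N in om1; have N0 := ltnW N1.
pose M := (Num.truncn (2 / delta)).+1.
have hM : 2 / M%:R < delta.
  have : 2 / delta < M%:R by rewrite /M truncnS_gt.
  by rewrite ltr_pdivrMr // mulrC -ltr_pdivrMr ?ltr0n.
pose W j : {poly R[i]} := N%:R^-1 *: \sum_(m < N) (om ^- j) ^+ m *: 'X^m.
exists [seq (W j, om ^+ j) | j <- iota 0 N]; split.
  move=> t /mapP[j _ ->] /=; by rewrite normcX normc_unity_root expr1n.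
move=> u hu q Qq; rewrite big_map.
have -> : \sum_(j <- iota 0 N) (W j, om ^+ j).1.[u 0 k] *:
      f (upd u k (W j, om ^+ j).2) =
    \sum_(j < N) interp_weight N om (u 0 k) j *: f (upd u k (om ^+ j)).
  rewrite -[N in iota 0 N]subn0 big_mkord; apply: eq_bigr => j _ /=.
  congr (_ *: _); rewrite /W /interp_weight hornerZ horner_sum; congr (_ * _).
  by apply: eq_bigr => m _; rewrite hornerZ hornerXn exprMn mulrC.
have fu : f u = f (upd u k (u 0 k)).
  by congr f; apply/rowP => j; rewrite mxE; case: eqP => // ->.
rewrite fu (_ : e = 4 * (e / 4)); last by field.
refine (@interpolation_error _ _ q (fun a => f (upd u k a))
  (fun a => g k (upd u k a)) N om (e / 4) delta _ _ _ _ _ _ _ M _ _ _ _) => //.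
- exact: unity_rootN.
- exact: normc_unity_root.
- move=> m; exact: unity_rootX_neq1.
- exact: ltW.
- move=> a h ha hah hh.
  have updD : upd u k (a + h) = upd u k a + h *: delta_mx 0 k.
    apply/rowP => j; rewrite !mxE eqxx /=; case: eqP => _.
      by rewrite mulr1.
    by rewrite mulr0 addr0.
  rewrite updD; apply: hd => //; first exact: unit_cpolydisc_upd.
  by rewrite -updD; exact: unit_cpolydisc_upd.
Qed.

Let mix m (c u : Cd) : Cd := \row_k (if (k < m)%N then c 0 k else u 0 k).

(** The one-variable error bound is uniform on the closed polydisc, so it can
    be applied to the first [m] coordinates in turn. *)
Lemma interpolation_first_coordinates m (e : R) : (m <= d)%N -> 0 < e ->
  exists s : seq (MP * Cd), (forall t, t \in s -> U t.2) /\
  forall u, U u -> forall q, Q q ->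
    q (f u - \sum_(t <- s) t.1.@[u 0] *: f (mix m t.2 u)) <= e.
Proof.
elim: m e => [|m ih] e md e0.
  exists [:: (1, 0)]; split.
    by move=> t; rewrite inE => /eqP -> k /=; rewrite mxE normc0 ler01.
  move=> u hu q Qq; rewrite big_seq1 /= meval1 scale1r.
  have -> : mix 0 0 u = u by apply/rowP => k; rewrite mxE.
  by rewrite subrr sn0 ltW.
have e2 : 0 < e / 2 by rewrite divr_gt0.
have [s [sU hs]] := ih _ (ltnW md) e2.
have [B [B0 hB]] := ev_bounded [seq (t.1, f t.2) | t <- s] 1.
have B1 : 0 < B + 1 by rewrite ltr_wpDl.
pose k := Ordinal md; have e3 : 0 < e / 2 / (B + 1) by rewrite divr_gt0.
have [s1 [s1U hs1]] := interpolation_coordinate k e3.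
have [qf hqf] := @choice _ _
  (fun (A : {poly R[i]}) (q : MP) => forall w : Cd, q.@[w 0] = A.[w 0 k])
  (fun A => meval_horner A k).
exists [seq (t.1 * qf x.1, upd t.2 k x.2) | t <- s, x <- s1]; split.
  move=> _ /allpairsP[[t x] /= [ts xs ->]] /=.
  by apply: unit_cpolydisc_upd; [exact: sU|exact: s1U].
move=> u hu q Qq; rewrite big_allpairs_dep /=.
pose v (t : MP * Cd) := mix m t.2 u.
have mixS (t : MP * Cd) a : mix m.+1 (upd t.2 k a) u = upd (v t) k a.
  apply/rowP => j; rewrite !mxE ltnS leq_eqVlt -(inj_eq val_inj) /=.
  by case: eqP => // ->; rewrite ltnn.
have -> : f u - \sum_(t <- s) \sum_(x <- s1) (t.1 * qf x.1).@[u 0] *: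
      f (mix m.+1 (upd t.2 k x.2) u) =
    (f u - \sum_(t <- s) t.1.@[u 0] *: f (v t)) +
    \sum_(t <- s) t.1.@[u 0] *:
      (f (v t) - \sum_(x <- s1) x.1.[v t 0 k] *: f (upd (v t) k x.2)).
  rewrite -addrA; congr (_ + _); rewrite -sumrN -sumrN -big_split /=.
  apply: eq_bigr => t _; rewrite scalerBr addKr scaler_sumr; congr (- _).
  apply: eq_bigr => x _; rewrite mixS mevalM hqf scalerA.
  by rewrite mxE /= ltnn.
rewrite (le_trans (snD _ _ _))// (splitr e) lerD ?hs //.
rewrite (le_trans (sn_sum _ _ _ _))//.
have bnd t : t \in s -> q (t.1.@[u 0] *: (f (v t) -
    \sum_(x <- s1) x.1.[v t 0 k] *: f (upd (v t) k x.2))) <=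
    normc t.1.@[u 0] * (e / 2 / (B + 1)).
  move=> ts; rewrite snZ ler_wpM2l ?normc_ge0 // hs1 // => j.
  by rewrite mxE; case: ifP => _; [exact: sU|exact: hu].
rewrite big_seq (le_trans (ler_sum _ bnd))// -big_seq -mulr_suml.
have := hB u hu; rewrite big_map /= => hB'.
rewrite mulrCA ger_pMr // ler_pdivrMr // mul1r (le_trans hB') //.
by rewrite lerDl.
Qed.

Lemma interpolation_unit_polydisc (e : R) : 0 < e ->
  exists s : seq (MP * Cd), (forall t, t \in s -> U t.2) /\
  forall u, U u -> forall q, Q q ->
    q (f u - \sum_(t <- s) t.1.@[u 0] *: f t.2) <= e.
Proof.
move=> e0; have [s [sU hs]] := interpolation_first_coordinates (leqnn d) e0.
exists s; split => // u hu q Qq; rewrite (le_trans _ (hs u hu q Qq)) //.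
rewrite (eq_bigr (fun t => t.1.@[u 0] *: f (mix d t.2 u))) // => t _.
by congr (_ *: f _); apply/rowP => k; rewrite mxE ltn_ord.
Qed.

End UnitPolydisc.

Section Dilation.
Variables (R : realType) (d : nat) (V : lmodType R[i]).
Local Notation MP := (mpoly d R[i]).
Local Notation Cd := 'rV[R[i]^o]_d.
Variables (z : Cd) (r : 'I_d -> R).
Hypothesis r0 : forall k, 0 < r k.
Variables (f : Cd -> V) (g : 'I_d -> Cd -> V) (Q : set (seminorm V)).
Local Notation K := (cpolydisc z r).
Hypothesis f_unif : forall e : R, 0 < e -> exists delta : R, 0 < delta /\
  forall w v, K 1 w -> K 1 v -> (forall k, normc (w 0 k - v 0 k) < delta) ->
  forall q, Q q -> q (f w - f v) <= e.
Hypothesis f_diff : forall (rho : R) k (e : R), 0 < rho < 1 -> 0 < e ->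
  exists delta : R, 0 < delta /\
  forall w (h : R[i]), K rho w -> K rho (w + h *: delta_mx 0 k) ->
  normc h < delta -> forall q, Q q ->
  q (f (w + h *: delta_mx 0 k) - f w - h *: g k w) <= e * normc h.

(** Derivatives are controlled on the polydiscs with [rho < 1] only, so the
    interpolated function is a dilation of [f] by a factor close to 1. *)
Lemma polynomial_interpolation (e : R) : 0 < e ->
  exists s : seq (MP * Cd), (forall t, t \in s -> K 1 t.2) /\
  forall w, K 1 w -> forall q, Q q ->
    q (f w - \sum_(t <- s) t.1.@[w 0] *: f t.2) <= e.
Proof.
move=> e0; have e2 : 0 < e / 2 by rewrite divr_gt0.
have [delta [dl0 hd]] := f_unif e2.
(* [eta] is so small that dilation by [1 - eta] moves each coordinate by less
   than [delta] *)
pose B := 1 + \sum_k r k.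
have B0 : 0 < B by rewrite ltr_wpDr // sumr_ge0 // => k _; exact: ltW.
have rB k : r k <= B.
  by rewrite /B (bigD1 k) //= addrCA lerDl addr_ge0 // sumr_ge0 // => j _; exact: ltW.
pose eta := Num.min (1 / 2) (delta / B / 2).
have eta0 : 0 < eta by rewrite lt_min !divr_gt0.
have eta1 : eta < 1 by rewrite gt_min ltr_pdivrMr // mul1r ltr1n.
have etaB : eta * B < delta.
  rewrite -ltr_pdivlMr // gt_min; apply/orP; right.
  by rewrite ltr_pdivrMr // ltr_pMr ?divr_gt0 // ltr1n.
pose rho := 1 - eta.
have rho01 : 0 < rho < 1 by rewrite subr_gt0 eta1 gtrBl.
have [rho0 rho1] := andP rho01.
pose scal (u : Cd) : Cd := \row_k ((rho * r k)%:C * u 0 k + z 0 k).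
have scalK u : unit_cpolydisc u -> K rho (scal u).
  move=> hu k; rewrite mxE addrK normcM normc_pos; last first.
    by rewrite mulr_ge0 // ltW.
  by rewrite ler_piMr // mulr_ge0 // ltW.
have scalD u h k : scal (u + h *: delta_mx 0 k) =
    scal u + ((rho * r k)%:C * h) *: delta_mx 0 k.
  apply/rowP => j; rewrite !mxE eqxx /=; have [->|_] := eqVneq j k.
    by rewrite !mulr1 mulrDr addrAC.
  by rewrite !mulr0 !addr0.
have fg k (e' : R) : 0 < e' -> exists delta : R, 0 < delta /\
    forall (u : Cd) (h : R[i]), unit_cpolydisc u ->
    unit_cpolydisc (u + h *: delta_mx 0 k) -> normc h < delta ->
    forall q, Q q -> q (f (scal (u + h *: delta_mx 0 k)) - f (scal u) -
      h *: ((rho * r k)%:C *: g k (scal u))) <= e' * normc h.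
  move=> e'0; have rr0 : 0 < rho * r k by rewrite mulr_gt0.
  have [dl [dl'0 h]] := f_diff k rho01 (divr_gt0 e'0 rr0).
  exists (dl / (rho * r k)); split; first by rewrite divr_gt0.
  move=> u t hu hu' ht q Qq; rewrite scalD scalerA [t * _]mulrC.
  have nt : normc ((rho * r k)%:C * t) = rho * r k * normc t.
    by rewrite normcM normc_pos // ltW.
  rewrite (le_trans (h _ _ _ _ _ _ Qq)) //.
  - exact: scalK.
  - by rewrite -scalD; exact: scalK.
  - by rewrite nt mulrC -ltr_pdivlMr.
  - by rewrite nt mulrA divfK // gt_eqF.
have [s [sU hs]] := @interpolation_unit_polydisc _ _ _ (f \o scal)
  (fun k u => (rho * r k)%:C *: g k (scal u)) Q fg _ e2.
pose unscal (w : Cd) : Cd := \row_k ((r k)^-1%:C * w 0 k + - ((r k)^-1%:C * z 0 k)).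
have [qf hqf] := @choice _ _
  (fun p q : MP => forall w : Cd, q.@[w 0] = p.@[(unscal w) 0])
  (fun p => meval_affine p _ _).
exists [seq (qf t.1, scal t.2) | t <- s]; split.
  move=> _ /mapP[t ts ->] /=; apply: cpolydisc_le (scalK _ (sU _ ts)) => //.
  exact: ltW.
move=> w hw q Qq; rewrite big_map /=.
have uw : unit_cpolydisc (unscal w).
  move=> k; rewrite mxE -mulrBr normcM normc_pos ?invr_ge0 ?(ltW (r0 k)) //.
  by rewrite ler_pdivrMl // mulrC; exact: hw.
rewrite (le_trans (sn_triangle q (f (scal (unscal w))) _ _))//.
rewrite (splitr e) lerD //.
  apply: hd => //; first exact: cpolydisc_le (ltW rho1) _ (scalK _ uw).
  move=> k; have rr : (r k)%:C * (r k)^-1%:C = 1 :> R[i].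
    by rewrite -rmorphM divff ?gt_eqF.
  have -> : w 0 k - scal (unscal w) 0 k = eta%:C * (w 0 k - z 0 k).
    by rewrite !mxE /rho rmorphM rmorphB rmorph1 /=; ring: rr.
  rewrite normcM normc_pos ?(ltW eta0) // (le_lt_trans _ etaB) //.
  by rewrite ler_wpM2l ?(ltW eta0) // (le_trans (hw k)) // mul1r.
have := hs _ uw q Qq; rewrite /= (eq_bigr (fun t => (qf t.1).@[w 0] *: f (scal t.2))) //.
by move=> t _; rewrite hqf.
Qed.

End Dilation.

(** * Differentiability estimates *)

Section MeanValue.
Variables (R : realType) (V : lmodType R[i]) (q : seminorm V).

(** The set of the [t] for which the bound holds between 0 and [t] contains its
    supremum, and it would contain larger points if that were not 1. *)
Lemma mean_value_inequality (phi : R -> V) (M : R) :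
  (forall t, 0 <= t <= 1 -> exists delta, 0 < delta /\
    forall s, 0 <= s <= 1 -> `|s - t| < delta ->
    q (phi s - phi t) <= M * `|s - t|) ->
  q (phi 1 - phi 0) <= M.
Proof.
move=> h; pose S := [set t | 0 <= t <= 1 /\ q (phi t - phi 0) <= M * t].
have S0 : S 0 by split; [rewrite lexx ler01|rewrite subrr sn0 mulr0].
have Sub t : S t -> t <= 1 by move=> [/andP[]].
have hS : has_sup S by split; [exists 0|exists 1 => t /Sub].
pose c := sup S.
have c01 : 0 <= c <= 1.
  apply/andP; split; first by apply: ub_le_sup => //; exact: hS.2.
  by apply: ge_sup; [exists 0|move=> t /Sub].
have [dl [dl0 hd]] := h c c01.
have Sc : S c.
  split=> //; have [s Ss cs] := sup_adherent dl0 hS.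
  have sc : s <= c by apply: ub_le_sup => //; exact: hS.2.
  have := hd s Ss.1; rewrite distrC ger0_norm ?subr_ge0 //.
  have -> : c - s < dl by rewrite ltrBlDr addrC -ltrBlDr.
  move=> /(_ isT) h1; rewrite (le_trans (sn_triangle q (phi s) _ _))//.
  rewrite snB (le_trans (lerD h1 Ss.2)) // -mulrDr subrK //.
have [c1|c1] := ltP c 1; last first.
  have cE : c = 1 by apply/eqP; rewrite eq_le c1 (andP c01).2.
  by move: Sc.2; rewrite cE mulr1.
pose t := Num.min 1 (c + dl / 2).
have ct : c < t by rewrite lt_min c1 ltrDl divr_gt0.
have t01 : 0 <= t <= 1.
  by rewrite (le_trans (andP c01).1 (ltW ct)) /= ge_min lexx.
have tS : S t.
  split=> //; have := hd t t01; rewrite ger0_norm ?subr_ge0 ?(ltW ct) //.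
  have -> : t - c < dl.
    rewrite ltrBlDl (le_lt_trans (y := c + dl / 2)) // ?ge_min ?lexx ?orbT //.
    by rewrite ltrD2l ltr_pdivrMr // ltr_pMr // ltr1n.
  move=> /(_ isT) h1; rewrite (le_trans (sn_triangle q (phi c) _ _))//.
  by rewrite (le_trans (lerD h1 Sc.2)) // -mulrDr subrK.
have : t <= c by apply: ub_le_sup => //; exact: hS.2.
by rewrite leNgt ct.
Qed.

End MeanValue.

Section UniformContinuity.
Variables (R : realType) (d : nat) (V : lmodType R[i]) (Q : set (seminorm V)).
Local Notation Cd := 'rV[R[i]^o]_d.

Lemma compact_uniformly_continuous (K : set Cd) (F : Cd -> V) : compact K ->
  (forall w (e : R), K w -> 0 < e -> exists delta : R, 0 < delta /\
    forall v, K v -> (forall k, normc (v 0 k - w 0 k) < delta) ->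
    forall q, Q q -> q (F v - F w) <= e) ->
  forall e : R, 0 < e -> exists delta : R, 0 < delta /\
    forall w v, K w -> K v -> (forall k, normc (w 0 k - v 0 k) < delta) ->
    forall q, Q q -> q (F w - F v) <= e.
Proof.
move=> /compact_near_coveringP cK Fc e e0.
pose P (dl : R) (w : Cd) := K w -> forall v, K v ->
  (forall k, normc (w 0 k - v 0 k) < dl) -> forall q, Q q -> q (F w - F v) <= e.
have /filter_ex[dl [dl0 hd]] : (0 : R)^'+ [set dl | 0 < dl /\ K `<=` P dl].
  apply: filterI; first exact: nbhs_right_gt.
  apply: (cK R (0 : R)^'+ P _) => w Kw; have e2 : 0 < e / 2 by rewrite divr_gt0.
  have [dl [dl0 h]] := Fc w _ Kw e2.
  have dl2 : 0 < dl / 2 by rewrite divr_gt0.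
  exists ([set v : Cd | forall k, normc (v 0 k - w 0 k) < dl / 2],
          [set x | x < dl / 2]).
    split; last exact: nbhs_right_lt.
    by apply/nbhs_rowP; exists (dl / 2).
  move=> [v x] /= [hv xd] Kv u Ku hu q Qq.
  have lt2 : dl / 2 < dl by rewrite ltr_pdivrMr // ltr_pMr // ltr1n.
  rewrite (le_trans (sn_triangle q (F w) _ _))// (splitr e) lerD //.
    by apply: h => // k; rewrite (lt_trans (hv k)).
  rewrite snB; apply: h => // k.
  rewrite -(subrKA (v 0 k)) (le_lt_trans (le_normcD _ _))// (splitr dl) ltrD //.
  by rewrite -normcN opprB (lt_trans (hu k)).
exists dl; split => // w v Kw; exact: hd.
Qed.

End UniformContinuity.

Section Partials.
Variables (R : realType) (d : nat) (E : tvsType R[i]).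
Local Notation Cd := 'rV[R[i]^o]_d.
Implicit Types (f : Cd -> E) (w : Cd) (k : 'I_d) (q : cseminorm E).

Lemma csn_ball q (x : E) (e : R) : 0 < e -> nbhs x [set y | q (y - x) < e].
Proof.
move=> e0; rewrite -[x in nbhs x _]add0r nbhs_translate.
have : nbhs (0 : E) [set v | q v < e].
  apply: (@csn_cont _ _ q 0 [set r | r < e]).
  by apply: lt_nbhsl; rewrite /= sn0.
by apply: filterS => v /=; rewrite addrK.
Qed.

Lemma is_cpartial_estimate f k w l q (e : R) : is_cpartial f k w l -> 0 < e ->
  exists delta : R, 0 < delta /\ forall h : R[i], normc h < delta ->
  q (f (w + h *: delta_mx 0 k) - f w - h *: l) <= e * normc h.
Proof.
move=> fl e0; have /dnbhs_complexP[dl [dl0 hd]] := fl _ (csn_ball q l e0).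
exists dl; split => // h hh; have [->|h0] := eqVneq h 0.
  by rewrite !scale0r addr0 subrr subr0 sn0 normc0 mulr0.
have := hd h h0 hh; rewrite /=.
have -> : f (w + h *: delta_mx 0 k) - f w - h *: l =
    h *: (h^-1 *: (f (w + h *: delta_mx 0 k) - f w) - l).
  by rewrite scalerBr scalerA divff // scale1r.
by rewrite snZ mulrC => /ltW h1; rewrite ler_wpM2r ?normc_ge0.
Qed.

Variables (I : Type) (p : I -> cseminorm E).
Hypothesis pf : directed_fundamental p.

Lemma is_cpartial_intro f k w l :
  (forall i (e : R), 0 < e -> exists delta : R, 0 < delta /\
    forall h : R[i], normc h < delta ->
    p i (f (w + h *: delta_mx 0 k) - f w - h *: l) <= e * normc h) ->
  is_cpartial f k w l.
Proof.
move=> h; apply/(cvg_fundP pf) => i e e0.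
have e2 : 0 < e / 2 by rewrite divr_gt0.
have [dl [dl0 hd]] := h i _ e2; apply/dnbhs_complexP; exists dl; split => // t t0 /hd.
have -> : f (w + t *: delta_mx 0 k) - f w - t *: l =
    t *: (t^-1 *: (f (w + t *: delta_mx 0 k) - f w) - l).
  by rewrite scalerBr scalerA divff // scale1r.
rewrite snZ mulrC ler_pM2r ?normc_gt0 // => /le_lt_trans; apply.
by rewrite ltr_pdivrMr // ltr_pMr // ltr1n.
Qed.

Lemma is_rpartial_intro f k w l (c : R[i]) :
  (forall i (e : R), 0 < e -> exists delta : R, 0 < delta /\
    forall h : R[i], normc h < delta ->
    p i (f (w + h *: delta_mx 0 k) - f w - h *: l) <= e * normc h) ->
  is_rpartial f (c *: delta_mx 0 k) w (c *: l).
Proof.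
move=> h; apply/(cvg_fundP pf) => i e e0.
have c1 : 0 < normc c + 1 by rewrite ltr_wpDl // normc_ge0.
have e2 : 0 < e / 2 / (normc c + 1) by rewrite !divr_gt0.
have [dl [dl0 hd]] := h i _ e2; apply/dnbhs_realP.
exists (dl / (normc c + 1)); split; first by rewrite divr_gt0.
move=> t t0 ht; have t0' : t%:C != 0 :> R[i].
  by rewrite -normc_gt0 /= expr0n addr0 sqrtr_sqr normr_gt0.
have nt : normc (t%:C : R[i]) = `|t| by rewrite /= expr0n addr0 sqrtr_sqr.
have := hd (t%:C * c); rewrite normcM nt.
have tc : `|t| * normc c < dl.
  apply: le_lt_trans (_ : `|t| * (normc c + 1) < dl).
    by rewrite ler_wpM2l // lerDl.
  by rewrite -ltr_pdivlMr.
move=> /(_ tc).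
have -> : f (w + (t%:C * c) *: delta_mx 0 k) - f w - (t%:C * c) *: l =
    t%:C *: ((t^-1)%:C *: (f (w + t%:C *: (c *: delta_mx 0 k)) - f w) - c *: l).
  rewrite scalerBr !scalerA -rmorphM divff //; congr (_ - _).
  by rewrite scale1r.
rewrite snZ nt mulrCA ler_pM2l ?normr_gt0 // => /le_lt_trans; apply.
rewrite mulrAC ltr_pdivrMr // (le_lt_trans (y := e / 2 * (normc c + 1))) //.
  by rewrite ler_wpM2l ?lerDl // ltW // divr_gt0.
by rewrite ltr_pM2r // ltr_pdivrMr // ltr_pMr // ltr1n.
Qed.

Lemma partials_agree f k w l m : hausdorff_space E ->
  is_cpartial f k w l -> is_rpartial f (1 *: delta_mx 0 k) w m -> l = m.
Proof.
move=> hE hl hm; apply: (fund_sep pf hE) => i e e0.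
have e2 : 0 < e / 2 by rewrite divr_gt0.
have [dl [dl0 hd]] := is_cpartial_estimate (p i) hl e2.
have /dnbhs_realP[dm [dm0 hd']] := hm _ (csn_ball (p i) m e2).
pose t := Num.min dl dm / 2.
have t0 : 0 < t by rewrite divr_gt0 // lt_min dl0.
have tm : t < Num.min dl dm.
  by rewrite ltr_pdivrMr // ltr_pMr ?lt_min ?dl0 // ltr1n.
move: (tm); rewrite lt_min => /andP[tl tdm].
have nt : normc (t%:C : R[i]) = t by rewrite normc_pos // ltW.
have := hd t%:C; rewrite nt => /(_ tl).
have := hd' t (lt0r_neq0 t0); rewrite gtr0_norm // => /(_ tdm) /=.
rewrite scale1r; set y := f _ - f w => h1 h2.
have h3 : p i ((t^-1)%:C *: y - l) <= e / 2.
  have -> : (t^-1)%:C *: y - l = (t^-1)%:C *: (y - t%:C *: l).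
    by rewrite [RHS]scalerBr scalerA -rmorphM mulVf ?gt_eqF // scale1r.
  by rewrite snZ normc_pos ?invr_ge0 ?(ltW t0) // ler_pdivrMl // mulrC.
rewrite (le_trans (sn_triangle (p i) ((t^-1)%:C *: y) _ _))//.
by rewrite (splitr e) lerD //; [rewrite snB|exact: ltW].
Qed.

End Partials.

Section PolydiscFunctions.
Variables (R : realType) (d : nat) (E : tvsType R[i]).
Hypothesis hE : hausdorff_space E.
Variables (I : Type) (p : I -> cseminorm E).
Hypothesis pf : directed_fundamental p.
Local Notation Cd := 'rV[R[i]^o]_d.
Variables (z : Cd) (r : 'I_d -> R).
Hypothesis r0 : forall k, 0 < r k.
Local Notation K := (cpolydisc z r).
Local Notation P := (polydisc z r).

Lemma compact_cpolydisc rho : 0 < rho -> compact (K rho).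
Proof.
move=> rho0; have -> : K rho = closure (polydisc z (fun k => rho * r k)).
  rewrite closure_polydisc; last by move=> k; rewrite mulr_gt0.
  by apply/seteqP; split=> w hw k; move: (hw k); rewrite mul1r.
exact: compact_closed_polydisc.
Qed.

Lemma cpolydisc_segment rho w (h : R[i]) k (t : R) : 0 <= t <= 1 ->
  K rho w -> K rho (w + h *: delta_mx 0 k) ->
  K rho (w + (t%:C * h) *: delta_mx 0 k).
Proof.
move=> /andP[t0 t1] hw hw' j.
have -> : (w + (t%:C * h) *: delta_mx 0 k) 0 j - z 0 j =
    (1 - t)%:C * (w 0 j - z 0 j) +
    t%:C * ((w + h *: delta_mx 0 k) 0 j - z 0 j).
  by rewrite !mxE rmorphB rmorph1 /=; ring.
rewrite (le_trans (le_normcD _ _))// !normcM !normc_pos ?subr_ge0 //.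
have -> : rho * r j = (1 - t) * (rho * r j) + t * (rho * r j) by ring.
by rewrite lerD // ler_wpM2l ?subr_ge0.
Qed.

(** The derivative along real increments is continuous by hypothesis; it is also
    the complex derivative, because both are limits along real [h]. *)
Lemma A_derivatives f : f \in A_pred z r E -> exists g : 'I_d -> Cd -> E,
  forall k w, P w -> {for w, continuous (g k)} /\
  forall (q : cseminorm E) (e : R), 0 < e -> exists delta : R, 0 < delta /\
    forall h : R[i], normc h < delta ->
    q (f (w + h *: delta_mx 0 k) - f w - h *: g k w) <= e * normc h.
Proof.
move=> /asboolP[_ [fC [D [D0 hD]]] _].
have [g hg] := choice (fun k => fC k 1 (or_introl erefl)).
exists g => k w Pw; have [hg1 hg2] := hg k w Pw; split => // q e e0.
pose l := D (multi_succ [ffun=> 0%N] k) w.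
have hc : is_cpartial (D [ffun=> 0%N]) k w l by apply: hD => // j _; rewrite ffunE.
have fe (q' : cseminorm E) (e' : R) : 0 < e' -> exists delta : R, 0 < delta /\
    forall h : R[i], normc h < delta ->
    q' (f (w + h *: delta_mx 0 k) - f w - h *: l) <= e' * normc h.
  move=> e'0; have [dl [dl0 hd]] := is_cpartial_estimate q' hc e'0.
  have /nbhs_rowP[dl' [dl'0 hP]] := polydisc_open r0 Pw.
  exists (Num.min dl dl'); split; first by rewrite lt_min dl0.
  move=> h; rewrite lt_min => /andP[h1 h2].
  have Ph : P (w + h *: delta_mx 0 k).
    apply: hP => j; rewrite !mxE eqxx /= addrAC subrr add0r.
    by case: eqP => _; rewrite ?mulr1 // mulr0 normc0.
  by rewrite -(D0 _ Pw) -(D0 _ Ph); exact: hd.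
rewrite -(@partials_agree R d E I p pf f k w l (g k w)) //; first exact: fe.
by apply: (is_cpartial_intro pf) => i e'; exact: fe.
Qed.

(** The mean value inequality for [f] minus its linear part at [w]: the derivative
    is uniformly continuous on the compact polydisc of factor [rho]. *)
Lemma A_uniformly_differentiable f (q : cseminorm E) : f \in A_pred z r E ->
  exists g : 'I_d -> Cd -> E, forall (rho : R) k (e : R),
  0 < rho < 1 -> 0 < e -> exists delta : R, 0 < delta /\
  forall w (h : R[i]), K rho w -> K rho (w + h *: delta_mx 0 k) ->
  normc h < delta ->
  q (f (w + h *: delta_mx 0 k) - f w - h *: g k w) <= e * normc h.
Proof.
move=> /A_derivatives[g hg]; exists g => rho k e /andP[rho0 rho1] e0.
have KP w : K rho w -> P w by exact: cpolydisc_polydisc.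
have e2 : 0 < e / 2 by rewrite divr_gt0.
have [dl [dl0 hd]] : exists delta : R, 0 < delta /\
    forall w v, K rho w -> K rho v -> (forall k, normc (w 0 k - v 0 k) < delta) ->
    q (g k w - g k v) <= e / 2.
  have [|dl [dl0 h]] := compact_uniformly_continuous (Q := [set q : seminorm E])
    (F := g k) (compact_cpolydisc rho0) _ e2; last first.
    by exists dl; split => // w v Kw Kv wv; exact: h.
  move=> w e' Kw e'0; have [gc _] := hg k w (KP _ Kw).
  have /nbhs_rowP[dl [dl0 h]] := gc _ (csn_ball q (g k w) e'0).
  by exists dl; split => // v _ /h /ltW hv _ ->.
exists dl; split => // w h Kw Kwh hh.
pose x (t : R) := w + (t%:C * h) *: delta_mx 0 k.
pose phi (t : R) := f (x t) - (t%:C * h) *: g k w.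
have -> : f (w + h *: delta_mx 0 k) - f w - h *: g k w = phi 1 - phi 0.
  by rewrite /phi /x mul1r mul0r !scale0r addr0 subr0 addrAC.
apply: mean_value_inequality => t t01.
have Kx s : 0 <= s <= 1 -> K rho (x s) by move=> s01; exact: cpolydisc_segment.
have [_ /(_ q _ e2)[dl' [dl'0 hd']]] := hg k (x t) (KP _ (Kx _ t01)).
have h1 : 0 < normc h + 1 by rewrite ltr_wpDl // normc_ge0.
exists (dl' / (normc h + 1)); split; first by rewrite divr_gt0.
move=> s s01 st.
have xs : x s = x t + ((s - t)%:C * h) *: delta_mx 0 k.
  by rewrite /x -addrA -scalerDl -mulrDl -rmorphD [t + _]addrC subrK.
have nst : normc ((s - t)%:C * h) = `|s - t| * normc h.
  by rewrite normcM; congr (_ * _); rewrite /= expr0n addr0 sqrtr_sqr.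
have -> : phi s - phi t =
    (f (x t + ((s - t)%:C * h) *: delta_mx 0 k) - f (x t) -
      ((s - t)%:C * h) *: g k (x t)) + ((s - t)%:C * h) *: (g k (x t) - g k w).
  rewrite -xs scalerBr [RHS]addrA subrK rmorphB mulrBl [in RHS]scalerBl /phi.
  by rewrite !opprD !opprK addrACA.
have e_split : e * normc h * `|s - t| =
    e / 2 * (`|s - t| * normc h) + (`|s - t| * normc h) * (e / 2) by field.
rewrite e_split (le_trans (snD _ _ _))// lerD //.
  rewrite -nst; apply: hd'; rewrite nst.
  apply: le_lt_trans (_ : `|s - t| * (normc h + 1) < dl').
    by rewrite ler_wpM2l // lerDl.
  by rewrite -ltr_pdivlMr.
rewrite snZ nst ler_wpM2l ?mulr_ge0 ?normc_ge0 //.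
apply: hd => //; first exact: Kx.
move=> j; rewrite /x !mxE eqxx /= addrAC subrr add0r.
have [t0 t1] := andP t01; case: eqP => _; last by rewrite mulr0 normc0.
by rewrite mulr1 normcM normc_pos // (le_lt_trans _ hh) // ler_piMl ?normc_ge0.
Qed.

Lemma A_uniformly_continuous f (q : cseminorm E) : f \in A_pred z r E ->
  forall e : R, 0 < e -> exists delta : R, 0 < delta /\
  forall w v, K 1 w -> K 1 v -> (forall k, normc (w 0 k - v 0 k) < delta) ->
  q (f w - f v) <= e.
Proof.
move=> /asboolP[fc _ _] e e0.
have [|dl [dl0 h]] := compact_uniformly_continuous (Q := [set q : seminorm E])
    (F := f) (compact_cpolydisc ltr01) _ e0; last first.
  by exists dl; split => // w v Kw Kv wv; exact: h.
move=> w e' Kw e'0.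
have /(_ w) := (subspace_continuousP _ _).1 fc; rewrite closure_polydisc //.
move=> /(_ Kw) /(_ _ (csn_ball q (f w) e'0)) /nbhs_rowP[dl [dl0 h]].
by exists dl; split => // v Kv /h /(_ Kv) /ltW hv _ ->.
Qed.

Lemma A_polynomial_interpolation f (q : cseminorm E) (e : R) :
  f \in A_pred z r E -> 0 < e -> exists s : epoly d E,
  forall w, K 1 w -> q (f w - ev s w) <= e.
Proof.
move=> fA e0; have [g hg] := A_uniformly_differentiable q fA.
have [|||s [_ hs]] := @polynomial_interpolation R d E z r r0 f g
  [set q : seminorm E] _ _ e.
- move=> e' e'0; have [dl [dl0 h]] := A_uniformly_continuous q fA e'0.
  by exists dl; split => // w v Kw Kv wv _ ->; exact: h.
- move=> rho k e' rho01 e'0; have [dl [dl0 h]] := hg rho k e' rho01 e'0.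
  by exists dl; split => // w t Kw Kv wv _ ->; exact: h.
- by [].
exists [seq (t.1, f t.2) | t <- s] => w Kw.
by rewrite /ev big_map; apply: hs.
Qed.

End PolydiscFunctions.

(** * Membership in the polydisc algebra and uniform limits *)

Section MultiIndex.
Variable d : nat.

(** The coordinates of a multi-index in increasing order, with multiplicities:
    the order in which the iterated partial derivative is taken. *)
Definition multi_list (b : {ffun 'I_d -> nat}) : seq 'I_d :=
  flatten [seq nseq (b k) k | k <- enum 'I_d].

Lemma multi_list0 : multi_list [ffun=> 0%N] = [::].
Proof. by rewrite /multi_list; elim: (enum _) => //= k s ->; rewrite ffunE. Qed.

Lemma multi_list_succ (b : {ffun 'I_d -> nat}) (k : 'I_d) :
  (forall j : 'I_d, (j < k)%N -> b j = 0%N) ->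
  multi_list (multi_succ b k) = k :: multi_list b.
Proof.
move=> bk; have : sorted ltn (map val (enum 'I_d)).
  by rewrite val_enum_ord iota_ltn_sorted.
have : k \in enum 'I_d by rewrite mem_enum.
rewrite /multi_list; elim: (enum _) => //= j s ih; rewrite inE.
have [<- _ sj|kj /= ks sj] := eqVneq k j.
  rewrite ffunE eqxx addn1 /=; congr (_ :: (_ ++ flatten _)).
  apply/eq_in_map => i si; rewrite ffunE; case: eqP => [ik|_]; last by rewrite addn0.
  have := allP (order_path_min ltn_trans sj) (val i) (map_f _ si).
  by rewrite ik /= ltnn.
have jk : (j < k)%N.
  exact: (allP (order_path_min ltn_trans sj) (val k) (map_f _ ks)).
rewrite ffunE bk // eq_sym (negPf kj) /= ih //.
exact: path_sorted sj.
Qed.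

End MultiIndex.

Section Membership.
Variables (R : realType) (d : nat) (E : tvsType R[i]).
Hypothesis hE : hausdorff_space E.
Variables (I : Type) (p : I -> cseminorm E).
Hypothesis pf : directed_fundamental p.
Local Notation Cd := 'rV[R[i]^o]_d.
Variables (z : Cd) (r : 'I_d -> R).
Hypothesis r0 : forall k, 0 < r k.
Local Notation K := (cpolydisc z r 1).
Local Notation P := (polydisc z r).

(** Taylor estimates at all orders give the iterated complex derivatives. The
    derivatives along the real and imaginary axes are their multiples by 1 and
    [i], so that continuity is only needed at the first order. *)
Lemma A_pred_intro (f : Cd -> E) (D : seq 'I_d -> Cd -> E) :
  (forall w i (e : R), K w -> 0 < e -> \forall v \near w, K v -> p i (f v - f w) < e) ->
  (forall w, ~ K w -> f w = 0) ->
  (forall w, P w -> D [::] w = f w) ->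
  (forall l k w i, P w -> exists C delta : R, [/\ 0 <= C, 0 < delta &
     forall h : R[i], normc h <= delta -> P (w + h *: delta_mx 0 k) ->
     p i (D l (w + h *: delta_mx 0 k) - D l w - h *: D (k :: l) w) <=
     C * normc h ^+ 2]) ->
  (forall k w i (e : R), P w -> 0 < e ->
     \forall v \near w, p i (D [:: k] v - D [:: k] w) < e) ->
  f \in A_pred z r E.
Proof.
move=> fc f0 Df Dd Dc.
have Dsmall l k w i (e : R) : P w -> 0 < e -> exists delta : R, 0 < delta /\
    forall h : R[i], normc h < delta -> P (w + h *: delta_mx 0 k) /\
    p i (D l (w + h *: delta_mx 0 k) - D l w - h *: D (k :: l) w) <= e * normc h.
  move=> Pw e0; have [C [dl [C0 dl0 hd]]] := Dd l k w i Pw.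
  have /nbhs_rowP[dl' [dl'0 hP]] := polydisc_open r0 Pw.
  have C1 : 0 < C + 1 by rewrite ltr_wpDl.
  exists (Num.min dl (Num.min dl' (e / (C + 1)))).
  split; first by rewrite !lt_min dl0 dl'0 divr_gt0.
  move=> h; rewrite !lt_min => /and3P[h1 h2 h3].
  have Ph : P (w + h *: delta_mx 0 k).
    apply: hP => j; rewrite !mxE eqxx /= addrAC subrr add0r.
    by case: eqP => _; rewrite ?mulr1 // mulr0 normc0.
  split=> //; rewrite (le_trans (hd h (ltW h1) Ph)) // expr2 mulrA.
  rewrite ler_wpM2r ?normc_ge0 // mulrC.
  rewrite (le_trans (y := normc h * (C + 1))) //.
    by rewrite ler_wpM2l ?normc_ge0 // lerDl.
  by rewrite -ler_pdivlMr // ltW.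
apply/asboolP; rewrite closure_polydisc //; split => //.
- apply/subspace_continuousP => w Kw; apply/(cvg_fundP pf) => i e e0.
  exact: (fc w i e Kw e0).
- split; last first.
    exists (fun b => D (multi_list b)); split.
      by move=> w Pw; rewrite multi_list0 Df.
    move=> b k w Pw bk; rewrite multi_list_succ //.
    apply: (is_cpartial_intro pf) => i e e0.
    have [dl [dl0 hd]] := Dsmall (multi_list b) k w i e Pw e0.
    by exists dl; split => // h /hd[].
  move=> k c _; exists (fun w => c *: D [:: k] w) => w Pw; split.
    apply: (is_rpartial_intro pf) => i e e0.
    have [dl [dl0 hd]] := Dsmall [::] k w i e Pw e0.
    exists dl; split => // h /hd[Ph]; rewrite !Df //.
  apply/(cvg_fundP pf (nbhs_filter (w : Cd))) => i e e0.
  have c1 : 0 < normc c + 1 by rewrite ltr_wpDl // normc_ge0.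
  have := Dc k w i _ Pw (divr_gt0 e0 c1); apply: filterS => v.
  rewrite /= -scalerBr snZ ltr_pdivlMr // => h.
  rewrite (le_lt_trans _ h) // mulrC ler_wpM2l ?sn_ge0 //.
  by rewrite lerDl.
Qed.

Definition restrict (f : Cd -> E) (w : Cd) : E := if `[< K w >] then f w else 0.

Lemma restrictE f w : K w -> restrict f w = f w.
Proof. by move=> Kw; rewrite /restrict asboolT. Qed.

Lemma restrict0 f w : ~ K w -> restrict f w = 0.
Proof. by move=> Kw; rewrite /restrict asboolF. Qed.

Lemma epoly_uniformly_bounded (s : epoly d E) (q : seminorm E) :
  exists M : R, forall w, K w -> q (ev s w) <= M.
Proof.
pose B := \sum_k (normc (z 0 k) + r k).
have KB w k : K w -> normc (w 0 k) <= B.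
  move=> Kw; have -> : w 0 k = (w 0 k - z 0 k) + z 0 k by rewrite subrK.
  rewrite (le_trans (le_normcD _ _))//.
  rewrite /B (bigD1 k) //= (le_trans (y := normc (z 0 k) + r k)) //.
    by rewrite addrC lerD2l; move: (Kw k); rewrite mul1r.
  by rewrite lerDl sumr_ge0 // => j _; rewrite addr_ge0 ?normc_ge0 // ltW.
elim: s => [|x s [M hM]].
  by exists 0 => w _; rewrite /ev big_nil sn0.
have [N [N0 hN]] := meval_bounded x.1 B.
exists (N * q x.2 + M) => w Kw; rewrite ev_cons (le_trans (snD _ _ _))//.
rewrite lerD ?hM // snZ ler_wpM2r ?sn_ge0 // hN // => k; exact: KB.
Qed.

Lemma epoly_in_A (s : epoly d E) : restrict (ev s) \in A_pred z r E.
Proof.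
apply: (@A_pred_intro _ (fun l => ev (epoly_derivs l s))).
- move=> w i e Kw e0; have := ev_continuous (p i) s w e0.
  by apply: filterS => v hv Kv; rewrite !restrictE.
- by move=> w; exact: restrict0.
- move=> w Pw; rewrite restrictE //.
  by have [rho [_ rho1 hw]] := polydisc_sub r0 Pw; apply: cpolydisc_le hw => //; exact: ltW.
- move=> l k w i Pw; have [rho [_ rho1 hw]] := polydisc_sub r0 Pw.
  have [C [dl [C0 dl0 h]]] := cauchy_taylor z r0 E l k rho1.
  have [M hM] := epoly_uniformly_bounded s (p i).
  exists (C * `|M|), dl; split => //; first by rewrite mulr_ge0.
  move=> t ht _; apply: h => // v Kv; rewrite (le_trans (hM v Kv)) //.
  exact: ler_norm.
- by move=> k w i e _ e0; exact: ev_continuous.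
Qed.

Lemma polydisc_closed w : P w -> K w.
Proof.
move=> Pw; have [rho [_ rho1 hw]] := polydisc_sub r0 Pw.
by apply: cpolydisc_le hw => //; exact: ltW.
Qed.

Lemma poly_tensorP (f : Cd -> E) : poly_tensor z r E f <->
  exists s : epoly d E, f = restrict (ev s).
Proof.
rewrite /poly_tensor /= closure_polydisc //; split.
  move=> [n [q [x [h1 h2]]]].
  exists [seq (q k, x k) | k <- enum 'I_n]; apply/funext => w.
  have [Kw|Kw] := pselect (K w); last by rewrite restrict0 // h2.
  by rewrite restrictE // h1 // /ev big_map big_enum.
move=> [s ->]; exists (size s), (fun k => (nth (0, 0) s k).1),
  (fun k => (nth (0, 0) s k).2); split=> w Kw; last by rewrite restrict0.
by rewrite restrictE // /ev (big_nth (0, 0)) big_mkord.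
Qed.

End Membership.

Section UniformLimits.
Variables (R : realType) (d : nat) (E : tvsType R[i]).
Hypothesis hE : hausdorff_space E.
Variables (I : Type) (p : I -> cseminorm E).
Hypothesis pf : directed_fundamental p.
Hypothesis cE : tvs_complete E.
Local Notation Cd := 'rV[R[i]^o]_d.
Variables (z : Cd) (r : 'I_d -> R).
Hypothesis r0 : forall k, 0 < r k.
Local Notation K := (cpolydisc z r 1).
Local Notation P := (polydisc z r).
Variable f : Cd -> E.

Definition epoly_near (i : I) (e : R) : set (epoly d E) :=
  [set s | forall w, K w -> p i (f w - ev s w) <= e].

Definition epoly_filter : set_system (epoly d E) :=
  filter_from [set ie : I * R | 0 < ie.2] (fun ie => epoly_near ie.1 ie.2).

Hypothesis f_approx : forall i (e : R), 0 < e -> epoly_near i e !=set0.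

Lemma epoly_filter_proper : ProperFilter epoly_filter.
Proof.
apply: filter_from_proper; last by move=> [i e] e0; exact: f_approx.
apply: filter_from_filter.
  by have [i _] := fund_index pf; exists (i, 1) => /=.
move=> [i e] [j e'] /= e0 e'0; have [k [c [c0 hc]]] := fund_directed pf i j.
exists (k, Num.min e e' / c) => /=; first by rewrite divr_gt0 // lt_min e0.
move=> s hs; split=> w Kw; have [h1 h2] := hc (f w - ev s w).
  rewrite (le_trans h1) // mulrC -ler_pdivlMr // (le_trans (hs w Kw)) //.
  by rewrite ler_wpM2r ?invr_ge0 ?(ltW c0) // ge_min lexx.
rewrite (le_trans h2) // mulrC -ler_pdivlMr // (le_trans (hs w Kw)) //.
by rewrite ler_wpM2r ?invr_ge0 ?(ltW c0) // ge_min lexx orbT.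
Qed.

Lemma epoly_near_filter i (e : R) : 0 < e -> epoly_filter (epoly_near i e).
Proof. by move=> e0; exists (i, e). Qed.

(** A map on polynomials that is Lipschitz for the uniform seminorms extends to
    the uniform limit [f]. *)
Lemma epoly_limit (L : epoly d E -> E) :
  (forall i, exists j (C : R), 0 <= C /\ forall s t M,
    (forall w, K w -> p j (ev s w - ev t w) <= M) -> p i (L s - L t) <= C * M) ->
  exists x : E, forall i (e : R), 0 < e ->
    epoly_filter [set s | p i (L s - x) < e].
Proof.
move=> hL; have PF := epoly_filter_proper.
have PL : ProperFilter (L @ epoly_filter) by exact: fmap_proper_filter.
suff /(@cE _ PL)[x hx] : forall U : set E, nbhs 0 U ->
    exists2 A, (L @ epoly_filter) A & forall x y, A x -> A y -> U (x - y).
  by exists x => i e e0; exact: (cvg_fundP pf _ _ _).1 hx i e e0.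
move=> U /(nbhs_fundP pf)[i [e [e0 hU]]].
have [j [C [C0 hC]]] := hL i; have C1 : 0 < C + 1 by rewrite ltr_wpDl.
pose e' := e / (C + 1) / 2; have e'0 : 0 < e' by rewrite !divr_gt0.
exists (L @` epoly_near j e').
  have := epoly_near_filter j e'0; apply: filterS => s hs /=; exists s => //.
move=> _ _ [s hs <-] [t ht <-]; apply: hU; rewrite subr0.
have : p i (L s - L t) <= C * (e' + e').
  apply: hC => w Kw; rewrite (le_trans (sn_triangle (p j) (f w) _ _))//.
  by rewrite lerD ?ht // snB hs.
move=> /le_lt_trans; apply; rewrite /e' -splitr mulrA ltr_pdivrMr // mulrC.
by rewrite ltr_pM2l // ltrDl.
Qed.

(** The constants of Taylor's estimate for a partial derivative of order [l]
    in the direction [k]. *)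
Definition taylor_bound l k (rho C delta : R) :=
  forall (q : seminorm E) (s : epoly d E) M,
    (forall w, K w -> q (ev s w) <= M) ->
    forall w (h : R[i]), cpolydisc z r rho w -> normc h <= delta ->
    q (ev (epoly_derivs l s) (w + h *: delta_mx 0 k) - ev (epoly_derivs l s) w
       - h *: ev (epoly_derivs (k :: l) s) w) <= C * M * normc h ^+ 2.

(** The estimates for polynomials have uniform constants, so the derivatives of
    the approximating polynomials converge and the limits satisfy them too. *)
Lemma uniform_limit_derivatives : exists D : seq 'I_d -> Cd -> E,
  [/\ forall w, P w -> D [::] w = f w,
    forall l k rho C delta i M, taylor_bound l k rho C delta ->
      (forall w, K w -> p i (f w) <= M) ->
      forall w (h : R[i]), cpolydisc z r rho w -> P w ->
      P (w + h *: delta_mx 0 k) -> normc h <= delta -> 0 <= C ->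
      p i (D l (w + h *: delta_mx 0 k) - D l w - h *: D (k :: l) w) <=
      C * (M + 1) * normc h ^+ 2 &
    forall l w i (e : R), P w -> 0 < e ->
      \forall v \near w, p i (D l v - D l w) < e].
Proof.
have PF := epoly_filter_proper.
pose Dlim l w x := P w -> forall i (e : R), 0 < e ->
  epoly_filter [set s | p i (ev (epoly_derivs l s) w - x) < e].
have Dex (lw : seq 'I_d * Cd) : exists x, Dlim lw.1 lw.2 x.
  case: lw => l w; have [Pw|nPw] := pselect (P w); last by exists 0.
  have [|x hx] := @epoly_limit (fun s => ev (epoly_derivs l s) w);
    last by exists x => _; exact: hx.
  move=> i; exists i; have [rho [_ rho1 hw]] := polydisc_sub r0 Pw.
  have [C [C0 hC]] := cauchy_estimate z r0 E l rho1.
  exists C; split => // s t M hM; rewrite -epoly_derivs_sub; apply: hC hw => v Kv.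
  by rewrite ev_cat ev_scale scaleN1r; exact: hM.
have [D hD] := choice Dex.
exists (fun l w => D (l, w)); split.
- move=> w Pw; apply: (fund_sep pf hE) => i e e0.
  have e2 : 0 < e / 2 by rewrite divr_gt0.
  have [s [hs1 hs2]] := filter_ex (filterI (hD ([::], w) Pw i _ e2) (epoly_near_filter i e2)).
  rewrite (le_trans (sn_triangle (p i) (ev s w) _ _))// (splitr e) lerD //.
    by rewrite snB ltW.
  by rewrite snB; apply: hs2; exact: polydisc_closed.
- move=> l k rho C dl i M hC hM w h hw Pw Ph hh C0.
  apply/ler_addgt0Pr => e e0.
  pose e4 := e / (3 + normc h).
  have h3 : 0 < 3 + normc h by rewrite ltr_wpDr ?normc_ge0.
  have e40 : 0 < e4 by rewrite divr_gt0.
  have [s [[[hs1 hs2] hs3] hs4]] := filter_ex (filterI (filterI (filterI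
    (hD (l, w) Pw i _ e40) (hD (l, w + h *: delta_mx 0 k) Ph i _ e40))
    (hD (k :: l, w) Pw i _ e40)) (epoly_near_filter i ltr01)).
  have hsM v : K v -> p i (ev s v) <= M + 1.
    move=> Kv; rewrite -[ev s v](subrK (f v)) addrC (le_trans (snD _ _ _))//.
    by rewrite lerD ?hM // snB hs4.
  have := hC _ _ _ hsM w h hw hh.
  move: hs1 hs2 hs3; rewrite /=.
  set a := ev _ _; set b := ev _ _; set c := ev _ _ => h1 h2 h3' h4.
  have -> : D (l, w + h *: delta_mx 0 k) - D (l, w) - h *: D (k :: l, w) =
      (b - a - h *: c) + ((D (l, w + h *: delta_mx 0 k) - b) +
      ((a - D (l, w)) + h *: (c - D (k :: l, w)))).
    rewrite scalerBr; move: (D (l, w + h *: delta_mx 0 k)) (D (l, w))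
      (h *: D (k :: l, w)) (h *: c) => x y u c'.
    rewrite addrCA [a - y + _]addrC [b - a - c' + _]addrA subrKA.
    by rewrite [b - a - u]addrAC subrKA -[b - u - y]addrA subrKA [- u - y]addrC addrA.
  rewrite (le_trans (snD _ _ _))// lerD //.
  have -> : e = e4 + (e4 + (normc h * e4 + e4)).
    by rewrite /e4; field; rewrite gt_eqF.
  rewrite (le_trans (snD _ _ _))// lerD ?(ltW h2) // 1?snB ?(ltW h2) //.
  rewrite (le_trans (snD _ _ _))// lerD ?(ltW h1) //.
  rewrite snZ ler_wpDr ?(ltW e40) // ler_wpM2l ?normc_ge0 //.
  exact: ltW.
- move=> l w i e Pw e0; have [rho /andP[rho0 rho1] hrho] := near_cpolydisc r0 Pw.
  have [C [C0 hC]] := cauchy_estimate z r0 E l rho1.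
  have C1 : 0 < 2 * C + 1 by rewrite ltr_wpDl // mulr_ge0.
  (* two polynomials that are [eta]-close to [f] have derivatives at a distance of
     at most [2 * C * eta] *)
  pose eta := e / 4 / (2 * C + 1); have eta0 : 0 < eta by rewrite !divr_gt0.
  have [s hs] := filter_ex (epoly_near_filter i eta0).
  have sD v : cpolydisc z r rho v -> p i (ev (epoly_derivs l s) v - D (l, v)) <= e / 4.
    move=> hv; have Pv := cpolydisc_polydisc r0 rho1 hv.
    have [t [ht1 ht2]] := filter_ex (filterI (hD (l, v) Pv i _ eta0)
      (epoly_near_filter i eta0)).
    rewrite (le_trans (sn_triangle (p i) (ev (epoly_derivs l t) v) _ _))//.
    have -> : e / 4 = C * (eta + eta) + eta.
      by rewrite /eta; field; rewrite gt_eqF.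
    rewrite lerD //; last exact: ltW.
    rewrite -epoly_derivs_sub; apply: hC hv => u Ku.
    rewrite ev_cat ev_scale scaleN1r (le_trans (sn_triangle (p i) (f u) _ _))//.
    by rewrite lerD ?ht2 // snB hs.
  have e4 : 0 < e / 4 by rewrite divr_gt0.
  have hc := ev_continuous (p i) (epoly_derivs l s) w e4.
  have hw : cpolydisc z r rho w := nbhs_singleton hrho.
  near=> v; have hv : cpolydisc z r rho v by near: v.
  rewrite (le_lt_trans (sn_triangle (p i) (ev (epoly_derivs l s) v) _ _))//.
  rewrite (le_lt_trans (lerD (lexx _) (sn_triangle (p i) (ev (epoly_derivs l s) w) _ _)))//.
  have -> : e = e / 4 + (e / 4 + e / 4) + e / 4 by field.
  rewrite addrA -[X in _ < X]addrA [X in _ < _ + X]addrC.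
  have a1 := sD _ hv; have a2 := sD _ hw; rewrite snB in a1.
  have a3 : p i (ev (epoly_derivs l s) (v : Cd) - ev (epoly_derivs l s) w) < e / 4 by near: v.
  by rewrite !addrA; move: a1 a2 a3 e4; lra.
Unshelve. all: by end_near. Qed.

(** Weierstrass' theorem, for limits of polynomials: completeness of [E] provides
    the derivatives. *)
Lemma uniform_limit_in_A : (forall w, ~ K w -> f w = 0) -> f \in A_pred z r E.
Proof.
move=> f0; have [D [D0 DT Dc]] := uniform_limit_derivatives.
have f_bounded i : exists M, forall w, K w -> p i (f w) <= M.
  have [s hs] := f_approx i ltr01; have [M hM] := epoly_uniformly_bounded z r0 s (p i).
  exists (1 + M) => w Kw; rewrite -[f w](subrK (ev s w)) (le_trans (snD _ _ _))//.
  by rewrite lerD ?hs ?hM.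
apply: (A_pred_intro pf r0 (D := D)) => //.
- move=> w i e Kw e0; have e4 : 0 < e / 4 by rewrite divr_gt0.
  have [s hs] := f_approx i e4; have := ev_continuous (p i) s w e4.
  apply: filterS => v hv Kv.
  rewrite (le_lt_trans (sn_triangle (p i) (ev s v) _ _))//.
  rewrite (le_lt_trans (lerD (lexx _) (sn_triangle (p i) (ev s w) _ _)))//.
  have a1 := hs _ Kv; have a2 := hs _ Kw; rewrite snB in a2.
  by move: a1 a2 hv e0; lra.
- move=> l k w i Pw; have [rho [_ rho1 hw]] := polydisc_sub r0 Pw.
  have [C [dl [C0 dl0 hC]]] := cauchy_taylor z r0 E l k rho1.
  have [M hM] := f_bounded i.
  exists (C * (`|M| + 1)), dl; split => //; first by rewrite mulr_ge0 ?addr_ge0.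
  move=> h hh Ph; apply: (DT l k rho C dl i `|M| hC) => // v Kv.
  by rewrite (le_trans (hM v Kv)) // ler_norm.
- by move=> k w i e; exact: Dc.
Qed.

End UniformLimits.

(** * The space of vector-valued functions *)

Section ComplexNumbers.
Variable R : realType.

Lemma complex_hausdorff : hausdorff_space (R[i]^o : tvsType R[i]).
Proof.
move=> a b hab; apply/eqP; rewrite eq_sym -subr_eq0; apply/contraT.
rewrite -normc_gt0 => n0; have e0 : 0 < normc (b - a) / 2 by rewrite divr_gt0.
have nb (x : R[i]) : nbhs (x : R[i]^o) [set c | normc (c - x) < normc (b - a) / 2].
  by apply/nbhs_complexP; exists (normc (b - a) / 2); split.
have [c [/= h1 h2]] := hab _ _ (nb a) (nb b).
have := le_normcD (b - c) (c - a); rewrite subrKA leNgt => /negP; case.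
by rewrite [ltRHS]splitr ltrD // -normcN opprB.
Qed.

Lemma modulus_fundamental : directed_fundamental (fun _ : unit => modulus R).
Proof.
split=> [[] []|U /nbhs_complexP[e [e0 hU]]].
  by exists tt, 1; split => // x; rewrite !mul1r.
by exists tt, e; split => // x /= xe; apply: hU; rewrite subr0.
Qed.

Lemma le_Re_normc (a : R[i]) : `|complex.Re a| <= normc a.
Proof.
by case: a => a b /=; rewrite -sqrtr_sqr ler_sqrt ?addr_ge0 ?sqr_ge0 // lerDl sqr_ge0.
Qed.

Lemma le_Im_normc (a : R[i]) : `|complex.Im a| <= normc a.
Proof.
by case: a => a b /=; rewrite -sqrtr_sqr ler_sqrt ?addr_ge0 ?sqr_ge0 // lerDr sqr_ge0.
Qed.

Lemma complex_complete : tvs_complete (R[i]^o : tvsType R[i]).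
Proof.
move=> F PF cF.
have small (e : R) : 0 < e -> exists2 A, F A &
    forall x y, A x -> A y -> normc (x - y) < e.
  move=> e0; have [|A FA hA] := cF [set x | normc x < e].
    by apply/nbhs_complexP; exists e; split => // b; rewrite subr0.
  by exists A.
have part (g : R[i] -> R) : (forall x y, `|g x - g y| <= normc (x - y)) ->
    exists l, forall e : R, 0 < e -> F [set x | `|g x - l| < e].
  move=> gl; have cg : cauchy (g @ F).
    apply: cauchy_exP => e e0; have [A FA hA] := small _ e0.
    have [x Ax] := filter_ex FA; exists (g x).
    apply: (@filterS _ F _ A) => // y Ay; rewrite /= -ball_normE /=.
    by rewrite (le_lt_trans (gl _ _)) // hA.
  have PG : ProperFilter (g @ F) by exact: fmap_proper_filter.
  have hl : g @ F --> lim (g @ F) by exact: cauchy_cvg.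
  move: (lim _) hl => l hl; exists l => e e0.
  have : nbhs l [set y | `|y - l| < e] by apply/nbhs_realP; exists e.
  exact: hl.
have [|x hx] := part (@complex.Re R).
  by move=> a b; rewrite (le_trans _ (le_Re_normc _)) //; case: a b => [? ?] [? ?].
have [|y hy] := part (@complex.Im R).
  by move=> a b; rewrite (le_trans _ (le_Im_normc _)) //; case: a b => [? ?] [? ?].
exists (x +i* y) => U /nbhs_complexP[e [e0 hU]].
have e2 : 0 < e / 2 by rewrite divr_gt0.
apply: filterS (filterI (hx _ e2) (hy _ e2)) => -[a b] [/= h1 h2]; apply: hU.
have -> : (a +i* b) - (x +i* y) = (a - x)%:C + (0 +i* (b - y)) :> R[i].
  by apply/eqP; rewrite eq_complex /= addr0 add0r !eqxx.
rewrite (le_lt_trans (le_normcD _ _))// (splitr e) ltrD //.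
  by rewrite /= expr0n addr0 sqrtr_sqr.
by rewrite /= expr0n add0r sqrtr_sqr.
Qed.

End ComplexNumbers.

Section FunctionSpace.
Variables (R : realType) (d : nat) (E : tvsType R[i]).
Hypothesis hE : hausdorff_space E.
Variables (I : Type) (p : I -> cseminorm E).
Hypothesis pf : directed_fundamental p.
Local Notation Cd := 'rV[R[i]^o]_d.
Variables (z : Cd) (r : 'I_d -> R).
Hypothesis r0 : forall k, 0 < r k.
Local Notation K := (cpolydisc z r 1).
Local Notation P := (polydisc z r).
Local Notation A := (A_carrier z r E).

Lemma A_sn_ub (q : cseminorm E) (f : A) w : K w -> q (f w) <= A_sn z r q f.
Proof.
rewrite -closure_polydisc // => Kw; have [M hM] := A_ev_bounded q f.
exact: (sup_fun_ub (ev := fun w (f : A) => f w) hM).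
Qed.

Lemma A_sn_le (q : cseminorm E) (f : A) (M : R) : 0 <= M ->
  (forall w, K w -> q (f w) <= M) -> A_sn z r q f <= M.
Proof.
move=> M0 h; apply: sup_fun_le => // w; rewrite closure_polydisc //; exact: h.
Qed.

Lemma A_sn_directed : sn_directed (fun i => A_sn z r (p i)).
Proof.
move=> i j; have [k [c [c0 hc]]] := fund_directed pf i j.
exists k, c; split => // f; split; apply: A_sn_le.
- by rewrite mulr_ge0 ?sn_ge0 // ltW.
- move=> w Kw; rewrite (le_trans (hc _).1) // ler_wpM2l ?(ltW c0) //.
  exact: A_sn_ub.
- by rewrite mulr_ge0 ?sn_ge0 // ltW.
- move=> w Kw; rewrite (le_trans (hc _).2) // ler_wpM2l ?(ltW c0) //.
  exact: A_sn_ub.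
Qed.

Lemma nbhs_A_spaceP (f : A_space z r p) (U : set (A_space z r p)) :
  nbhs f U <-> exists i (e : R), 0 < e /\
    forall g, A_sn z r (p i) (g - f) < e -> U g.
Proof.
have [i0 _] := fund_index pf.
exact: (@nbhs_lcsP R A I _ i0 f U A_sn_directed).
Qed.

Lemma A_fun_in (f : A) : (f : Cd -> E) \in A_pred z r E.
Proof. by case: f. Qed.

Lemma A_fun_out (f : A) w : ~ K w -> f w = 0.
Proof.
move=> Kw; case: f => f /= /asboolP[_ _]; apply.
by rewrite closure_polydisc.
Qed.

Lemma A_ext (f g : A) : (forall w, K w -> f w = g w) -> f = g.
Proof.
move=> h; apply/val_inj/funext => w; have [Kw|Kw] := pselect (K w); first exact: h.
by rewrite /= !A_fun_out.
Qed.

Definition epolyA (s : epoly d E) : A := ACarrier (epoly_in_A pf z r0 s).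

Lemma epolyAE s w : K w -> epolyA s w = ev s w.
Proof. exact: restrictE. Qed.

Lemma epolyA_near (f : A) (q : cseminorm E) (e : R) : 0 < e ->
  exists s, A_sn z r q (f - epolyA s) <= e.
Proof.
move=> e0; have [s hs] := A_polynomial_interpolation hE pf r0 q (A_fun_in f) e0.
exists s; apply: A_sn_le (ltW e0) _ => w Kw.
by rewrite -[(f - epolyA s) w]/(f w - epolyA s w) epolyAE // hs.
Qed.

Lemma poly_tensor_in_A :
  poly_tensor z r E `<=` [set f : Cd -> E | f \in A_pred z r E].
Proof. by move=> f /(poly_tensorP z r0)[s ->]; exact: (epoly_in_A pf z r0 s). Qed.

Lemma poly_tensor_dense :
  dense [set f : A_space z r p | poly_tensor z r E (f : A)].
Proof.
move=> O [f Of] oO; have : nbhs f O by apply: open_nbhs_nbhs.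
move=> /nbhs_A_spaceP[i [e [e0 h]]].
have e2 : 0 < e / 2 by rewrite divr_gt0.
have [s hs] := epolyA_near f (p i) e2; exists (epolyA s); split.
  apply: h; rewrite snB (le_lt_trans hs) // ltr_pdivrMr // ltr_pMr //.
  by rewrite ltr1n.
by apply/(poly_tensorP z r0); exists s.
Qed.

Lemma A_space_hausdorff : hausdorff_space (A_space z r p).
Proof.
move=> f g hfg; apply: A_ext => w Kw; apply: (fund_sep pf hE) => i e e0.
have e2 : 0 < e / 2 by rewrite divr_gt0.
have nb (x : A_space z r p) : nbhs x [set y | A_sn z r (p i) (y - x) < e / 2].
  by apply/nbhs_A_spaceP; exists i, (e / 2).
have [y [/= h1 h2]] := hfg _ _ (nb f) (nb g).
rewrite (le_trans (sn_triangle (p i) ((y : A) w) _ _))// (splitr e) lerD //.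
  by rewrite snB (le_trans (A_sn_ub (p i) (y - f : A) Kw)) // ltW.
by rewrite (le_trans (A_sn_ub (p i) (y - g : A) Kw)) // ltW.
Qed.

(** Pointwise limits of Cauchy filters are uniform limits of members of the space,
    hence of polynomials. *)
Lemma A_space_complete : tvs_complete E -> tvs_complete (A_space z r p).
Proof.
move=> cE F PF cF.
have small i (e : R) : 0 < e -> exists2 B, F B &
    forall (x y : A), B x -> B y -> forall w, K w -> p i (x w - y w) < e.
  move=> e0; have [|B FB hB] := cF [set x | A_sn z r (p i) x < e].
    by apply/nbhs_A_spaceP; exists i, e; split => // g; rewrite subr0.
  exists B => // x y Bx By w Kw; apply: le_lt_trans (hB x y Bx By).
  exact: (A_sn_ub (p i) (x - y : A) Kw).
pose lim_at w l := K w -> forall i (e : R), 0 < e ->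
  F [set g : A | p i (g w - l) < e].
have [f0 hf0] : exists f0, forall w, lim_at w (f0 w).
  suff /choice[f0 h] : forall w, exists l, lim_at w l by exists f0.
  move=> w; have [Kw|nKw] := pselect (K w); last by exists 0.
  have PL : ProperFilter ((fun g : A => g w) @ F) by exact: fmap_proper_filter.
  suff /(@cE _ PL)[l hl] : forall U : set E, nbhs 0 U -> exists2 B,
      ((fun g : A => g w) @ F) B & forall x y, B x -> B y -> U (x - y).
    by exists l => _ i e e0; exact: (cvg_fundP pf _ _ _).1 hl i e e0.
  move=> U /(nbhs_fundP pf)[i [e [e0 hU]]]; have [B FB hB] := small i e e0.
  exists ((fun g : A => g w) @` B).
    by apply: (@filterS _ F _ B) => // g Bg; exists g.
  by move=> _ _ [g Bg <-] [h Bh <-]; apply: hU; rewrite subr0; exact: hB.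
pose f := restrict z r f0.
have unif i (e : R) : 0 < e -> exists2 B, F B &
    forall g : A, B g -> forall w, K w -> p i (g w - f w) <= e.
  move=> e0; have e2 : 0 < e / 2 by rewrite divr_gt0.
  have [B FB hB] := small i _ e2; exists B => // g Bg w Kw.
  have [h [Bh hh]] := filter_ex (filterI FB (hf0 w Kw i _ e2)).
  rewrite /f restrictE // (le_trans (sn_triangle (p i) (h w) _ _))//.
  by rewrite (splitr e) lerD // ltW // hB.
have fA : f \in A_pred z r E.
  apply: (uniform_limit_in_A hE pf cE r0); last by move=> w; exact: restrict0.
  move=> i e e0; have e2 : 0 < e / 2 by rewrite divr_gt0.
  have [B FB hB] := unif i _ e2; have [g Bg] := filter_ex FB.
  have [s hs] := A_polynomial_interpolation hE pf r0 (p i) (A_fun_in g) e2.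
  exists s => w Kw; rewrite (le_trans (sn_triangle (p i) (g w) _ _))//.
  by rewrite (splitr e) lerD ?hs // snB hB.
exists (ACarrier fA : A_space z r p) => U /nbhs_A_spaceP[i [e [e0 hU]]].
have e2 : 0 < e / 2 by rewrite divr_gt0.
have [B FB hB] := unif i _ e2; apply: (@filterS _ F _ B) => // g Bg; apply: hU.
apply: (@le_lt_trans _ _ (e / 2)); last by rewrite ltr_pdivrMr // ltr_pMr // ltr1n.
by apply: A_sn_le (ltW e2) _ => w Kw; exact: (hB g Bg w Kw).
Qed.

End FunctionSpace.

(** * Continuous linear maps and functionals *)

Section ContinuousLinearMaps.
Variable R : realType.

Lemma linearD_fun (U V : lmodType R[i]) (f : U -> V) : linear f ->
  forall x y, f (x + y) = f x + f y.
Proof. by move=> fl x y; have := fl 1 x y; rewrite !scale1r. Qed.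

Lemma linearZ_fun (U V : lmodType R[i]) (f : U -> V) : linear f ->
  forall a x, f (a *: x) = a *: f x.
Proof. by move=> fl a x; have := fl a x 0; rewrite (linear_fun0 fl) !addr0. Qed.

Lemma linearB_fun (U V : lmodType R[i]) (f : U -> V) : linear f ->
  forall x y, f (x - y) = f x - f y.
Proof.
by move=> fl x y; rewrite -scaleN1r (linearD_fun fl) (linearZ_fun fl) scaleN1r.
Qed.

Lemma linear_sum_fun (U V : lmodType R[i]) (f : U -> V) : linear f ->
  forall (T : Type) (s : seq T) (F : T -> U),
  f (\sum_(t <- s) F t) = \sum_(t <- s) f (F t).
Proof.
move=> fl T s F; apply: (big_morph f); first exact: linearD_fun.
exact: linear_fun0.
Qed.

Lemma linear_continuous_at0 (X Y : tvsType R[i]) (f : X -> Y) : linear f ->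
  (forall U : set Y, nbhs 0 U -> nbhs 0 (f @^-1` U)) -> continuous f.
Proof.
move=> fl f0 x U; rewrite -[f x]add0r nbhs_translate => /f0.
rewrite /= => h; suff : nbhs x (f @^-1` U) by [].
rewrite -[x]add0r nbhs_translate; move: h; apply: filterS => y /=.
by rewrite (linearD_fun fl).
Qed.

Definition functional_sn (X : lmodType R[i]) (f : X -> R[i]^o) (fl : linear f) :
  seminorm X.
Proof.
apply: (@Seminorm R X (fun x => normc (f x))).
- by move=> a x; rewrite (linearZ_fun fl) normcM.
- by move=> x y; rewrite (linearD_fun fl); exact: le_normcD.
Defined.

Section Fundamental.
Variables (X : tvsType R[i]) (I : Type) (p : I -> cseminorm X).
Hypothesis pf : directed_fundamental p.

Lemma linear_continuous_bound (Y : tvsType R[i]) (J : Type) (q : J -> cseminorm Y)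
    (qf : directed_fundamental q) (f : X -> Y) : linear f ->
  (forall j, exists i (C : R), forall x, q j (f x) <= C * p i x) -> continuous f.
Proof.
move=> fl h; apply: (linear_continuous_at0 fl) => U /(nbhs_fundP qf)[j [e [e0 hU]]].
have [i [C hC]] := h j; apply/(nbhs_fundP pf).
have C1 : 0 < `|C| + 1 by rewrite ltr_wpDl.
exists i, (e / (`|C| + 1)); split; first by rewrite divr_gt0.
move=> y; rewrite subr0 => hy; apply: hU; rewrite subr0.
rewrite (le_lt_trans (hC y)) // (le_lt_trans (y := (`|C| + 1) * p i y)) //.
  by rewrite ler_wpM2r ?sn_ge0 // (le_trans (ler_norm _)) // lerDl.
by rewrite mulrC -ltr_pdivlMr.
Qed.

Lemma functional_continuous (q : cseminorm X) (f : X -> R[i]^o) : linear f ->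
  (forall x, normc (f x) <= q x) -> continuous f.
Proof.
move=> fl h; apply: (linear_continuous_at0 fl) => U /nbhs_complexP[e [e0 hU]].
have := csn_ball q 0 e0; apply: filterS => x /=; rewrite subr0 => qx.
by apply: hU; rewrite subr0 (le_lt_trans (h x)).
Qed.

Lemma functional_bound (f : clin X R[i]^o) :
  exists i (C : R), 0 < C /\ forall x, normc (f x) <= C * p i x.
Proof.
apply: (fund_dom pf (q := functional_sn (clin_linear f))).
have := @clin_continuous _ _ _ f 0 [set y | normc y < 1].
rewrite (linear_fun0 (clin_linear f)) => h.
have h0 : nbhs (0 : R[i]^o) [set y | normc y < 1].
  by apply/nbhs_complexP; exists 1; split => // b; rewrite subr0.
have : nbhs (0 : X) [set x | normc (f x) < 1] by exact: h h0.
by apply: filterS => x /= /ltW.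
Qed.

Lemma equicont_bound (H : set (clin X R[i]^o)) : equicont H ->
  exists i (C : R), 0 < C /\ forall f, H f -> forall x, normc (f x) <= C * p i x.
Proof.
move=> /(equicont_sn (modulus R)) /(nbhs_fundP pf)[i [e [e0 h]]].
exists i, (2 / e); split; first by rewrite divr_gt0.
move=> f Hf; apply: (@sn_le_of_ball _ _ _ (functional_sn (clin_linear f)) _ e0).
by move=> x px; have := h x; rewrite subr0 => /(_ px) /(_ f Hf).
Qed.

Lemma equicont_intro (q : cseminorm X) (H : set (clin X R[i]^o)) :
  (forall f, H f -> forall x, normc (f x) <= q x) -> equicont H.
Proof.
move=> h x U; rewrite -entourage_from_ballE => -[e /= e0 hU].
have /complex_realP[t te] : e \is Num.real by exact: gtr0_real.
rewrite {}te ltcR in e0 hU *.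
have := csn_ball q x e0; apply: filterS => y /= qy f Hf; apply: hU => /=.
rewrite -ball_normE /= normCE ltcR -(linearB_fun (clin_linear f)).
by rewrite (le_lt_trans (h _ Hf _)) // snB.
Qed.

End Fundamental.

End ContinuousLinearMaps.

(** * Uniform interpolation on compact sets of scalar functions *)

Section ScalarAlgebra.
Variables (R : realType) (d : nat).
Local Notation C := R[i]^o.
Local Notation MP := (mpoly d R[i]).
Local Notation Cd := 'rV[C]_d.
Variables (z : Cd) (r : 'I_d -> R).
Hypothesis r0 : forall k, 0 < r k.
Local Notation K := (cpolydisc z r 1).
Local Notation P := (polydisc z r).
Local Notation F := (A_scalar z r).
Local Notation A := (A_carrier z r C).
Local Notation hC := (@complex_hausdorff R).
Local Notation mf := (modulus_fundamental R).
Local Notation nrm := (A_sn z r (modulus R)).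

Lemma A_sn_continuous (E : tvsType R[i]) (I : Type) (p : I -> cseminorm E)
    (pf : directed_fundamental p) i :
  continuous (A_sn z r (p i) : A_space z r p -> R).
Proof.
move=> f U /nbhs_realP[e [e0 hU]]; apply/(nbhs_A_spaceP pf r0).
exists i, e; split => // g hg; apply: hU; apply: le_lt_trans hg.
rewrite ler_norml lerBlDr lerNl opprB; apply/andP; split.
  by rewrite lerBlDr -[X in A_sn _ _ _ X <= _](subrK g) (le_trans (snD _ _ _)) // lerD2r snB.
by rewrite -[X in A_sn _ _ _ X <= _](subrK f) (le_trans (snD _ _ _)).
Qed.

Definition A_csn (E : tvsType R[i]) (I : Type) (p : I -> cseminorm E)
    (pf : directed_fundamental p) i : cseminorm (A_space z r p) :=
  @CSeminorm R (A_space z r p) (A_sn z r (p i)) (@A_sn_continuous E I p pf i).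

Lemma A_csn_fundamental (E : tvsType R[i]) (I : Type) (p : I -> cseminorm E)
    (pf : directed_fundamental p) : directed_fundamental (A_csn pf).
Proof.
split; first exact: A_sn_directed.
move=> U /(nbhs_A_spaceP pf r0)[i [e [e0 hU]]]; exists i, e; split => //.
by move=> f hf; apply: hU; rewrite subr0.
Qed.

Definition F_csn : unit -> cseminorm F := A_csn mf.

Lemma F_csn_fundamental : directed_fundamental F_csn.
Proof. exact: A_csn_fundamental. Qed.

Lemma compact_F_bounded (B : set F) : compact B ->
  exists M : R, 0 <= M /\ forall b : A, B b -> nrm b <= M.
Proof.
move=> /compact_tvs_bounded /(csn_bounded (F_csn tt))[M hM].
by exists `|M|; split => // b Bb; rewrite (le_trans (hM b Bb)) // ler_norm.
Qed.

(** With the seminorms of all [b] in a set, the map from [w] to the evaluation of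
    [b] at [w] is a vector-valued function that can be interpolated. *)
Definition eval_sn (b : A) : seminorm (A -> C).
Proof.
apply: (@Seminorm R (A -> C) (fun phi => normc (phi b))).
- by move=> a phi; exact: normcM.
- by move=> phi psi; exact: le_normcD.
Defined.

Lemma compact_F_equicontinuous (B : set F) : compact B ->
  forall e : R, 0 < e -> exists delta : R, 0 < delta /\
  forall w v, K w -> K v -> (forall k, normc (w 0 k - v 0 k) < delta) ->
  forall b : A, B b -> normc (b w - b v) <= e.
Proof.
move=> /compact_near_coveringP cB e e0.
have [|dl [dl0 h]] := @compact_uniformly_continuous R d (A -> C)
    [set eval_sn b | b in B] K (fun w b => b w)
    (compact_cpolydisc r0 ltr01) _ e e0; last first.
  exists dl; split => // w v Kw Kv wv b Bb.
  by apply: (h w v Kw Kv wv (eval_sn b)); exists b.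
move=> w e' Kw e'0; pose Q (dl : R) (b : F) := forall v, K v ->
  (forall k, normc (v 0 k - w 0 k) < dl) -> normc ((b : A) v - (b : A) w) <= e'.
have /filter_ex[dl [dl0 hd]] : (0 : R)^'+ [set dl | 0 < dl /\ B `<=` Q dl].
  apply: filterI; first exact: nbhs_right_gt.
  apply: (cB R (0 : R)^'+ Q _) => b Bb; have e3 : 0 < e' / 3 by rewrite divr_gt0.
  have [dl [dl0 h]] := A_uniformly_continuous r0 (modulus R) (A_fun_in b) e3.
  exists ([set c : F | nrm (c - b) < e' / 3], [set x | x < dl]).
    split; last exact: nbhs_right_lt.
    by apply/(nbhs_A_spaceP mf r0); exists tt, (e' / 3).
  move=> [c x] /= [hc xd] v Kv hv.
  have h1 := A_sn_ub r0 (modulus R) (c - b : A) Kv.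
  have h2 := A_sn_ub r0 (modulus R) (c - b : A) Kw.
  have h3 : normc ((b : A) v - (b : A) w) <= e' / 3.
    by apply: h => // k; rewrite (lt_trans (hv k)).
  have -> : (c : A) v - (c : A) w = ((c : A) v - (b : A) v) +
    (((b : A) v - (b : A) w) + ((b : A) w - (c : A) w)) by ring.
  rewrite (le_trans (le_normcD _ _)) // (le_trans (lerD (lexx _) (le_normcD _ _))) //.
  rewrite -[normc ((b : A) w - _)]normcN opprB.
  by move: h1 h2 hc h3; rewrite /=; lra.
exists dl; split => // v Kv hv _ [b Bb <-]; exact: hd.
Qed.

Lemma F_approx (b : A) (i : unit) (e : R) : 0 < e ->
  epoly_near (fun _ => modulus R) z r b i e !=set0.
Proof. by move=> e0; exact: (A_polynomial_interpolation hC mf r0 _ (A_fun_in b)). Qed.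

(** Evaluation at the points of the polydisc is itself a function with values in
    the dual of the scalar algebra, and it is holomorphic uniformly on compact
    sets; its interpolation is the transpose of a finite rank operator. *)
Lemma compact_interpolation (B : set F) (e : R) : compact B -> 0 < e ->
  exists s : seq (MP * Cd), (forall t, t \in s -> K t.2) /\
  forall b : A, B b -> forall w, K w ->
    normc (b w - \sum_(t <- s) t.1.@[w 0] * b t.2) <= e.
Proof.
move=> cB e0; have [M [M0 hM]] := compact_F_bounded cB.
have /choice[D hD] : forall b : A, exists D : seq 'I_d -> Cd -> C,
    (forall w, P w -> D [::] w = b w) /\
    (forall l k rho C' delta M, @taylor_bound R d R[i]^o z r l k rho C' delta ->
      (forall w, K w -> normc (b w) <= M) ->
      forall w (h : R[i]), cpolydisc z r rho w -> P w ->
      P (w + h *: delta_mx 0 k) -> normc h <= delta -> 0 <= C' ->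
      normc (D l (w + h *: delta_mx 0 k) - D l w - h *: D (k :: l) w) <=
      C' * (M + 1) * normc h ^+ 2).
  move=> b; have [D [D0 DT _]] := uniform_limit_derivatives hC mf
    (@complex_complete R) r0 (F_approx b).
  by exists D; split => // l k rho C' dl N; exact: (DT l k rho C' dl tt N).
have [|||s [sK hs]] := @polynomial_interpolation R d (A -> C) z r r0
  (fun w b => b w) (fun k w b => D b [:: k] w) [set eval_sn b | b in B] _ _ e.
- move=> e' e'0; have [dl [dl0 h]] := compact_F_equicontinuous cB e'0.
  by exists dl; split => // w v Kw Kv wv _ [b Bb <-]; exact: h.
- move=> rho k e' /andP[rho0 rho1] e'0.
  have [C' [dl [C0 dl0 hC']]] := cauchy_taylor z r0 C [::] k rho1.
  have C1 : 0 < C' * (M + 1) + 1 by rewrite ltr_wpDl // mulr_ge0 // addr_ge0.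
  exists (Num.min dl (e' / (C' * (M + 1) + 1))); split.
    by rewrite lt_min dl0 divr_gt0.
  move=> w h hw hwh; rewrite lt_min => /andP[h1 h2] _ [b Bb <-].
  have Pw := cpolydisc_polydisc r0 rho1 hw.
  have Ph := cpolydisc_polydisc r0 rho1 hwh.
  have [D0 DT] := hD b.
  have bM v : K v -> normc (b v) <= M.
    by move=> Kv; rewrite (le_trans (A_sn_ub r0 (modulus R) b Kv)) // hM.
  have := DT _ _ _ _ _ _ hC' bM w h hw Pw Ph (ltW h1) C0.
  rewrite !D0 // => h3; apply: le_trans h3 _.
  rewrite expr2 mulrA ler_wpM2r ?normc_ge0 //.
  rewrite (le_trans (y := (C' * (M + 1) + 1) * normc h)) //.
    by rewrite ler_wpM2r ?normc_ge0 // lerDl.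
  by rewrite mulrC -ler_pdivlMr // ltW.
- by [].
exists s; split => // b Bb w Kw.
have := hs w Kw (eval_sn b) (ex_intro2 _ _ b Bb erefl).
apply: le_trans; rewrite le_eqVlt; apply/orP; left; apply/eqP.
apply: (congr1 (fun x : C => normc (b w - x))).
by elim/big_rec2: _ => // t x y _ ->.
Qed.

Lemma dirac_subproof (w : Cd) : (fun f : F => (f : A) w : C) \in @clin_pred R F C.
Proof.
apply/asboolP; split => //; have [Kw|Kw] := pselect (K w).
  apply: (@functional_continuous R F (F_csn tt)) => // f.
  exact: (A_sn_ub r0 (modulus R) f Kw).
have -> : (fun f : F => (f : A) w : C) = fun _ => 0.
  by apply/funext => f; rewrite A_fun_out.
exact: (@cst_continuous _ _ (0 : C)).
Qed.

Definition dirac (w : Cd) : clin F C := Clin (dirac_subproof w).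

Definition poly_scalar (q : MP) : A := epolyA mf z r0 [:: (q, 1 : C)].

Lemma poly_scalarE q w : K w -> poly_scalar q w = q.@[w 0].
Proof. by move=> Kw; rewrite epolyAE // /ev big_seq1 /= [LHS]mulr1. Qed.

(** The interpolation operator with polynomials and nodes [s]. *)
Definition interp (s : seq (MP * Cd)) (f : A) : A :=
  \sum_(t <- s) f t.2 *: poly_scalar t.1.

Lemma interpE s f w : K w -> interp s f w = \sum_(t <- s) t.1.@[w 0] * f t.2.
Proof.
move=> Kw; rewrite /interp (big_morph (fun g : A => g w) (id1 := 0) (op1 := +%R)) //.
by apply: eq_bigr => t _; rewrite -poly_scalarE // mulrC.
Qed.

Lemma compact_interp (B : set F) (e : R) : compact B -> 0 < e ->
  exists s : seq (MP * Cd), (forall t, t \in s -> K t.2) /\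
  forall b : A, B b -> nrm (b - interp s b) <= e.
Proof.
move=> cB e0; have [s [sK hs]] := compact_interpolation cB e0.
exists s; split => // b Bb; apply: (A_sn_le r0 (ltW e0)) => w Kw.
by rewrite -[(b - interp s b) w]/(b w - interp s b w) interpE //; exact: hs.
Qed.

Lemma interp_clin s : (interp s : F -> F) \in @clin_pred R F F.
Proof.
have li : linear (interp s : F -> F).
  move=> a f g; rewrite /interp scaler_sumr -big_split; apply: eq_bigr => t _ /=.
  by rewrite scalerA -scalerDl.
apply/asboolP; split => //.
apply: (linear_continuous_bound F_csn_fundamental F_csn_fundamental li) => -[].
suff [C' [C'0 hC']] : exists C' : R, 0 <= C' /\ forall f : A, nrm (interp s f) <= C' * nrm f.
  by exists tt, C'.
elim: s {li} => [|t s [C' [C'0 hC']]].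
  by exists 0; split => // f; rewrite /interp big_nil sn0 mul0r.
have [[] [M [M0 hM]]] := functional_bound F_csn_fundamental (dirac t.2).
exists (M * nrm (poly_scalar t.1) + C'); split.
  by rewrite addr_ge0 // mulr_ge0 ?sn_ge0 // ltW.
move=> f; rewrite /interp big_cons (le_trans (snD _ _ _)) // mulrDl lerD //; last exact: hC'.
rewrite snZ mulrAC ler_wpM2r ?sn_ge0 //; exact: hM.
Qed.

(** A neighbourhood of the identity involves finitely many compact sets, and their
    union serves for all of them. *)
Lemma compact_exhaust (s : seq (set_type (@acc R F) * cseminorm F)) :
  exists (B : set F) (c : R), [/\ compact B, 0 < c &
  forall (T : clin F F) (e : R), 0 <= e -> (forall b : F, B b -> nrm (T b - b : A) <= e) ->
  all (fun i => clin_sn (@acc_bounded R F) i (T - clin_id F) <= c * e) s].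
Proof.
elim: s => [|[L q] s [B [c [cB c0 hc]]]].
  by exists set0, 1; split => //; exact: compact0.
have [_ cL] := set_valP L.
have [[] [c' [c'0 hc']]] := fund_dom_csn F_csn_fundamental q.
exists (val L `|` B), (c + c'); split; [exact: compactU|exact: addr_gt0|].
move=> T e e0 hT /=; apply/andP; split.
  apply: sup_fun_le => [|x /= Lx]; first by rewrite mulr_ge0 // addr_ge0 // ltW.
  apply: (le_trans (hc' (T x - x))).
  rewrite mulrDl (le_trans (y := c' * e)) //.
    by rewrite ler_wpM2l ?(ltW c'0) //; apply: hT; left.
  by rewrite lerDr mulr_ge0 // ltW.
apply: sub_all (hc T e e0 _) => [i /le_trans|b Bb]; last by apply: hT; right.
by apply; rewrite mulrDl lerDl mulr_ge0 // ltW.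
Qed.

Lemma scalar_approximation_property : approximation_property F.
Proof.
move=> U [s [e [e0 hU]]]; have [B [c [cB c0 hc]]] := compact_exhaust s.
have e2 : 0 < e / c / 2 by rewrite !divr_gt0.
have [t [tK ht]] := compact_interp cB e2.
exists (Clin (interp_clin t) : Lkappa F F); split.
  exists (size t), (fun k => dirac (nth (0, 0) t k).2),
    (fun k => poly_scalar (nth (0, 0) t k).1) => f /=.
  by rewrite /interp (big_nth (0, 0)) big_mkord.
apply: hU; rewrite /lcs_ball /=.
have ht' (b : F) : B b -> nrm (interp t b - b : A) <= e / c / 2.
  by move=> Bb; have := ht b Bb; rewrite snB.
have := hc (Clin (interp_clin t)) _ (ltW e2) ht'.
apply: sub_all => i /le_lt_trans; apply.
have -> : c * (e / c / 2) = e / 2 by field; rewrite gt_eqF.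
by rewrite ltr_pdivrMr // ltr_pMr // ltr1n.
Qed.

End ScalarAlgebra.

(** * The isomorphism with the epsilon product *)

Definition mk_linear (R : pzRingType) (X Y : lmodType R) (f : X -> Y)
    (fl : linear f) : {linear X -> Y} :=
  HB.pack f (GRing.isLinear.Build R X Y *:%R f fl).

Section DualSeparation.
Variables (R : realType) (E : tvsType R[i]).
Hypothesis hE : hausdorff_space E.
Variables (I : Type) (p : I -> cseminorm E).
Hypothesis pf : directed_fundamental p.

Lemma norming_functional (q : cseminorm E) (x : E) :
  exists psi : clin E R[i]^o, (forall y, normc (psi y) <= q y) /\
    normc (psi x) = q x.
Proof.
have [psi [pl ple px]] := hahn_banach q x.
have pc : psi \in @clin_pred R E R[i]^o.
  by apply/asboolP; split => //; exact: functional_continuous pl ple.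
by exists (Clin pc).
Qed.

Lemma functionals_separate (x y : E) :
  (forall psi : clin E R[i]^o, psi x = psi y) -> x = y.
Proof.
move=> h; apply: (fund_sep pf hE) => i e e0.
have [psi [_ <-]] := norming_functional (p i) (x - y).
by rewrite (linearB_fun (clin_linear psi)) h subrr normc0 ltW.
Qed.

Lemma linear_continuous_to_lcs (V : lmodType R[i]) (J : Type) (q : J -> seminorm V)
    (f : E -> lcs q) : linear f ->
  (forall j, exists i (C : R), forall x, q j (f x) <= C * p i x) -> continuous f.
Proof.
move=> fl h; apply: (linear_continuous_at0 fl) => U [s [e [e0 hU]]].
suff : nbhs (0 : E) [set x | all (fun j => q j (f x) < e) s].
  apply: filterS => x /= hx; apply: hU; rewrite /lcs_ball /=.
  by move: hx; apply: sub_all => j; rewrite subr0.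
elim: s {hU} => [|j s ih]; first by apply: filterS filterT.
have [i [C hC]] := h j; have C1 : 0 < `|C| + 1 by rewrite ltr_wpDl.
apply: filterS (filterI (csn_ball (p i) 0 (divr_gt0 e0 C1)) ih) => x [/= hx ->].
rewrite andbT; rewrite subr0 in hx.
rewrite (le_lt_trans (hC x)) // (le_lt_trans (y := (`|C| + 1) * p i x)) //.
  by rewrite ler_wpM2r ?sn_ge0 // (le_trans (ler_norm _)) // lerDl.
by rewrite mulrC -ltr_pdivlMr.
Qed.

End DualSeparation.

Lemma linear_continuous_from_lcs (R : realType) (V : lmodType R[i]) (J : Type)
    (q : J -> seminorm V) (Y : tvsType R[i]) (I : Type) (p : I -> cseminorm Y)
    (pf : directed_fundamental p) (f : lcs q -> Y) : linear f ->
  (forall i, exists j, forall x, p i (f x) <= q j x) -> continuous f.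
Proof.
move=> fl h; apply: (linear_continuous_at0 fl) => U /(nbhs_fundP pf)[i [e [e0 hU]]].
have [j hj] := h i; exists [:: j], e; split => // x.
rewrite /lcs_ball /= andbT subr0 => hx; apply: hU.
by rewrite subr0 (le_lt_trans (hj x)).
Qed.

Section EpsilonProduct.
Variables (R : realType) (d : nat).
Local Notation C := R[i]^o.
Local Notation MP := (mpoly d R[i]).
Local Notation Cd := 'rV[C]_d.
Variables (z : Cd) (r : 'I_d -> R).
Hypothesis r0 : forall k, 0 < r k.
Local Notation K := (cpolydisc z r 1).
Local Notation F := (A_scalar z r).
Local Notation AC := (A_carrier z r C).
Local Notation hC := (@complex_hausdorff R).
Local Notation mf := (modulus_fundamental R).
Local Notation nrm := (A_sn z r (modulus R)).
Local Notation Ff := (F_csn_fundamental z r0).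
Variables (E : tvsType R[i]).
Hypothesis hE : hausdorff_space E.
Variables (I : Type) (p : I -> cseminorm E).
Hypothesis pf : directed_fundamental p.
Local Notation A := (A_carrier z r E).
Implicit Types (f : A) (phi : clin F C) (psi : clin E C).

Lemma center_in_K : K z.
Proof. by move=> k; rewrite subrr normc0 mul1r ltW. Qed.

Definition epoly_map psi (s : epoly d E) : epoly d C :=
  [seq (t.1, psi t.2) | t <- s].

Lemma ev_epoly_map psi s w : ev (epoly_map psi s) w = psi (ev s w).
Proof.
rewrite /ev big_map (linear_sum_fun (clin_linear psi)); apply: eq_bigr => t _.
by rewrite (linearZ_fun (clin_linear psi)).
Qed.

Lemma comp_in_A psi f : (fun w => psi (f w)) \in A_pred z r C.
Proof.
apply: (uniform_limit_in_A hC mf (@complex_complete R) r0) => [[] e e0|w Kw].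
  have [i [c [c0 hc]]] := functional_bound pf psi.
  have [s hs] := A_polynomial_interpolation hE pf r0 (p i) (A_fun_in f) (divr_gt0 e0 c0).
  exists (epoly_map psi s) => w Kw; rewrite ev_epoly_map -(linearB_fun (clin_linear psi)).
  by rewrite (le_trans (hc _)) // mulrC -ler_pdivlMr // hs.
by rewrite (A_fun_out r0 f Kw) (linear_fun0 (clin_linear psi)).
Qed.

Definition comp psi f : AC := ACarrier (comp_in_A psi f).

Lemma comp_linear psi : linear (comp psi).
Proof.
by move=> a f g; apply: (A_ext r0) => w _; exact: (clin_linear psi).
Qed.

Lemma comp_norm psi (q : cseminorm E) f : (forall y, normc (psi y) <= q y) ->
  nrm (comp psi f) <= A_sn z r q f.
Proof.
move=> h; apply: (A_sn_le r0); first exact: sn_ge0.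
by move=> w Kw; rewrite (le_trans (h _)) // A_sn_ub.
Qed.

Section Integral.
Variables (phi : clin F C) (f : A).

Let L (s : epoly d E) : E := \sum_(t <- s) phi (poly_scalar z r0 t.1) *: t.2.

Let L_psi psi s : psi (L s) = phi (epolyA mf z r0 (epoly_map psi s)).
Proof.
rewrite /L (linear_sum_fun (clin_linear psi)).
have -> : epolyA mf z r0 (epoly_map psi s) =
    \sum_(t <- s) psi t.2 *: poly_scalar z r0 t.1.
  apply: (A_ext r0) => w Kw; rewrite epolyAE // /ev big_map.
  rewrite (big_morph (fun g : AC => g w) (id1 := 0) (op1 := +%R)) //.
  by apply: eq_bigr => t _; rewrite -(poly_scalarE r0 _ Kw); exact: mulrC.
rewrite (linear_sum_fun (clin_linear phi)); apply: eq_bigr => t _.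
rewrite (linearZ_fun (clin_linear psi)) (linearZ_fun (clin_linear phi)).
exact: mulrC.
Qed.

(** For a polynomial with terms [q *: x] the vector is the sum of the [phi q *: x].
    By the Hahn-Banach theorem these sums are bounded by the polynomials, so they
    converge when the polynomials converge to [f]. *)
Lemma integral_exists : tvs_complete E -> exists x : E, forall psi, psi x = phi (comp psi f).
Proof.
move=> cE; have [[] [c [c0 hc]]] := functional_bound Ff phi.
have approx i (e : R) : 0 < e -> epoly_near p z r f i e !=set0.
  by move=> e0; exact: (A_polynomial_interpolation hE pf r0 _ (A_fun_in f)).
have [|x hx] := epoly_limit pf cE approx (L := L).
  move=> i; exists i, c; split; first exact: ltW.
  move=> s t M hM; have [psi [ple <-]] := norming_functional (p i) (L s - L t).
  rewrite (linearB_fun (clin_linear psi)) !L_psi -(linearB_fun (clin_linear phi)).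
  have M0 : 0 <= M by apply: le_trans (hM z center_in_K); exact: sn_ge0.
  rewrite (le_trans (hc _)) // ler_wpM2l ?(ltW c0) //.
  apply: (A_sn_le r0 M0) => w Kw; apply: le_trans (hM w Kw).
  apply: le_trans (ple _); rewrite (linearB_fun (clin_linear psi)).
  by rewrite -!ev_epoly_map -(epolyAE mf r0 _ Kw) -(epolyAE mf r0 _ Kw).
exists x => psi; have PF := epoly_filter_proper pf approx.
apply: (fund_sep mf hC) => _ e e0 /=.
have [i [c' [c'0 hc']]] := functional_bound pf psi.
have e1 : 0 < e / 2 / c' by rewrite !divr_gt0.
have e2 : 0 < e / 2 / c / c' by rewrite !divr_gt0.
have [s [/= hs1 hs2]] := filter_ex (filterI (hx i _ e1)
  (epoly_near_filter p z r f i e2)).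
have -> : psi x - phi (comp psi f) = (psi x - psi (L s)) +
    (psi (L s) - phi (comp psi f)) by rewrite subrKA.
rewrite (le_trans (le_normcD _ _)) // (splitr e) lerD //.
  rewrite -(linearB_fun (clin_linear psi)) (le_trans (hc' _)) //.
  by rewrite mulrC -ler_pdivlMr // snB ltW.
rewrite L_psi -(linearB_fun (clin_linear phi)) (le_trans (hc _)) //.
rewrite mulrC -ler_pdivlMr //.
apply: (A_sn_le r0) => [|w Kw]; first by rewrite !divr_ge0 // ltW.
rewrite snB -[X in modulus R X]/(psi (f w) - epolyA mf z r0 (epoly_map psi s) w).
rewrite epolyAE // ev_epoly_map -(linearB_fun (clin_linear psi)).
by rewrite (le_trans (hc' _)) // mulrC -ler_pdivlMr // hs2.
Qed.

End Integral.

Section CompactImage.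
Variables (f : A) (i : I).

(** The functions that vary no more than [f] does in the seminorm [p i]: they
    contain all [psi \o f] with [psi] bounded by [p i]. *)
Definition dominated : set F :=
  [set g : F | forall w, K w -> normc ((g : AC) w) <= p i (f w) /\
     forall v, K v -> normc ((g : AC) w - (g : AC) v) <= p i (f w - f v)].

Lemma comp_dominated psi : (forall y, normc (psi y) <= p i y) ->
  dominated (comp psi f).
Proof.
move=> h w Kw; split=> [|v Kv]; first exact: h.
by rewrite -[X in normc X]/(psi (f w) - psi (f v)) -(linearB_fun (clin_linear psi)).
Qed.

Let F_eval (a b : R[i]) (g h : F) w : ((a *: g + b *: h : F) : AC) w =
  a * (g : AC) w + b * (h : AC) w.
Proof.
rewrite -[LHS]/(dirac z r0 w (a *: g + b *: h)) (linearD_fun (clin_linear _)).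
by rewrite !(linearZ_fun (clin_linear _)).
Qed.

Lemma dominated_absolutely_convex : absolutely_convex dominated.
Proof.
move=> g h a b hg hh ab.
have {}ab : normc a + normc b <= 1.
  by move: ab; rewrite !normCE -rmorphD -[X in _ <= X]/(1%:C) lecR.
have conv (x y : R[i]) (m : R) : normc x <= m -> normc y <= m ->
    normc (a * x + b * y) <= m.
  move=> xm ym; have m0 : 0 <= m := le_trans (normc_ge0 _) xm.
  rewrite (le_trans (le_normcD _ _)) // !normcM.
  rewrite (le_trans (y := (normc a + normc b) * m)) //; last exact: ler_piMl.
  by rewrite mulrDl lerD // ler_wpM2l ?normc_ge0.
move=> w Kw; have [g1 g2] := hg w Kw; have [h1 h2] := hh w Kw; split.
  by rewrite F_eval; exact: (conv _ _ _ g1 h1).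
move=> v Kv; have := conv _ _ _ (g2 v Kv) (h2 v Kv).
by rewrite !F_eval !mulrBr opprD addrACA.
Qed.

Lemma fmap_ultra (T T' : Type) (h : T -> T') (G : set_system T) :
  UltraFilter G -> UltraFilter (h @ G).
Proof.
move=> UG; have PG : ProperFilter G by exact: ultra_proper.
split; first exact: fmap_proper_filter.
move=> H PH GH; apply/seteqP; split=> // X HX; have [//|GnX] := in_ultra_setVsetC (h @^-1` X) UG.
have HnX : H (~` X) by exact: GH.
by have [x []] := filter_ex (filterI HX HnX).
Qed.

Lemma bounded_ultra (G : set_system C) (M : R) : UltraFilter G ->
  G [set c | normc c <= M] -> exists l : C, forall e : R, 0 < e ->
  G [set c | normc (c - l) < e].
Proof.
move=> UG GM; pose M' := `|M| + 1.
have M'0 : 0 < M' by rewrite ltr_wpDl.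
pose X := (fun w : 'rV[C]_1 => w 0 0) @` cpolydisc 0 (fun _ => M') 1.
have cX : compact X.
  apply: continuous_compact; last by apply: compact_cpolydisc.
  by apply: continuous_subspaceT => w; exact: coord_continuous.
have GX : G X.
  apply: filterS GM => c /= cM; exists (const_mx c); last by rewrite mxE.
  move=> k; rewrite !mxE subr0 mul1r (le_trans cM) // (le_trans (ler_norm _)) //.
  by rewrite lerDl.
move: cX; rewrite compact_ultra => /(_ G UG GX)[l [_ hl]].
exists l => e e0; apply: hl; apply/nbhs_complexP.
by exists e; split.
Qed.

(** Arzela-Ascoli, with ultrafilters; the pointwise limit is uniform because
    the functions are as equicontinuous as [f] is continuous. *)
Lemma compact_dominated : compact dominated.
Proof.
rewrite compact_ultra => G UG GD; have PG : ProperFilter G by exact: ultra_proper.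
have /choice[g0 hg0] : forall w, exists l : C, K w -> forall e : R, 0 < e ->
    G [set g : F | normc ((g : AC) w - l) < e].
  move=> w; have [Kw|nKw] := pselect (K w); last by exists 0.
  have UGw : UltraFilter ((fun g : F => (g : AC) w : C) @ G) by exact: fmap_ultra.
  have [|l hl] := @bounded_ultra _ (p i (f w)) UGw; last by exists l => _.
  by apply: (@filterS _ G _ dominated) => // g hg; have [] := hg w Kw.
pose g := restrict z r (g0 : Cd -> C).
have hg w : K w -> forall e : R, 0 < e -> G [set h : F | normc ((h : AC) w - g w) < e].
  by move=> Kw; rewrite /g restrictE //; exact: hg0.
have gdom w : K w -> normc (g w) <= p i (f w) /\
    forall v, K v -> normc (g w - g v) <= p i (f w - f v).
  move=> Kw; split=> [|v Kv]; apply/ler_addgt0Pr => e e0.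
    have [h [h1 h2]] := filter_ex (filterI GD (hg w Kw e e0)).
    have -> : g w = (h : AC) w + (g w - (h : AC) w) by rewrite addrC subrK.
    rewrite (le_trans (le_normcD _ _)) // lerD //; first by have [] := h1 w Kw.
    by rewrite -normcN opprB ltW.
  have e2 : 0 < e / 2 by rewrite divr_gt0.
  have [h [[h1 h2] h3]] := filter_ex (filterI (filterI GD (hg w Kw _ e2)) (hg v Kv _ e2)).
  have -> : g w - g v = ((h : AC) w - (h : AC) v) +
    ((g w - (h : AC) w) + ((h : AC) v - g v)) by ring.
  rewrite (le_trans (le_normcD _ _)) // lerD //; first by have [_] := h1 w Kw; exact.
  rewrite (le_trans (le_normcD _ _)) // (splitr e) lerD //; last exact: ltW.
  by rewrite -normcN opprB ltW.
have unif (e : R) : 0 < e -> G [set h : F | forall w, K w -> normc ((h : AC) w - g w) <= e].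
  move=> e0; have e3 : 0 < e / 3 by rewrite divr_gt0.
  have /compact_near_coveringP cK := compact_cpolydisc (z := z) r0 ltr01.
  pose Q (h : F) (w : Cd) := K w -> normc ((h : AC) w - g w) <= e.
  suff : G [set h | K `<=` Q h] by apply: filterS => h hh w Kw; exact: hh.
  apply: (cK F G Q _) => w Kw.
  have [dl [dl0 hd]] := A_uniformly_continuous r0 (p i) (A_fun_in f) e3.
  exists ([set v : Cd | forall k, normc (v 0 k - w 0 k) < dl],
    dominated `&` [set h : F | normc ((h : AC) w - g w) < e / 3]).
    by split; [apply/nbhs_rowP; exists dl|exact: filterI GD (hg w Kw _ e3)].
  move=> [v h] /= [hv [h1 h2]] Kv; have pv := hd v w Kv Kw hv.
  have -> : (h : AC) v - g v = ((h : AC) v - (h : AC) w) +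
    (((h : AC) w - g w) + (g w - g v)) by ring.
  have [_ /(_ w Kw) h3] := h1 v Kv; have [_ /(_ v Kv) h4] := gdom w Kw.
  rewrite snB in h4.
  rewrite (le_trans (le_normcD _ _)) // (le_trans (lerD (lexx _) (le_normcD _ _))) //.
  by move: pv h2 h3 h4; lra.
have gA : g \in A_pred z r C.
  apply: (uniform_limit_in_A hC mf (@complex_complete R) r0); last by move=> w; exact: restrict0.
  move=> j e e0; have e2 : 0 < e / 2 by rewrite divr_gt0.
  have [h hh] := filter_ex (unif _ e2).
  have [s hs] := A_polynomial_interpolation hC mf r0 (modulus R) (A_fun_in (h : AC)) e2.
  exists s => w Kw; rewrite (le_trans (sn_triangle (modulus R) ((h : AC) w) _ _)) //.
  by rewrite (splitr e) lerD ?hs // snB; exact: hh.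
exists (ACarrier gA : F); split; first exact: gdom.
move=> U /(nbhs_A_spaceP mf r0)[[] [e [e0 hU]]].
have e2 : 0 < e / 2 by rewrite divr_gt0.
apply: filterS (unif _ e2) => h hh; apply: hU.
apply: (@le_lt_trans _ _ (e / 2)); last by rewrite ltr_pdivrMr // ltr_pMr // ltr1n.
by apply: (A_sn_le r0 (ltW e2)) => w Kw; exact: (hh w Kw).
Qed.

End CompactImage.

End EpsilonProduct.

Lemma clin_eval_lin (R : realType) (X Y : tvsType R[i]) (a : R[i])
  (T S : clin X Y) (x : X) : (a *: T + S) x = a *: T x + S x.
Proof. by []. Qed.

Lemma clin_eval_sum (R : realType) (X Y : tvsType R[i]) (J : Type) (s : seq J)
  (T : J -> clin X Y) (x : X) : (\sum_(t <- s) T t) x = \sum_(t <- s) T t x.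
Proof. by elim/big_rec2: _ => // t u v _ <-. Qed.

Section Isomorphism.
Variables (R : realType) (d : nat).
Local Notation C := R[i]^o.
Local Notation MP := (mpoly d R[i]).
Local Notation Cd := 'rV[C]_d.
Variables (z : Cd) (r : 'I_d -> R).
Hypothesis r0 : forall k, 0 < r k.
Local Notation K := (cpolydisc z r 1).
Local Notation F := (A_scalar z r).
Local Notation AC := (A_carrier z r C).
Local Notation hC := (@complex_hausdorff R).
Local Notation mf := (modulus_fundamental R).
Local Notation nrm := (A_sn z r (modulus R)).
Local Notation Ff := (F_csn_fundamental z r0).
Variables (E : tvsType R[i]).
Hypothesis hE : hausdorff_space E.
Variables (I : Type) (p : I -> cseminorm E).
Hypothesis pf : directed_fundamental p.
Hypothesis cE : tvs_complete E.
Local Notation A := (A_carrier z r E).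
Local Notation cmp := (comp r0 hE pf).
Implicit Types (f : A) (phi : clin F C) (psi : clin E C).

Definition pairing f phi : E := sval (cid (integral_exists r0 hE pf phi f cE)).

Lemma pairingE f phi psi : psi (pairing f phi) = phi (cmp psi f).
Proof. exact: (svalP (cid (integral_exists r0 hE pf phi f cE))). Qed.

Lemma pairing_sn f phi i : exists psi, (forall y, normc (psi y) <= p i y) /\
  p i (pairing f phi) = normc (phi (cmp psi f)).
Proof.
have [psi [ple px]] := norming_functional (p i) (pairing f phi).
by exists psi; rewrite -px pairingE.
Qed.

Lemma pairing_linear f : linear (pairing f : clin F C -> E).
Proof.
move=> a phi phi'; apply: (functionals_separate hE pf) => psi.
by rewrite (clin_linear psi) !pairingE clin_eval_lin.
Qed.

Lemma dominated_acc f i : @acc R F (dominated p f i).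
Proof.
by split; [exact: dominated_absolutely_convex|exact: compact_dominated].
Qed.

Definition dominated_index f i : set_type (@acc R F) :=
  SigSub (mem_set (dominated_acc f i)).

(** By [pairing_sn] the seminorm of [pairing f phi] is the modulus of [phi] at a
    point of the compact set of functions dominated by [f]. *)
Lemma pairing_continuous f : continuous (pairing f : dual_kappa F -> E).
Proof.
apply: (@linear_continuous_from_lcs R _ _ (clin_sn (@acc_bounded R F)) E I p pf).
  exact: (pairing_linear f).
move=> i; exists (dominated_index f i, modulus R) => phi.
have [psi [ple ->]] := pairing_sn f phi i.
have [M hM] := clin_ev_bounded (@acc_bounded R F) (dominated_index f i) (modulus R) phi.
apply: (sup_fun_ub (ev := fun (x : F) (T : clin F C) => T x) hM).
exact: (comp_dominated r0 hE pf f ple).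
Qed.

Lemma pairing_clin f : (pairing f : dual_kappa F -> E) \in @clin_pred R (dual_kappa F) E.
Proof.
by apply/asboolP; split; [exact: (pairing_linear f)|exact: pairing_continuous].
Qed.

Definition to_eps (f : A_space z r p) : eps_product F E := Clin (pairing_clin f).

Lemma to_eps_linear : linear to_eps.
Proof.
move=> a f g; apply: val_inj; apply/funext => phi.
change (pairing (a *: (f : A) + (g : A)) phi = a *: pairing f phi + pairing g phi).
apply: (functionals_separate hE pf) => psi.
by rewrite (clin_linear psi) !pairingE (comp_linear r0 hE pf psi) (clin_linear phi).
Qed.

Lemma to_eps_continuous : continuous to_eps.
Proof.
apply: (@linear_continuous_to_lcs R (A_space z r p) I (A_csn z r0 pf)
  _ _ (@clin_sn R (dual_kappa F) E (@equicont R F) (@equicont_bounded R F)) to_eps to_eps_linear).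
move=> [H q]; have [i [c [c0 hc]]] := fund_dom_csn pf q.
have [[] [c' [c'0 hc']]] := equicont_bound Ff (set_valP H).
exists i, (c * c') => f; apply: sup_fun_le => [|phi Hphi].
  by rewrite mulr_ge0 ?sn_ge0 // mulr_ge0 // ltW.
apply: (le_trans (hc (pairing f phi))); rewrite -mulrA ler_wpM2l ?(ltW c0) //.
have [psi [ple ->]] := pairing_sn f phi i.
apply: (le_trans (hc' _ Hphi _)); rewrite ler_wpM2l ?(ltW c'0) //.
exact: (comp_norm r0 hE pf).
Qed.

(** Continuity on the dual with the topology of uniform convergence on compact
    sets, measured by a single compact set. *)
Lemma dual_continuity (u : clin (dual_kappa F) E) i (e : R) : 0 < e ->
  exists (B : set F) (dl : R), [/\ compact B, 0 < dl &
  forall phi, (forall b : F, B b -> normc (phi b) <= dl) -> p i (u phi) <= e].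
Proof.
move=> e0; have := @clin_continuous _ _ _ u 0 _ (csn_ball (p i) (u 0) e0).
move=> [s [e' [e'0 hs]]].
suff [B [c [cB c0 hB]]] : exists (B : set F) (c : R), [/\ compact B, 0 < c &
    forall phi (t : R), 0 <= t -> (forall b : F, B b -> normc (phi b) <= t) ->
    all (fun j => clin_sn (@acc_bounded R F) j phi <= c * t) s].
  exists B, (e' / c / 2); split=> //; first by rewrite !divr_gt0.
  move=> phi hphi; have u0 : u 0 = 0 by exact: (linear_fun0 (clin_linear u)).
  suff : p i (u phi - u 0) < e by rewrite u0 subr0 => /ltW.
  apply: (hs phi); rewrite /lcs_ball /=.
  have e2 : 0 <= e' / c / 2 by rewrite !divr_ge0 // ltW.
  have := hB phi _ e2 hphi; apply: sub_all => j; rewrite subr0 => /le_lt_trans; apply.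
  have -> : c * (e' / c / 2) = e' / 2 by field; rewrite gt_eqF.
  by rewrite ltr_pdivrMr // ltr_pMr // ltr1n.
elim: s {hs} => [|[L q] s [B [c [cB c0 hc]]]].
  by exists set0, 1; split => //; exact: compact0.
have [_ cL] := set_valP L.
have [[] [c' [c'0 hc']]] := fund_dom_csn mf q.
exists (val L `|` B), (c + c'); split; [exact: compactU|exact: addr_gt0|].
move=> phi t t0 ht /=; apply/andP; split.
  apply: sup_fun_le => [|x /= Lx]; first by rewrite mulr_ge0 // addr_ge0 // ltW.
  apply: (le_trans (hc' (phi x))); rewrite mulrDl (le_trans (y := c' * t)) //.
    by rewrite ler_wpM2l ?(ltW c'0) //; apply: ht; left.
  by rewrite lerDr mulr_ge0 // ltW.
apply: sub_all (hc phi t t0 _) => [j /le_trans|b Bb]; last by apply: ht; right.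
by apply; rewrite mulrDl lerDl mulr_ge0 // ltW.
Qed.

(** Point evaluations are approximated by their interpolations, uniformly on
    compact sets; applying [u] yields vector-valued polynomials. *)
Lemma eps_interpolation (u : clin (dual_kappa F) E) i (e : R) (c : R) :
  0 < e -> 0 < c -> exists s : seq (MP * Cd),
  (forall w, K w -> p i (u (dirac z r0 w) -
     \sum_(t <- s) t.1.@[w 0] *: u (dirac z r0 t.2)) <= e) /\
  forall phi, (forall g : AC, normc (phi g) <= c * nrm g) ->
    p i (u phi - \sum_(t <- s) phi (poly_scalar z r0 t.1) *: u (dirac z r0 t.2)) <= e.
Proof.
move=> e0 c0; have [B [dl [cB dl0 hB]]] := dual_continuity u i e0.
have c1 : 0 < c + 1 by rewrite ltr_wpDr.
have dlc : 0 < dl / (c + 1) by rewrite divr_gt0.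
have [s [_ hs]] := compact_interp r0 cB dlc.
have dlc' : dl / (c + 1) <= dl.
  by rewrite ler_pdivrMr // ler_peMr ?(ltW dl0) // lerDr ltW.
have usum (a : MP * Cd -> R[i]) :
    \sum_(t <- s) a t *: u (dirac z r0 t.2) = u (\sum_(t <- s) a t *: dirac z r0 t.2).
  rewrite [RHS](linear_sum_fun (clin_linear u)); apply: eq_bigr => t _.
  by rewrite (linearZ_fun (clin_linear u)).
have evsum (a : MP * Cd -> R[i]) (chi : clin F C) (b : F) :
    (chi - \sum_(t <- s) a t *: dirac z r0 t.2) b =
    chi b - \sum_(t <- s) a t * (b : AC) t.2.
  rewrite -scaleN1r addrC clin_eval_lin scaleN1r addrC; congr (_ - _).
  by rewrite clin_eval_sum.
exists s; split => [w Kw|phi hphi].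
  rewrite usum -(linearB_fun (clin_linear u)); apply: hB => b Bb.
  rewrite evsum; apply: le_trans dlc'; apply: le_trans (hs b Bb).
  apply: le_trans (A_sn_ub r0 (modulus R) _ Kw).
  rewrite -[X in modulus R X]/((b : AC) w - interp r0 s b w).
  by rewrite interpE.
rewrite usum -(linearB_fun (clin_linear u)); apply: hB => b Bb.
rewrite evsum; have -> : phi b - \sum_(t <- s) phi (poly_scalar z r0 t.1) * (b : AC) t.2 =
    phi ((b : AC) - interp r0 s b : AC).
  rewrite [RHS](linearB_fun (clin_linear phi)); congr (_ - _).
  rewrite /interp (linear_sum_fun (clin_linear phi)); apply: eq_bigr => t _.
  by rewrite (linearZ_fun (clin_linear phi)); exact: mulrC.
rewrite (le_trans (hphi _)) // (le_trans (ler_wpM2l (ltW c0) (hs b Bb))) //.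
by rewrite mulrA ler_pdivrMr // mulrC ler_wpM2l ?(ltW dl0) // lerDl.
Qed.

Definition eps_fun (u : clin (dual_kappa F) E) : Cd -> E :=
  restrict z r (fun w => u (dirac z r0 w)).

Lemma eps_fun_in_A u : eps_fun u \in A_pred z r E.
Proof.
apply: (uniform_limit_in_A hE pf cE r0); last by move=> w; exact: restrict0.
move=> i e e0; have [s [hs _]] := eps_interpolation u i e0 ltr01.
exists [seq (t.1, u (dirac z r0 t.2)) | t <- s] => w Kw.
by rewrite /eps_fun restrictE // /ev big_map; exact: hs.
Qed.

Definition from_eps (u : eps_product F E) : A_space z r p := ACarrier (eps_fun_in_A u).

Lemma from_epsE (u : eps_product F E) w : K w ->
  (from_eps u : A) w = (u : clin (dual_kappa F) E) (dirac z r0 w).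
Proof. exact: restrictE. Qed.

Lemma from_eps_linear : linear from_eps.
Proof.
move=> a u v; apply: (A_ext r0) => w Kw.
change (eps_fun (a *: (u : clin (dual_kappa F) E) + (v : clin (dual_kappa F) E)) w =
  a *: eps_fun u w + eps_fun v w).
by rewrite /eps_fun !restrictE.
Qed.

Lemma dirac_equicont : equicont [set dirac z r0 w | w in K].
Proof.
apply: (@equicont_intro R F (F_csn z r0 tt)) => _ [w Kw <-] g.
exact: (A_sn_ub r0 (modulus R) g Kw).
Qed.

Lemma from_eps_continuous : continuous from_eps.
Proof.
apply: (@linear_continuous_from_lcs R _ _ (@clin_sn R (dual_kappa F) E (@equicont R F) (@equicont_bounded R F))
  (A_space z r p) I (A_csn z r0 pf) (A_csn_fundamental z r0 pf) from_eps from_eps_linear).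
move=> i; exists (SigSub (mem_set dirac_equicont), p i) => u.
have [M hM] := @clin_ev_bounded R (dual_kappa F) E (@equicont R F) (@equicont_bounded R F) (SigSub (mem_set dirac_equicont)) (p i) u.
have ub := sup_fun_ub (ev := fun x (T : clin (dual_kappa F) E) => T x) hM.
apply: (A_sn_le r0) => [|w Kw]; first exact: sn_ge0.
by rewrite (from_epsE u Kw); apply: ub; exists w.
Qed.

Lemma to_epsK : cancel to_eps from_eps.
Proof.
move=> f; apply: (A_ext r0) => w Kw; rewrite from_epsE //.
apply: (functionals_separate hE pf) => psi.
exact: (pairingE f (dirac z r0 w) psi).
Qed.

(** Both sides agree on combinations of point evaluations, and these approximate
    [phi] uniformly on compact sets. *)
Lemma from_epsK : cancel from_eps to_eps.
Proof.
move=> u; apply: val_inj; apply/funext => phi.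
change (pairing (from_eps u) phi = (u : clin (dual_kappa F) E) phi).
apply: (functionals_separate hE pf) => psi; rewrite pairingE.
apply: (fund_sep mf hC) => _ e e0 /=.
have [i [c [c0 hc]]] := functional_bound pf psi.
have [[] [c' [c'0 hc']]] := functional_bound Ff phi.
pose eta := e / (c' * c + c).
have cc : 0 < c' * c + c by rewrite addr_gt0 // mulr_gt0.
have eta0 : 0 < eta by rewrite divr_gt0.
have [s [hs1 hs2]] := eps_interpolation u i eta0 c'0.
pose g : AC := \sum_(t <- s) psi (u (dirac z r0 t.2)) *: poly_scalar z r0 t.1.
have gphi : phi g = psi (\sum_(t <- s) phi (poly_scalar z r0 t.1) *: u (dirac z r0 t.2)).
  rewrite (linear_sum_fun (clin_linear psi)) (linear_sum_fun (clin_linear phi)).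
  apply: eq_bigr => t _; rewrite (linearZ_fun (clin_linear psi)).
  by rewrite (linearZ_fun (clin_linear phi)); exact: mulrC.
have -> : phi (cmp psi (from_eps u)) - psi (u phi) =
    (phi (cmp psi (from_eps u)) - phi g) + (phi g - psi (u phi)) by rewrite subrKA.
rewrite (le_trans (le_normcD _ _)) //.
have -> : e = c' * (c * eta) + c * eta by rewrite /eta; field; rewrite gt_eqF.
rewrite lerD //; last first.
  rewrite gphi -(linearB_fun (clin_linear psi)) (le_trans (hc _)) //.
  by rewrite ler_wpM2l ?(ltW c0) // snB; exact: hs2.
rewrite -(linearB_fun (clin_linear phi)) (le_trans (hc' _)) // ler_wpM2l ?(ltW c'0) //.
apply: (A_sn_le r0) => [|w Kw]; first by rewrite mulr_ge0 // ltW.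
have gw : g w = psi (\sum_(t <- s) t.1.@[w 0] *: u (dirac z r0 t.2)).
  rewrite /g (big_morph (fun g : AC => g w) (id1 := 0) (op1 := +%R)) //.
  rewrite (linear_sum_fun (clin_linear psi)); apply: eq_bigr => t _.
  rewrite (linearZ_fun (clin_linear psi)) -(poly_scalarE r0 _ Kw).
  exact: (mulrC (psi (u (dirac z r0 t.2))) (poly_scalar z r0 t.1 w)).
rewrite -[X in modulus R X]/(psi ((from_eps u : A) w) - g w) gw.
rewrite from_epsE // -(linearB_fun (clin_linear psi)) (le_trans (hc _)) //.
by rewrite ler_wpM2l ?(ltW c0) // hs1.
Qed.

Lemma A_space_eps_product :
  topologically_isomorphic (A_space z r p) (eps_product F E).
Proof.
exists (mk_linear to_eps_linear), (mk_linear from_eps_linear).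
split; [exact: to_epsK|exact: from_epsK|exact: to_eps_continuous|].
exact: from_eps_continuous.
Qed.

End Isomorphism.

(** * Completions *)

Section CompletionUniqueness.
Variable R : realType.

Section OneSide.
Variables (X W1 W2 : tvsType R[i]).
Variables (j1 : {linear X -> W1}) (j2 : {linear X -> W2}).
Hypotheses (c1 : is_completion j1) (c2 : is_completion j2).

(** [y] and [l] are the limits of one filter on [X]: the graph of the
    extension by continuity, in a form symmetric in the two completions. *)
Definition joint_limit (y : W1) (l : W2) := exists G : set_system X,
  [/\ ProperFilter G, j1 @ G --> y & j2 @ G --> l].

Lemma completion_continuous : continuous j2.
Proof.
case: c2 => _ _ _ emb _ x U hU.
have : nbhs x (j2 @^-1` U) by apply/emb; exists U.
exact.
Qed.

(** The traces on [X] of the neighbourhoods of [y] form a Cauchy filter. *)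
Lemma joint_limit_total y : exists l, joint_limit y l.
Proof.
have jc := completion_continuous; case: c1 => _ _ _ emb1 den1.
case: c2 => _ comp2 _ _ _.
pose G : set_system X := [set B : set X | exists2 V, nbhs y V & j1 @^-1` V `<=` B].
have PG : ProperFilter G.
  split.
    move=> [V Vy hV]; have [] := den1 (V°).
    - by exists y; exact: Vy.
    - exact: open_interior.
    by move=> v [/interior_subset Vv [x _ xv]]; apply: (hV x); rewrite /= xv.
  split.
  - by exists setT => //; exact: filterT.
  - move=> A B [V hV VA] [V' hV' VB]; exists (V `&` V'); first exact: filterI.
    by move=> x [/VA ? /VB ?].
  - by move=> A B AB [V hV VA]; exists V => //; exact: subset_trans AB.
have [|l hl] := @comp2 (j2 @ G) (fmap_proper_filter _ PG).
  move=> U U0; have U0' : nbhs (0 : X) (j2 @^-1` U).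
    by apply: (jc 0); rewrite linear0.
  have [V1 V10 hV1] := (emb1 _ _).1 U0'; rewrite linear0 in V10.
  have : nbhs ((0 : W1), (0 : W1)) [set u | V1 (u.1 - u.2)].
    by apply: sub_continuous; rewrite /= subrr.
  move=> [[B B'] /= [hB hB']] hBB.
  have BB0 : nbhs (0 : W1) (B `&` B') by exact: filterI.
  exists (j2 @` (j1 @^-1` [set v | (B `&` B') (v - y)])).
    exists [set v | (B `&` B') (v - y)]; last by move=> x hx; exists x.
    by rewrite -[y in nbhs y _]add0r nbhs_translate; move: BB0; apply: filterS => v /=; rewrite addrK.
  move=> _ _ [x [hx _] <-] [x' [_ hx'] <-]; rewrite -linearB; apply: hV1 => /=.
  have : V1 ((j1 x - y) - (j1 x' - y)) := hBB (j1 x - y, j1 x' - y) (conj hx hx').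
  by rewrite (linearB j1) opprB addrA subrK.
exists l, G; split => // V hV; exists V => //.
Qed.

Lemma joint_limit_lin (a : R[i]) y l y' l' : joint_limit y l -> joint_limit y' l' ->
  joint_limit (a *: y + y') (a *: l + l').
Proof.
move=> [G [PG G1 G2]] [H [PH H1 H2]].
exists ((fun u : X * X => a *: u.1 + u.2) @ filter_prod G H).
have FP : Filter (filter_prod G H) by exact: filter_prod_filter.
split; first exact: fmap_proper_filter.
- have h1 : (fun u : X * X => j1 u.1) @ filter_prod G H --> y.
    exact: (@cvg_comp _ _ _ (fun u : X * X => u.1) j1 (filter_prod G H) G _ cvg_fst G1).
  have h2 : (fun u : X * X => j1 u.2) @ filter_prod G H --> y'.
    exact: (@cvg_comp _ _ _ (fun u : X * X => u.2) j1 (filter_prod G H) H _ cvg_snd H1).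
  have := cvg_lincomb (a := a) FP h1 h2.
  suff -> : (fun u : X * X => a *: j1 u.1 + j1 u.2) =
      (fun u : X * X => j1 (a *: u.1 + u.2)) by [].
  by apply/funext => u; rewrite linearP.
- have h1 : (fun u : X * X => j2 u.1) @ filter_prod G H --> l.
    exact: (@cvg_comp _ _ _ (fun u : X * X => u.1) j2 (filter_prod G H) G _ cvg_fst G2).
  have h2 : (fun u : X * X => j2 u.2) @ filter_prod G H --> l'.
    exact: (@cvg_comp _ _ _ (fun u : X * X => u.2) j2 (filter_prod G H) H _ cvg_snd H2).
  have := cvg_lincomb (a := a) FP h1 h2.
  suff -> : (fun u : X * X => a *: j2 u.1 + j2 u.2) =
      (fun u : X * X => j2 (a *: u.1 + u.2)) by [].
  by apply/funext => u; rewrite linearP.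
Qed.

Lemma joint_limit0 l : joint_limit 0 l -> l = 0.
Proof.
have jc := completion_continuous; case: c1 => _ _ _ emb1 _; case: c2 => h2 _ _ _ _.
move=> [G [PG G1 G2]]; have G0 : G --> (0 : X).
  move=> U /emb1[V]; rewrite linear0 => /G1 GV VU; exact: (@filterS _ G _ _ _ VU GV).
have G2' : j2 @ G --> (0 : W2).
  move=> U U0; have : nbhs (0 : X) (j2 @^-1` U) by apply: (jc 0); rewrite linear0.
  exact: G0.
exact: (@cvg_unique _ h2 (j2 @ G) _ _ _ G2 G2').
Qed.

Lemma joint_limit_functional y l l' : joint_limit y l -> joint_limit y l' -> l = l'.
Proof.
move=> h h'; have := joint_limit_lin (-1) h h'; rewrite !scaleN1r addNr.
by move=> /joint_limit0/eqP; rewrite addrC subr_eq0 => /eqP.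
Qed.

(** If [y] is close to 0, so are the images under [j2] of the points whose images
    under [j1] are close to [y], and [g y] is a limit of such images. *)
Lemma joint_limit_continuous (g : W1 -> W2) : linear g ->
  (forall y, joint_limit y (g y)) -> continuous g.
Proof.
have jc := completion_continuous; case: c1 => _ _ _ emb1 _.
move=> gl hg; apply: (linear_continuous_at0 gl) => U U0.
have : nbhs ((0 : W2), (0 : W2)) [set u | U (u.1 + u.2)].
  by apply: add_continuous; rewrite /= addr0.
move=> [[B B'] /= [hB hB']] hBB.
have B0 : nbhs (0 : X) (j2 @^-1` B') by apply: (jc 0); rewrite linear0.
have [V1 V10 hV1] := (emb1 _ _).1 B0; rewrite linear0 in V10.
have := nbhs_interior V10; apply: filterS => y Vy.
have [G [PG G1 G2]] := hg y.
have GV : G (j1 @^-1` V1) by exact: G1.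
have GB : G [set x | B (g y - j2 x)].
  have : nbhs (g y) [set w | B (g y - w)].
    have := @sub_continuous W2 (g y, g y) B; rewrite /= subrr => /(_ hB).
    move=> [[D D'] /= [hD hD']] DD; apply: filterS hD' => w Dw.
    by apply: (DD (g y, w)); split => //=; exact: nbhs_singleton hD.
  exact: G2.
have [x [hx1 hx2]] := filter_ex (filterI GV GB).
rewrite /= -(subrK (j2 x) (g y)); apply: (hBB (_, _)); split => //=.
exact: hV1.
Qed.

End OneSide.

Lemma completion_unique (X W1 W2 : tvsType R[i])
    (j1 : {linear X -> W1}) (j2 : {linear X -> W2}) :
  is_completion j1 -> is_completion j2 -> topologically_isomorphic W1 W2.
Proof.
move=> c1 c2; have [g hg] := choice (joint_limit_total c1 c2).
have [h hh] := choice (joint_limit_total c2 c1).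
have sym y l : joint_limit j2 j1 y l -> joint_limit j1 j2 l y.
  by move=> [G [PG G1 G2]]; exists G.
have gl : linear g.
  move=> a x y; apply: (joint_limit_functional c1 c2 (hg _)).
  exact: joint_limit_lin.
have hl : linear h.
  move=> a x y; apply: (joint_limit_functional c2 c1 (hh _)).
  exact: joint_limit_lin.
exists (mk_linear gl), (mk_linear hl); split => [y|l||].
- apply: (joint_limit_functional c2 c1 (hh (g y))).
  by have [G [PG G1 G2]] := hg y; exists G.
- exact: (joint_limit_functional c1 c2 (hg (h l)) (sym _ _ (hh l))).
- exact: joint_limit_continuous gl hg.
- exact: joint_limit_continuous hl hh.
Qed.

Lemma topologically_isomorphic_sym (X Y : tvsType R[i]) :
  topologically_isomorphic X Y -> topologically_isomorphic Y X.
Proof. by move=> [f [g [fg gf fc gc]]]; exists g, f. Qed.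

Lemma topologically_isomorphic_trans (X Y Z : tvsType R[i]) :
  topologically_isomorphic X Y -> topologically_isomorphic Y Z ->
  topologically_isomorphic X Z.
Proof.
move=> [f [g [fg gf fc gc]]] [f' [g' [fg' gf' fc' gc']]].
exists (f' \o f : {linear X -> Z}), (g \o g' : {linear Z -> X}); split.
- by move=> x /=; rewrite fg' fg.
- by move=> x /=; rewrite gf gf'.
- by move=> x; apply: continuous_comp; [exact: fc|exact: fc'].
- by move=> x; apply: continuous_comp; [exact: gc'|exact: gc].
Qed.

End CompletionUniqueness.

(** Induction on the number of terms: either the first vector is a combination of
    the others and its term is merged into theirs, or its function vanishes. With
    all bilinear [b] in place of [\sum_(u <- s) b u.1 u.2], this says that a
    tensor is determined by the vector-valued function that it represents. *)
Lemma tensor_of_zero_function (R : realType) (T : Type) (F E : lmodType R[i])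
    (ev : F -> T -> R[i]) (ev_lin : forall w, linear (ev^~ w : F -> R[i]^o))
    (ev_inj : forall x, (forall w, ev x w = 0) -> x = 0)
    (b : F -> E -> R[i]^o) (bl : forall y, linear (b^~ y)) (br : forall x, linear (b x))
    (s : seq (F * E)) :
  (forall w, \sum_(u <- s) ev u.1 w *: u.2 = 0) -> \sum_(u <- s) b u.1 u.2 = 0.
Proof.
have [n] := ubnP (size s); elim: n s => // n ih [|[x y] s] /= sn hs.
  by rewrite big_nil.
have [[c [cs yc]]|ny] := pselect (exists c : seq ((F * E) * R[i]),
    [seq v.1 | v <- c] = s /\ y = \sum_(v <- c) v.2 *: v.1.2).
  pose s' := [seq (v.1.1 + v.2 *: x, v.1.2) | v <- c].
  have ss : size s' = size s by rewrite -cs !size_map.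
  have : \sum_(u <- s') b u.1 u.2 = 0.
    apply: ih => [|w]; first by rewrite ss -ltnS.
    have := hs w; rewrite big_cons /= -cs !big_map yc /= scaler_sumr -big_split /=.
    move=> h; rewrite -[RHS]h; apply: eq_bigr => v _.
    have -> : ev (v.1.1 + v.2 *: x) w = ev v.1.1 w + v.2 * ev x w.
      rewrite (linearD_fun (ev_lin w)); congr (_ + _).
      exact: (linearZ_fun (ev_lin w)).
    by rewrite scalerDl scalerA addrC mulrC.
  move=> h; rewrite big_cons /= -cs big_map -[RHS]h /s' big_map /= yc.
  rewrite (linear_sum_fun (br x)) -big_split /=; apply: eq_bigr => v _.
  rewrite (linearD_fun (bl _)) (linearZ_fun (bl _)) (linearZ_fun (br x)).
  by rewrite addrC.
have x0 : x = 0.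
  apply: ev_inj => w; apply/eqP/contraT => xw; case: ny.
  exists [seq (u, - (ev u.1 w / ev x w)) | u <- s]; split.
    by rewrite -map_comp map_id_in.
  have := hs w; rewrite big_cons /= addrC => /eqP; rewrite addr_eq0 => /eqP h.
  rewrite big_map /= (eq_bigr (fun u => - (ev x w)^-1 *: (ev u.1 w *: u.2))).
    by rewrite -scaler_sumr h scaleNr scalerN opprK scalerA mulVf // scale1r.
  by move=> u _; rewrite scalerA mulNr mulrC.
rewrite big_cons x0 /= (linear_fun0 (bl y)) add0r; apply: ih => // w.
by have := hs w; rewrite big_cons /= x0 (linear_fun0 (ev_lin w)) scale0r add0r.
Qed.

Section TensorCompletion.
Variables (R : realType) (d : nat).
Local Notation C := R[i]^o.
Local Notation MP := (mpoly d R[i]).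
Local Notation Cd := 'rV[C]_d.
Variables (z : Cd) (r : 'I_d -> R).
Hypothesis r0 : forall k, 0 < r k.
Local Notation K := (cpolydisc z r 1).
Local Notation F := (A_scalar z r).
Local Notation AC := (A_carrier z r C).
Local Notation hC := (@complex_hausdorff R).
Local Notation mf := (modulus_fundamental R).
Local Notation nrm := (A_sn z r (modulus R)).
Local Notation Ff := (F_csn_fundamental z r0).
Variables (E : tvsType R[i]).
Hypothesis hE : hausdorff_space E.
Variables (I : Type) (p : I -> cseminorm E).
Hypothesis pf : directed_fundamental p.
Hypothesis cE : tvs_complete E.
Local Notation A := (A_carrier z r E).
Local Notation cmp := (comp r0 hE pf).
Implicit Types (f : A) (phi : clin F C) (psi : clin E C) (t : tensor F E).

Lemma elementary_in_A (x : AC) (y : E) : (fun w => x w *: y) \in A_pred z r E.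
Proof.
apply: (uniform_limit_in_A hE pf cE r0) => [i e e0|w Kw]; last first.
  by rewrite (A_fun_out r0 x Kw) scale0r.
have y1 : 0 < p i y + 1 by rewrite ltr_wpDl // sn_ge0.
have [s hs] := A_polynomial_interpolation hC mf r0 (modulus R) (A_fun_in x) (divr_gt0 e0 y1).
exists [seq (v.1, v.2 *: y) | v <- s] => w Kw.
have -> : ev [seq (v.1, v.2 *: y) | v <- s] w = ev s w *: y.
  rewrite /ev big_map scaler_suml; apply: eq_bigr => t _.
  by rewrite scalerA.
rewrite -scalerBl snZ (le_trans (ler_wpM2r (sn_ge0 _ _) (hs w Kw))) //.
by rewrite mulrAC ler_pdivrMr // ler_wpM2l ?(ltW e0) // lerDl.
Qed.

Lemma tensor_function_exists t : exists f : A, forall w psi,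
  psi (f w) = t (bilin_tensor (dirac z r0 w) psi).
Proof.
case: t => t /= /asboolP[s ->].
exists (\sum_(u <- s) (ACarrier (elementary_in_A u.1 u.2) : A)) => w psi.
rewrite (big_morph (fun g : A => g w) (id1 := 0) (op1 := +%R)) //.
rewrite (linear_sum_fun (clin_linear psi)); apply: eq_bigr => u _ /=.
exact: (linearZ_fun (clin_linear psi)).
Qed.

Definition tensor_function t : A := sval (cid (tensor_function_exists t)).

Lemma tensor_functionE t w psi :
  psi (tensor_function t w) = t (bilin_tensor (dirac z r0 w) psi).
Proof. exact: (svalP (cid (tensor_function_exists t))). Qed.

Lemma tensor_pairing t phi psi :
  t (bilin_tensor phi psi) = phi (cmp psi (tensor_function t)).
Proof.
have tE : forall w, psi (tensor_function t w) = t (bilin_tensor (dirac z r0 w) psi).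
  by move=> w; exact: tensor_functionE.
have [s ts] : exists s : seq (F * E), forall b, t b = \sum_(u <- s) b u.1 u.2.
  by case: t {tE} => t /= /asboolP[s ->]; exists s.
have -> : cmp psi (tensor_function t) = \sum_(u <- s) psi u.2 *: (u.1 : AC).
  apply: (A_ext r0) => w Kw; rewrite -[LHS]/(psi (tensor_function t w)) tE ts.
  rewrite (big_morph (fun g : AC => g w) (id1 := 0) (op1 := +%R)) //.
  by apply: eq_bigr => u _; exact: (mulrC ((u.1 : AC) w) (psi u.2)).
rewrite ts (linear_sum_fun (clin_linear phi)); apply: eq_bigr => u _.
by rewrite (linearZ_fun (clin_linear phi)); exact: (mulrC (phi u.1) (psi u.2)).
Qed.

Lemma tensor_function_linear :
  linear (tensor_function : inj_tensor F E -> A_space z r p).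
Proof.
move=> a t u; apply: (A_ext r0) => w Kw.
change (tensor_function (a *: (t : tensor F E) + (u : tensor F E)) w =
  a *: tensor_function t w + tensor_function u w).
apply: (functionals_separate hE pf) => psi.
by rewrite (clin_linear psi) !tensor_functionE.
Qed.

Lemma tensor_function_injective : injective tensor_function.
Proof.
move=> t u tu; apply/eqP; rewrite -subr_eq0; apply/eqP.
have h0 : tensor_function (t - u) = 0.
  by rewrite (linearB_fun tensor_function_linear) tu subrr.
move: (t - u) h0 => {tu} {t} {u} t t0.
have [s ts] : exists s : seq (F * E), forall b, t b = \sum_(u <- s) b u.1 u.2.
  by case: t {t0} => t /= /asboolP[s ->]; exists s.
apply: val_inj; apply/funext => b; rewrite -[LHS]/(t b) ts.
have ev_lin w : linear ((fun x : F => dirac z r0 w x) : F -> R[i]^o).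
  exact: (clin_linear (dirac z r0 w)).
have ev_inj (x : F) : (forall w, dirac z r0 w x = 0) -> x = 0.
  by move=> hx; apply: (A_ext r0) => w _; exact: hx.
apply: (tensor_of_zero_function ev_lin ev_inj (bilin_l b) (bilin_r b)).
move=> w; apply: (functionals_separate hE pf) => psi.
rewrite (linear_fun0 (clin_linear psi)) (linear_sum_fun (clin_linear psi)).
transitivity (t (bilin_tensor (dirac z r0 w) psi)); last first.
  by rewrite -tensor_functionE t0; exact: (linear_fun0 (clin_linear psi)).
by rewrite ts; apply: eq_bigr => u _; exact: (linearZ_fun (clin_linear psi)).
Qed.

Lemma polar_equicont i : equicont [set psi | forall y, normc (psi y) <= p i y].
Proof. exact: (@equicont_intro R E (p i)). Qed.

(** The seminorm [p i] at a point is the supremum over its polar, and point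
    evaluations are equicontinuous. *)
Lemma tensor_function_continuous :
  continuous (tensor_function : inj_tensor F E -> A_space z r p).
Proof.
apply: (@linear_continuous_from_lcs R _ _ (@tensor_sn R F E) (A_space z r p) I
  (A_csn z r0 pf) (A_csn_fundamental z r0 pf) _ tensor_function_linear) => i.
exists (SigSub (mem_set (dirac_equicont r0)), SigSub (mem_set (polar_equicont i))) => t.
have [M hM] := tensor_ev_bounded
  (SigSub (mem_set (dirac_equicont r0)), SigSub (mem_set (polar_equicont i))) t.
have ub := sup_fun_ub (ev := fun fg (t : tensor F E) => t (bilin_tensor fg.1 fg.2)) hM.
apply: (A_sn_le r0) => [|w Kw]; first exact: sn_ge0.
have [psi [ple <-]] := norming_functional (p i) (tensor_function t w).
rewrite tensor_functionE; apply: (ub (dirac z r0 w, psi)).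
by split => //=; exists w.
Qed.

(** Conversely, equicontinuous functionals on the scalar functions are bounded by a
    multiple of the supremum of point evaluations. *)
Lemma tensor_sn_bound HG : exists i (c : R), 0 <= c /\ forall t,
  tensor_sn HG t <= c * A_sn z r (p i) (tensor_function t).
Proof.
case: HG => H G; have [[] [c [c0 hc]]] := equicont_bound Ff (set_valP H).
have [i [c' [c'0 hc']]] := equicont_bound pf (set_valP G).
exists i, (c * c'); split=> [|t]; first by rewrite mulr_ge0 ?(ltW c0) ?(ltW c'0).
apply: sup_fun_le => [|[phi psi] [/= Hphi Gpsi]].
  by rewrite mulr_ge0 ?sn_ge0 // mulr_ge0 // ltW.
rewrite tensor_pairing (le_trans (hc _ Hphi _)) // -mulrA ler_wpM2l ?(ltW c0) //.
apply: (A_sn_le r0) => [|w Kw].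
  by apply: mulr_ge0; [exact: ltW|exact: (sn_ge0 (A_sn z r (p i)))].
apply: (le_trans (hc' _ Gpsi _)); rewrite ler_wpM2l ?(ltW c'0) //.
exact: (A_sn_ub r0 (p i) _ Kw).
Qed.

Lemma tensor_function_embedding (t : inj_tensor F E) (U : set (inj_tensor F E)) :
  nbhs t U <-> exists2 V : set (A_space z r p),
    nbhs (tensor_function t : A_space z r p) V & tensor_function @^-1` V `<=` U.
Proof.
split; last first.
  move=> [V Vt VU].
  have hV : nbhs t ((tensor_function : inj_tensor F E -> A) @^-1` V).
    exact: (@tensor_function_continuous t V Vt).
  exact: filterS VU hV.
move=> [s [e [e0 hU]]].
suff [V hV hs] : exists2 V : set (A_space z r p), nbhs (tensor_function t : A_space z r p) V &
    forall u, V (tensor_function u) -> lcs_ball (@tensor_sn R F E) s e t u.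
  by exists V => // u /hs /hU.
elim: s {hU} => [|HG s [V hV ih]]; first by exists setT => //; exact: filterT.
have [i [c [c0 hc]]] := tensor_sn_bound HG.
have c1 : 0 < c + 1 by rewrite ltr_wpDl.
exists ([set g | A_sn z r (p i) (g - tensor_function t) < e / (c + 1)] `&` V).
  apply: filterI => //; apply/(nbhs_A_spaceP pf r0).
  by exists i, (e / (c + 1)); split => //; rewrite divr_gt0.
move=> u [h1 /ih h2]; rewrite /lcs_ball /=; apply/andP; split; last exact: h2.
apply: (le_lt_trans (hc _)); rewrite (linearB_fun tensor_function_linear).
apply: le_lt_trans (_ : (c + 1) * A_sn z r (p i) (tensor_function u - tensor_function t) < e).
  by rewrite ler_wpM2r ?sn_ge0 // lerDl.
by rewrite mulrC -ltr_pdivlMr.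
Qed.

Lemma epoly_tensor_subproof (s : epoly d E) :
  (fun b : bilin F E => \sum_(u <- [seq (poly_scalar z r0 v.1 : F, v.2) | v <- s])
     b u.1 u.2) \in @tensor_pred R F E.
Proof. by apply/asboolP; exists [seq (poly_scalar z r0 v.1 : F, v.2) | v <- s]. Qed.

Lemma tensor_function_epoly (s : epoly d E) :
  tensor_function (Tensor (epoly_tensor_subproof s)) = epolyA pf z r0 s.
Proof.
apply: (A_ext r0) => w Kw; apply: (functionals_separate hE pf) => psi.
rewrite tensor_functionE epolyAE // /ev /= big_map (linear_sum_fun (clin_linear psi)).
apply: eq_bigr => t _; rewrite (linearZ_fun (clin_linear psi)).
by rewrite -(poly_scalarE r0 _ Kw).
Qed.

Lemma tensor_function_completion : is_completion (mk_linear tensor_function_linear).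
Proof.
split; [exact: A_space_hausdorff|exact: A_space_complete|
  exact: tensor_function_injective|exact: tensor_function_embedding|].
move=> O O0 oO; have [f [Of /(poly_tensorP z r0)[s fs]]] := poly_tensor_dense hE pf r0 O0 oO.
exists f; split => //; exists (Tensor (epoly_tensor_subproof s)) => //.
rewrite /= tensor_function_epoly; apply: (A_ext r0) => w _.
by rewrite fs.
Qed.

End TensorCompletion.

(** * Density, epsilon product and approximation property *)

Theorem corollary7p6 (R : realType) (d : nat) (d_gt0 : (0 < d)%N)
    (E : tvsType R[i]) (E_hausdorff : hausdorff_space E)
    (E_nontrivial : exists x : E, x != 0)
    (I : Type) (p : I -> cseminorm E) (p_fund : directed_fundamental p)
    (E_lcomplete : locally_complete E)
    (z : 'rV[R[i]^o]_d) (r : 'I_d -> R) (r_gt0 : forall k, 0 < r k) :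
  [/\ poly_tensor z r E `<=` [set f : 'rV[R[i]^o]_d -> E | f \in A_pred z r E] /\
      dense [set f : A_space z r p |
        poly_tensor z r E (f : A_carrier z r E)],
      tvs_complete E ->
        topologically_isomorphic (A_space z r p)
          (eps_product (A_scalar z r) E) /\
        (exists (W : tvsType R[i])
           (j : {linear inj_tensor (A_scalar z r) E -> W}), is_completion j) /\
        (forall (W : tvsType R[i])
           (j : {linear inj_tensor (A_scalar z r) E -> W}), is_completion j ->
           topologically_isomorphic (eps_product (A_scalar z r) E) W)
    & approximation_property (A_scalar z r)].
Proof.
split; last exact: scalar_approximation_property.
  by split; [exact: (poly_tensor_in_A p_fund r_gt0)|exact: poly_tensor_dense].
move=> E_complete.
have iso := A_space_eps_product z r_gt0 E_hausdorff p_fund E_complete.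
have compl := tensor_function_completion z r_gt0 E_hausdorff p_fund E_complete.
split=> //; split; first by eexists; eexists; exact: compl.
move=> W j jc; apply: topologically_isomorphic_trans (completion_unique compl jc).
exact: topologically_isomorphic_sym.
Qed.
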